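(* Let $\alpha\in(0,1)$ and let $Z$ be a one-sided $\alpha$-stable process. Suppose $\phi:\mathbb{R}\to\mathbb{R}$ is continuous on $\mathbb{R}$, non-decreasing on $\mathbb{R}$, and (strictly) positive on $\mathbb{R}$. Then the solution to the stochastic differential equation $$dX_t=\phi(X_{t-})\,dZ_t$$ is pathwise unique.
   Context: Throughout, $(\Omega,\mathcal{F},\{\mathcal{F}_t\}_{t\ge 0},\mathbb{P})$ denotes a filtered probability space satisfying the usual conditions. For $\alpha\in(0,1)$, a one-sided $\alpha$-stable process $Z=(Z_t)_{t\ge0}$ is an $\{\mathcal{F}_t\}$-adapted càdlàg Lévy process with $Z_0=0$ (with $Z_t-Z_s$ independent of $\mathcal{F}_s$ for $s<t$) whose characteristic function is $$\mathbb{E}\,e^{iuZ_t}=\exp\Big\{t\int_0^\infty (e^{iuh}-1)\,\frac{c}{h^{1+\alpha}}\,dh\Big\},\qquad u\in\mathbb{R},\ t\ge 0,$$ where $c>0$ is a constant. In particular $Z$ has only positive jumps, is non-decreasing, has no continuous part, and $Z_t=\sum_{s\le t}\Delta Z_s$. A solution of $dX_t=\phi(X_{t-})\,dZ_t$ with initial value $x_0\in\mathbb{R}$ is a real-valued, càdlàg, $\{\mathcal{F}_t\}$-adapted process $X=(X_t)_{t\ge0}$ such that, $\mathbb{P}$-a.s., $X_t=x_0+\int_0^t\phi(X_{s-})\,dZ_s$ for all $t\ge 0$; here $\int_0^t\phi(X_{s-})\,dZ_s=\sum_{s\le t}\phi(X_{s-})\Delta Z_s$. Pathwise uniqueness means: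 whenever $X$ and $X'$ are two solutions on the same filtered probability space, driven by the same process $Z$ and with the same initial value $x_0\in\mathbb{R}$, then $\mathbb{P}(X_t=X'_t\text{ for all }t\ge0)=1$. *)

(* Defs.v *)
From HB Require Import structures.
From mathcomp Require Import all_boot all_order all_algebra.
From mathcomp Require Import complex.
From mathcomp Require Import all_classical all_reals all_analysis.

Set Implicit Arguments.
Unset Strict Implicit.
Unset Printing Implicit Defensive.

Import Order.TTheory GRing.Theory Num.Theory.
Import numFieldNormedType.Exports.

Local Open Scope classical_set_scope.
Local Open Scope ring_scope.
Local Open Scope complex_scope.

(* Time is [0, +oo[. Filtrations and processes are indexed by all of R, but
   every condition below only constrains (and only reads) them at t >= 0. *)

Definition cexp (R : realType) (z : R[i]) : R[i] :=
  (expR (complex.Re z) * cos (complex.Im z)) +i*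
  (expR (complex.Re z) * sin (complex.Im z)).

Definition cintegral d (T : measurableType d) (R : realType)
    (mu : {measure set T -> \bar R}) (D : set T) (f : T -> R[i]) : R[i] :=
  (\int[mu]_(x in D) complex.Re (f x)) +i* (\int[mu]_(x in D) complex.Im (f x)).

Section paths.
Variable R : realType.
Implicit Types x : R -> R.

Definition left_lim x (t : R) : R := lim (x s @[s --> t^'-]).

Definition jump x (t : R) : R := x t - left_lim x t.

Definition cadlag x : Prop :=
  (forall t : R, 0 <= t -> x s @[s --> t^'+] --> x t) /\
  (forall t : R, 0 < t -> cvg (x s @[s --> t^'-])).

(* Unordered sum of a real family. [esum] is meant for nonnegative families,
   so the positive and negative parts are summed separately; the result is
   finite exactly when the family is absolutely summable, because
   +oo - +oo = -oo in \bar R. *)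
Definition unordered_sum (D : set R) (f : R -> R) : \bar R :=
  (\esum_(s in D) (f^\+%R s)%:E - \esum_(s in D) (f^\-%R s)%:E)%E.

(* There is no jump at time 0, hence the sum over 0 < s <= t. *)
Definition jump_integral (h z : R -> R) (t : R) : \bar R :=
  unordered_sum `]0, t] (fun s => h s * jump z s).

End paths.

Section processes.
Context d (T : measurableType d) (R : realType).
Variables (P : probability T R) (F : R -> set (set T)).
Implicit Types X Z : R -> T -> R.

(* [usual_null] makes P complete as well: [P.-negligible A] only says that A
   is included in a measurable set of probability 0. *)
Record usual_conditions : Prop := UsualConditions {
  usual_sigma_algebra : forall t : R, 0 <= t -> sigma_algebra [set: T] (F t) ;
  usual_sub : forall t : R, 0 <= t -> F t `<=` measurable ;
  usual_mono : forall s t : R, 0 <= s -> s <= t -> F s `<=` F t ;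
  usual_right_continuous : forall t : R, 0 <= t ->
    F t = \bigcap_(s in [set s : R | t < s]) F s ;
  usual_null : forall A : set T, P.-negligible A -> F 0 A }.

Definition adapted X : Prop :=
  forall t : R, 0 <= t -> forall B : set R, measurable B -> F t (X t @^-1` B).

Definition independent_of (G : set (set T)) (Y : T -> R) : Prop :=
  forall (A : set T) (B : set R), G A -> measurable B ->
    P (A `&` Y @^-1` B) = (P A * P (Y @^-1` B))%E.

Definition eq_law (Y Y' : T -> R) : Prop :=
  forall B : set R, measurable B -> P (Y @^-1` B) = P (Y' @^-1` B).

Record cadlag_levy Z : Prop := CadlagLevy {
  levy_adapted : adapted Z ;
  levy_cadlag : forall w, cadlag (Z ^~ w) ;
  levy_start : {ae P, forall w, Z 0 w = 0} ;
  levy_indep : forall s t : R, 0 <= s -> s < t ->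
    independent_of (F s) (fun w => Z t w - Z s w) ;
  levy_stationary : forall s t : R, 0 <= s -> s < t ->
    eq_law (fun w => Z t w - Z s w) (Z (t - s)) }.

Definition char_fun (Y : T -> R) (u : R) : R[i] :=
  cintegral P [set: T] (fun w => cexp ((u * Y w) *i)).

Definition stable_exponent (c alpha u : R) : R[i] :=
  cintegral lebesgue_measure `]0, +oo[
    (fun h : R => (cexp ((u * h) *i) - 1) * (c / h `^ (1 + alpha))%:C).

Definition one_sided_stable (alpha : R) Z : Prop :=
  cadlag_levy Z /\
  exists2 c : R, 0 < c & forall u t : R, 0 <= t ->
    char_fun (Z t) u = cexp (t%:C * stable_exponent c alpha u).

Definition sde_solution (phi : R -> R) Z (x0 : R) X : Prop :=
  [/\ forall w, cadlag (X ^~ w),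
      adapted X &
      {ae P, forall w, forall t : R, 0 <= t ->
        ((X t w)%:E =
         x0%:E + jump_integral (fun s => phi (left_lim (X ^~ w) s)) (Z ^~ w) t)%E}].

Definition pathwise_unique (phi : R -> R) Z : Prop :=
  forall (x0 : R) (X X' : R -> T -> R),
    sde_solution phi Z x0 X -> sde_solution phi Z x0 X' ->
    P [set w | forall t : R, 0 <= t -> X t w = X' t w] = 1%E.

End processes.

(* Main.v *)
Require Import Defs.
From HB Require Import structures.
From mathcomp Require Import all_boot all_order all_algebra.
From mathcomp Require Import all_classical all_reals all_analysis.
From mathcomp Require Import complex measurable_realfun ring lra.

Set Implicit Arguments.
Unset Strict Implicit.
Unset Printing Implicit Defensive.

Import Order.TTheory GRing.Theory Num.Theory.
Import numFieldNormedType.Exports.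
Import ComplexField.Normc.

Local Open Scope classical_set_scope.
Local Open Scope ring_scope.

(** Two solutions X and X' of dX = phi(X-) dZ are compared with their maximum M.

    The driver Z is non-decreasing and moves by jumps only, so a solution
    satisfies X_t >= X_s + phi(X_s) (Z_t - Z_s), and its Euler sums over regular
    grids converge to its increments ([jump_solution_euler]). As phi is
    monotone, M has both properties too ([euler_path_max]), and M - X is
    non-decreasing ([euler_path_sub_monotone]).

    Let Y be X or M, and lam > 0. Along a grid of mesh delta, the sum of
    e^{- lam Y_k} (1 - e^{- lam phi(Y_k) dZ_k}) telescopes in the limit to
    e^{- lam x0}, since Y tends to infinity. The increment dZ_k is independent of Y_k
    and E e^{- c Z_t} = e^{- kappa t c^alpha}; with b = kappa phi^alpha, taking means
    gives, as delta tends to 0,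
      lam^alpha E int_0^oo e^{- lam Y_t} b(Y_t) dt = e^{- lam x0}
    ([total_cvg], [total_cell_cvg]). This identity holds for every Y of the
    class, so the occupation measures of X and M, weighted by b, have the same
    Laplace transforms at all integers lam >= 1. By the theorem of
    Weierstrass they integrate the function e^{- 2 v} / b(v) equally
    ([total_rate_cvg]), i.e. E int e^{- 2 X_t} dt = E int e^{- 2 M_t} dt. As X <= M, the
    two processes coincide ([euler_process_eq]). By symmetry X' = M.
    All this is done at the level of the grid, so that no
    integral over time appears.

    Three facts on Z have to be extracted from its characteristic function.
    - Increments are non-negative: the characteristic function is in the class
      of [one_sided] functions, which contains the exponentials of Levy exponents
      with positive jumps ([one_sided_levy]), and testing this class against
      Poisson kernels gives positivity ([one_sided_ge0]).
    - The Laplace transform: means of cos(u Z) determine those of e^{- lam |Z|}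
      ([cos_mean_laplace]); the scaling of the stable exponent and the
      independence of increments do the rest ([stable_laplace]).
    - There is no continuous part: the sum of the increments truncated at eta
      has mean of order eta^{1 - alpha} ([stable_pure_jump]). *)

(** * Polynomial approximation on the unit interval *)

(** Only continuity at the points of [a, b] is asked, for f defined on the whole
    line: this is the form that applies to the continuous part of a path. *)
Lemma heine_cantor (R : realType) (f : R -> R) (a b e : R) :
  (forall x, a <= x <= b -> {for x, continuous f}) -> 0 < e ->
  exists2 del : R, 0 < del & forall x y, a <= x <= b -> a <= y <= b ->
    `|x - y| < del -> `|f x - f y| < e.
Proof.
move=> cf e0.
have loc (x : R) : a <= x <= b -> exists2 r : R, 0 < r &
    forall x' d y : R, `|x - x'| < r / 2 -> d < r / 2 -> `|x' - y| < d ->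
      `|f x' - f y| < e.
  move=> xab; have /cvgrPdist_lt /(_ (e / 2)) := cf x xab.
  rewrite divr_gt0// => /(_ isT) [/= r r0 rf].
  have {}r0 : 0 < (r : R) := r0.
  exists r => // x' d y xx' dr x'y.
  have d1 : `|x - x'| < r by lra.
  have d2 : `|x - y| < r.
    have h : `|x - y| <= `|x - x'| + `|x' - y| := ler_distD x' x y.
    lra.
  have h1 : `|f x - f x'| < e / 2 by exact: rf.
  have h2 : `|f x - f y| < e / 2 by exact: rf.
  have h : `|f x' - f y| <= `|f x - f x'| + `|f x - f y|.
    by rewrite (distrC (f x)) ler_distD.
  lra.
have /compact_near_coveringP ncov := @segment_compact R a b.
have [] := ncov R (0^'+) (fun d x => forall y, a <= y <= b ->
  `|x - y| < d -> `|f x - f y| < e) _.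
- move=> x /= /[!in_itv]/= xab.
  have [r r0 rP] := loc x xab.
  exists (ball (x : R) (r / 2), [set d : R | d < r / 2]) => /=.
    split; first by apply: nbhsx_ballx; rewrite divr_gt0.
    by apply: nbhs_right_lt; rewrite divr_gt0.
  by move=> [x' d] /= [xx' dr] y yab; exact: rP.
- move=> d /= d0 Hd; exists (d / 2); first by rewrite divr_gt0.
  move=> x y xab yab xy; have := Hd (d / 2); rewrite /ball_ /= sub0r normrN.
  rewrite ger0_norm ?divr_ge0 ?ltW// => h.
  have /h : d / 2 < d by lra.
  by rewrite divr_gt0// => /(_ isT x); apply => //=; rewrite in_itv.
Qed.

Section bernstein.
Variable R : realType.

(** The Bernstein polynomial of the values g 0, ..., g n, i.e. the mean of g over a
    binomial variable. Conditioning on the first trial gives this recursion,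
    which makes positivity and the moment computation plain inductions. *)
Fixpoint bernstein (n : nat) (g : nat -> R) : {poly R} :=
  if n is m.+1 then (1 - 'X) * bernstein m g + 'X * bernstein m (g \o S)
  else (g 0%N)%:P.

Lemma bernstein_le n (g h : nat -> R) x : 0 <= x <= 1 ->
  (forall k, (k <= n)%N -> g k <= h k) ->
  (bernstein n g).[x] <= (bernstein n h).[x].
Proof.
move=> /andP[x0 x1]; elim: n g h => [|n IH] g h gh /=; first by rewrite !hornerE gh.
rewrite !hornerE lerD// ler_wpM2l// ?subr_ge0// IH// => k kn; apply: gh => //.
exact: leqW.
Qed.

(** First two moments of the binomial law, packed in one induction. *)
Lemma bernstein_quadratic n (c0 c1 c2 : R) x :
  (bernstein n (fun k => c0 + c1 * k%:R + c2 * k%:R ^+ 2)).[x] =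
  c0 + c1 * (n%:R * x) + c2 * ((n%:R * x) ^+ 2 + n%:R * x * (1 - x)).
Proof.
elim: n c0 c1 c2 => [|n IH] c0 c1 c2 /=; first by rewrite hornerC (_ : 0%:R = 0 :> R)//; ring.
rewrite !(hornerD, hornerN, hornerM, hornerX, hornerC) IH.
rewrite (_ : _ \o S = fun k => (c0 + c1 + c2) + (c1 + 2 * c2) * k%:R + c2 * k%:R ^+ 2).
  by rewrite IH -natr1; ring.
by apply/funext => k /=; rewrite -natr1; ring.
Qed.

(** With d the modulus of f at e / 2 and K a bound of f, one has
    |f x - f q| <= e / 2 + (2 K / d^2) (q - x)^2 for all q in [0, 1]; Bernstein's
    operator is monotone and maps the right-hand side, a quadratic in the
    index, to e / 2 plus a variance of order 1 / n. *)
Lemma weierstrass (f : R -> R) (e : R) : continuous f -> 0 < e ->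
  exists p : {poly R}, forall x, 0 <= x <= 1 -> `|f x - p.[x]| <= e.
Proof.
move=> cf e0.
have e2 : 0 < e / 2 by rewrite divr_gt0.
have [d d0 fd] := @heine_cantor R f 0 1 (e / 2) (fun x _ => cf x) e2.
have [K Kf] : exists K, forall x, 0 <= x <= 1 -> `|f x| <= K.
  have cn : {within `[0, 1], continuous (fun x => `|f x|)}.
    apply: continuous_subspaceT => x.
    by apply: (continuous_comp (cf x)); exact: norm_continuous.
  have [c _ cP] := @EVT_max R (fun x => `|f x|) 0 1 ler01 cn.
  by exists (`|f c|) => x x01; apply: cP; rewrite in_itv.
have K0 : 0 <= K.
  apply: le_trans (Kf 0 _); rewrite ?normr_ge0// lexx ler01//.
pose L := 2 * K / d ^+ 2.
have L0 : 0 <= L.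
  by apply: divr_ge0; [apply: mulr_ge0|exact: sqr_ge0].
have [n nL] : exists n, L <= e / 2 * n.+1%:R.
  exists (Num.truncn (L / (e / 2))).
  rewrite mulrC -ler_pdivrMr//; apply: ltW.
  by rewrite truncnS_gt.
exists (bernstein n.+1 (fun k => f (k%:R / n.+1%:R))) => x x01.
have n0 : (0 : R) < n.+1%:R by [].
have key k : (k <= n.+1)%N ->
    `|f x - f (k%:R / n.+1%:R)| <= e / 2 + L * (k%:R / n.+1%:R - x) ^+ 2.
  move=> kn.
  have k01 : 0 <= (k%:R / n.+1%:R : R) <= 1.
    by rewrite divr_ge0//= ler_pdivrMr// mul1r ler_nat.
  move: k01; set q := k%:R / n.+1%:R => k01.
  have [xk|xk] := ltP `|x - q| d.
    have h := fd _ _ x01 k01 xk.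
    have h2 : 0 <= L * (q - x) ^+ 2 by rewrite mulr_ge0// sqr_ge0.
    by apply: ltW; apply: lt_le_trans h _; rewrite lerDl.
  have h : `|f x - f (q)| <= 2 * K.
    have := ler_normB (f x) (f (q)).
    by have := Kf _ x01; have := Kf _ k01; move=> *; lra.
  have : 2 * K <= L * (q - x) ^+ 2.
    rewrite /L -mulrA ler_peMr// ?mulr_ge0//.
    rewrite mulrC ler_pdivlMr ?exprn_gt0// mul1r.
    rewrite -[leRHS]real_normK ?num_real// distrC.
    by rewrite lerXn2r// nnegrE ?normr_ge0// ltW.
  by move=> h2; apply: le_trans h _; apply: le_trans h2 _; rewrite lerDr ltW.
clearbody L.
pose c0 := e / 2 + L * x ^+ 2; pose c1 := - (2 * L * x / n.+1%:R).
pose c2 := L / n.+1%:R ^+ 2.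
have quad k : e / 2 + L * (k%:R / n.+1%:R - x) ^+ 2 = c0 + c1 * k%:R + c2 * k%:R ^+ 2.
  rewrite /c0 /c1 /c2; move: n0; set N : R := n.+1%:R => /lt0r_neq0 N0.
  by field.
have val : c0 + c1 * (n.+1%:R * x) + c2 * ((n.+1%:R * x) ^+ 2 + n.+1%:R * x * (1 - x))
    <= e.
  rewrite (_ : _ + _ = e / 2 + L * (x * (1 - x)) / n.+1%:R).
    suff h : L * (x * (1 - x)) / n.+1%:R <= e / 2.
      by apply: le_trans (lerD (lexx _) h) _; lra.
    rewrite ler_pdivrMr//; apply: le_trans nL.
    rewrite ler_piMr//; case/andP: x01 => x0 x1.
    by nra.
  rewrite /c0 /c1 /c2; move: n0; set N : R := n.+1%:R => /lt0r_neq0 N0.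
  by field.
clearbody c0 c1 c2.
have {}key k : (k <= n.+1)%N ->
    f x - (c0 + c1 * k%:R + c2 * k%:R ^+ 2) <= f (k%:R / n.+1%:R)
      <= f x + (c0 + c1 * k%:R + c2 * k%:R ^+ 2).
  by move=> kn; have := key k kn; rewrite quad distrC ler_distl.
rewrite distrC ler_distl; apply/andP; split.
  have h := @bernstein_le n.+1
    (fun k => (f x - c0) + (- c1) * k%:R + (- c2) * k%:R ^+ 2)
    (fun k => f (k%:R / n.+1%:R)) x x01.
  apply: le_trans (h _) => [|k kn].
    by rewrite bernstein_quadratic !mulNr -!addrA lerD2l -!opprD lerN2 !addrA.
  have /andP[+ _] := key k kn; apply: le_trans.
  by rewrite le_eqVlt; apply/orP; left; apply/eqP; ring.
have h := @bernstein_le n.+1 (fun k => f (k%:R / n.+1%:R))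
    (fun k => (f x + c0) + c1 * k%:R + c2 * k%:R ^+ 2) x x01.
apply: le_trans (h _) _ => [k kn|].
  by have /andP[_ +] := key k kn; rewrite !addrA.
by rewrite bernstein_quadratic -!addrA lerD2l !addrA.
Qed.

End bernstein.

(** * Jumps of monotone paths *)

Section jumps.
Variable R : realType.
Implicit Types (f z x : R -> R) (A : seq R).

Definition monotone_path f := forall s t, 0 <= s -> s <= t -> f s <= f t.

Lemma sum_le_esum (D : set R) f A : (forall r, D r -> 0 <= f r) -> uniq A ->
  (forall r, r \in A -> D r) ->
  ((\sum_(r <- A) f r)%:E <= \esum_(r in D) (f r)%:E)%E.
Proof.
move=> f0 uA AD; apply: esum_ge; exists [set` A].
  by split; [apply/finite_seqP; exists A|move=> r /=; exact: AD].
by rewrite -fsbig_seq// sumEFin.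
Qed.

(** A possibly infinite sum is approached from below by finite sums; all later
    arguments about jumps manipulate finite lists only. *)
Lemma esum_le_sum (D : set R) f (X e : R) : 0 < e ->
  (X%:E <= \esum_(r in D) (f r)%:E)%E ->
  exists A, [/\ uniq A, forall r, r \in A -> D r & X - e <= \sum_(r <- A) f r].
Proof.
move=> e0 XD.
have : ((X - e)%:E < \esum_(r in D) (f r)%:E)%E.
  by apply: lt_le_trans XD; rewrite lte_fin ltrBlDr ltrDl.
move=> /ereal_sup_gt[_ [B [finB BD]] <-] /ltW.
move: finB BD => /finite_fsetP[B' ->] BD.
rewrite fsbig_finite//= set_fsetK sumEFin lee_fin => h.
by exists (finmap.enum_fset B'); split; [exact: finmap.fset_uniq|exact: BD|exact: h].
Qed.

Lemma left_lim_cvg f t : cadlag f -> 0 < t -> f s @[s --> t^'-] --> left_lim f t.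
Proof. by move=> [_ cf] t0; exact: cf. Qed.

Lemma le_left_lim f s t : cadlag f -> monotone_path f -> 0 <= s -> s < t ->
  f s <= left_lim f t.
Proof.
move=> cf mf s0 st; have t0 : 0 < t by exact: le_lt_trans st.
apply: (cvgr_to_ge (left_lim_cvg cf t0)).
near=> u; apply: mf => //; apply: ltW; near: u; exact: nbhs_left_gt.
Unshelve. all: by end_near. Qed.

Lemma left_lim_le f t : cadlag f -> monotone_path f -> 0 < t ->
  left_lim f t <= f t.
Proof.
move=> cf mf t0; apply: (cvgr_to_le (left_lim_cvg cf t0)).
near=> u; apply: mf; apply: ltW; near: u; [exact: nbhs_left_gt|exact: nbhs_left_lt].
Unshelve. all: by end_near. Qed.

Lemma jump_ge0 f t : cadlag f -> monotone_path f -> 0 < t -> 0 <= jump f t.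
Proof. by move=> cf mf t0; rewrite subr_ge0 left_lim_le. Qed.

(** Sort the jump times; a path that is monotone climbs at least its jump at r
    between the previous time and r. *)
Lemma sum_jump_le f A s t : cadlag f -> monotone_path f -> 0 <= s -> s <= t ->
  uniq A -> (forall r, r \in A -> s < r <= t) ->
  \sum_(r <- A) jump f r <= f t - f s.
Proof.
move=> cf mf s0 st uA Ast.
have : perm_eq A (sort <=%R A) by rewrite perm_sym perm_sort.
move=> pA; rewrite (perm_big _ pA)/=.
have sA : sorted <%R (sort <=%R A).
  by rewrite lt_sorted_uniq_le sort_uniq uA sort_le_sorted.
have {}Ast r : r \in sort <=%R A -> s < r <= t by rewrite mem_sort; exact: Ast.
move: (sort _ A) sA Ast s0 st => {uA pA A} A.
elim: A s => [|r A IH] s /=; first by rewrite big_nil subr_ge0 => *; exact: mf.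
move=> rA Ast s0 st; rewrite big_cons.
have /andP[sr rt] := Ast r (mem_head _ _).
have r0 : 0 <= r by rewrite (le_trans s0)// ltW.
have h : \sum_(j <- A) jump f j <= f t - f r.
  apply: IH => //; first exact: path_sorted rA.
  move=> u uA; move: rA; rewrite (path_sortedE lt_trans) => /andP[/allP ru _].
  have /andP[_ ->] : s < u <= t by apply: Ast; rewrite inE uA orbT.
  by rewrite andbT; exact: ru.
have h2 := le_left_lim cf mf s0 sr.
by rewrite /jump; lra.
Qed.

(** For a non-negative integrand along a monotone path the negative part of the
    unordered sum vanishes. *)
Lemma jump_integralE (h z : R -> R) t : cadlag z -> monotone_path z ->
  (forall r, 0 < r -> 0 <= h r) ->
  jump_integral h z t = (\esum_(r in `]0%R, t]) (h r * jump z r)%:E)%E.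
Proof.
move=> cz mz h0; rewrite /jump_integral /unordered_sum.
have hz r : `]0%R, t]%classic r -> 0 <= h r * jump z r.
  by rewrite /= in_itv/= => /andP[r0 _]; rewrite mulr_ge0 ?h0 ?jump_ge0.
rewrite [X in (_ - X)%E]esum1 ?sube0.
  by apply: eq_esum => r /hz rz; congr EFin; rewrite /funrpos; apply/max_idPl.
by move=> r /hz rz; congr EFin; rewrite /funrneg; apply/max_idPr; rewrite oppr_le0.
Qed.

Lemma esum_itv_split (h : R -> R) s t : 0 <= s -> s <= t ->
  (forall r, 0 < r -> 0 <= h r) ->
  (\esum_(r in `]0%R, t]) (h r)%:E =
   \esum_(r in `]0%R, s]) (h r)%:E + \esum_(r in `]s, t]) (h r)%:E)%E.
Proof.
move=> s0 st h0.
rewrite (esumID `]0%R, s]%classic); last first.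
  by move=> r; rewrite /= in_itv/= => /andP[r0 _]; rewrite lee_fin h0.
congr (_ + _)%E; congr esum; apply/seteqP; split => r /=; rewrite !in_itv/=.
- by case.
- by move=> /andP[r0 rs]; rewrite r0 rs (le_trans rs).
- by move=> [/andP[-> ->]] /= /negP; rewrite -ltNge andbT.
- move=> /andP[sr rt]; rewrite rt (le_lt_trans s0 sr); split => //.
  by apply/negP; rewrite /= -ltNge.
Qed.

End jumps.

(** * Euler paths *)

Section euler_paths.
Variable R : realType.
Implicit Types (phi z x : R -> R).

Definition grid (s t : R) (n k : nat) : R := s + (t - s) * (k%:R / n%:R).

Lemma grid0 s t n : grid s t n 0 = s.
Proof. by rewrite /grid mul0r mulr0 addr0. Qed.

Lemma gridn s t n : grid s t n.+1 n.+1 = t.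
Proof. by rewrite /grid divff ?pnatr_eq0// mulr1 addrC subrK. Qed.

Lemma gridS s t n k : grid s t n k.+1 - grid s t n k = (t - s) / n%:R.
Proof. by rewrite /grid -natr1; ring. Qed.

Lemma le_grid s t n i j : s <= t -> (i <= j)%N -> grid s t n i <= grid s t n j.
Proof.
move=> st ij; rewrite /grid lerD2l ler_wpM2l ?subr_ge0//.
by rewrite ler_wpM2r ?invr_ge0// ler_nat.
Qed.

Lemma grid_ge s t n k : s <= t -> s <= grid s t n k.
Proof. by move=> st; rewrite -[leLHS](grid0 s t n) le_grid. Qed.

Lemma telescope_grid (f : R -> R) s t n :
  \sum_(k < n.+1) (f (grid s t n.+1 k.+1) - f (grid s t n.+1 k)) = f t - f s.
Proof.
rewrite -(big_mkord xpredT (fun k => f (grid s t n.+1 k.+1) - f (grid s t n.+1 k))).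
by rewrite (telescope_sumr (fun k => f (grid s t n.+1 k)))// gridn grid0.
Qed.

Definition euler_sum phi z x s t n : R :=
  \sum_(k < n) phi (x (grid s t n k)) * (z (grid s t n k.+1) - z (grid s t n k)).

(** What survives of dx = phi(x-) dz for a supersolution: phi (x r) >= phi (x s)
    after time s. *)
Definition euler_super phi z x := forall s t, 0 <= s -> s <= t ->
  x s + phi (x s) * (z t - z s) <= x t.

(** A substitute for solutions of dx = phi(x-) dz that is closed under maximum.
    Solutions are Euler paths, and the proof of uniqueness uses nothing else of
    them; whether the maximum of two solutions is again a solution never has to
    be decided. *)
Definition euler_path phi z x := euler_super phi z x /\
  (forall s t, 0 <= s -> s <= t ->
    euler_sum phi z x s t n.+1 @[n --> \oo] --> x t - x s).

Lemma euler_super_monotone phi z x : (forall u, 0 < phi u) -> monotone_path z ->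
  euler_super phi z x -> monotone_path x.
Proof.
move=> phi0 mz ex s t s0 st; apply: le_trans (ex _ _ s0 st).
by rewrite lerDl mulr_ge0 ?subr_ge0 ?mz// ltW.
Qed.

Lemma euler_sum_le phi z x s t n : euler_super phi z x -> 0 <= s -> s <= t ->
  euler_sum phi z x s t n.+1 <= x t - x s.
Proof.
move=> ex s0 st; rewrite -(telescope_grid x s t n); apply: ler_sum => k _.
by rewrite lerBrDl ex// ?le_grid// (le_trans s0)// grid_ge.
Qed.

Section max.
Variables (phi z x y : R -> R).
Hypothesis mphi : forall u v, u <= v -> phi u <= phi v.
Hypothesis mz : monotone_path z.
Let hi t := Num.max (x t) (y t).
Let lo t := Num.min (x t) (y t).

Lemma euler_super_max : euler_super phi z x -> euler_super phi z y ->
  euler_super phi z hi.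
Proof.
move=> ex ey s t s0 st; rewrite /hi; case: (leP (x s) (y s)) => _.
  by apply: le_trans (ey _ _ s0 st) _; rewrite le_max lexx orbT.
by apply: le_trans (ex _ _ s0 st) _; rewrite le_max lexx.
Qed.

Lemma euler_super_min : euler_super phi z x -> euler_super phi z y ->
  euler_super phi z lo.
Proof.
move=> ex ey s t s0 st; rewrite /lo le_min; apply/andP; split.
- apply: le_trans (ex _ _ s0 st); rewrite lerD ?ge_min ?lexx//.
  by rewrite ler_wpM2r ?subr_ge0 ?mz// mphi// ge_min lexx.
- apply: le_trans (ey _ _ s0 st); rewrite lerD ?ge_min ?lexx ?orbT//.
  by rewrite ler_wpM2r ?subr_ge0 ?mz// mphi// ge_min lexx orbT.
Qed.

(** phi being monotone, minimum and maximum are both Euler supersolutions, so each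
    of their Euler sums is at most the corresponding increment. The two Euler
    sums add up to those of x and y, whose limits are the increments of x and
    y, and x + y = max + min: no loss is possible in either inequality. *)
Lemma euler_path_max : euler_path phi z x -> euler_path phi z y ->
  euler_path phi z hi.
Proof.
move=> [ex cx] [ey cy]; have ehi := euler_super_max ex ey.
split => // s t s0 st.
have elo := euler_super_min ex ey.
have maxmin u v : Num.max u v + Num.min u v = u + v :> R by rewrite addr_max_min.
have sumE n : euler_sum phi z hi s t n + euler_sum phi z lo s t n =
    euler_sum phi z x s t n + euler_sum phi z y s t n.
  rewrite -!big_split/=; apply: eq_bigr => k _; rewrite -!mulrDl; congr (_ * _).
  by rewrite /hi /lo; case: leP => _ //; rewrite addrC.
apply: (@squeeze_cvgr _ _ _ _
   (fun n => euler_sum phi z x s t n.+1 + euler_sum phi z y s t n.+1 - (lo t - lo s))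
   (cst (hi t - hi s))).
- apply: nearW => n; rewrite euler_sum_le// andbT -sumE -addrA gerDl subr_le0.
  exact: euler_sum_le.
- rewrite (_ : hi t - hi s = (x t - x s) + (y t - y s) - (lo t - lo s)).
    by apply: cvgB; [apply: cvgD; [exact: cx|exact: cy]|exact: cvg_cst].
  by have := maxmin (x t) (y t); have := maxmin (x s) (y s); rewrite /hi /lo; lra.
- exact: cvg_cst.
Qed.

(** Term by term comparison of the Euler sums: phi (x r) <= phi (y r). *)
Lemma euler_path_sub_monotone : euler_path phi z x -> euler_path phi z y ->
  (forall t, 0 <= t -> x t <= y t) -> monotone_path (fun t => y t - x t).
Proof.
move=> [ex cx] [ey cy] xy s t s0 st.
suff : x t - x s <= y t - y s by lra.
apply: ler_cvg_to (cx _ _ s0 st) (cy _ _ s0 st) _; apply: nearW => n.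
apply: ler_sum => k _.
have g0 : 0 <= grid s t n.+1 k by rewrite (le_trans s0)// grid_ge.
by rewrite ler_wpM2r ?subr_ge0 ?mz ?le_grid// mphi// xy.
Qed.

End max.

Section jump_solution.
Variables (phi z x : R -> R) (x0 : R).
Hypothesis phic : continuous phi.
Hypothesis mphi : forall u v, u <= v -> phi u <= phi v.
Hypothesis phi0 : forall u, 0 < phi u.
Hypothesis mz : monotone_path z.
Hypothesis cz : cadlag z.
Hypothesis pz : forall s t, 0 <= s -> s <= t ->
  ((z t - z s)%:E <= \esum_(r in `]s, t]) (jump z r)%:E)%E.
Hypothesis cx : cadlag x.
Hypothesis xE : forall t, 0 <= t -> ((x t)%:E =
  x0%:E + jump_integral (fun r => phi (left_lim x r)) z t)%E.

Lemma jump_solution0 : x 0 = x0.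
Proof.
have := xE (lexx 0); rewrite jump_integralE//; last by move=> r _; exact: ltW.
by rewrite set_itvoc0 esum_set0 adde0 => -[].
Qed.

Lemma jump_solution_incr s t : 0 <= s -> s <= t -> ((x t - x s)%:E =
  \esum_(r in `]s, t]) (phi (left_lim x r) * jump z r)%:E)%E.
Proof.
move=> s0 st.
have h0 r : 0 < r -> 0 <= phi (left_lim x r) * jump z r.
  by move=> r0; rewrite mulr_ge0 ?jump_ge0// ltW.
have := xE (le_trans s0 st); have := xE s0.
rewrite !jump_integralE//; try by move=> r _; exact: ltW.
rewrite (esum_itv_split s0 st h0).
case: (\esum_(r in `]0%R, s]) _)%E => [u| |] //= -[->].
case: (\esum_(r in `]s, t]) _)%E => [v| |] //= -[->].
by congr EFin; ring.
Qed.

Let x_monotone : monotone_path x.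
Proof.
move=> s t s0 st; rewrite -subr_ge0 -lee_fin jump_solution_incr//.
apply: esum_ge0 => r; rewrite /= in_itv/= => /andP[sr _].
by rewrite lee_fin mulr_ge0 ?jump_ge0 ?(le_lt_trans s0)// ltW.
Qed.

(** Between s and t the integrand is at least phi (x s), and z has no continuous
    part, so its jumps exhaust the increment of z. *)
Lemma jump_solution_super : euler_super phi z x.
Proof.
move=> s t s0 st; rewrite addrC -lerBrDr.
apply/ler_addgt0Pr => e e0.
have e1 : 0 < e / phi (x s) by rewrite divr_gt0.
have [A [uA Ast Az]] := esum_le_sum e1 (pz s0 st).
have : phi (x s) * \sum_(r <- A) jump z r <= x t - x s.
  rewrite -lee_fin (jump_solution_incr s0 st).
  apply: le_trans (@sum_le_esum _ _ (fun r => phi (left_lim x r) * jump z r) _ _ uA Ast).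
    rewrite lee_fin mulr_sumr big_seq [leRHS]big_seq; apply: ler_sum => r /Ast.
    rewrite /= in_itv/= => /andP[sr _]; rewrite ler_wpM2r ?jump_ge0//.
      exact: le_lt_trans sr.
    by apply: mphi; exact: le_left_lim.
  move=> r /=; rewrite in_itv/= => /andP[sr _].
  by rewrite mulr_ge0 ?jump_ge0 ?(le_lt_trans s0)// ltW.
move=> h; apply: le_trans (lerD h (lexx e)).
move: Az; rewrite -(ler_pM2l (phi0 (x s))) mulrBr mulrCA divff ?gt_eqF// mulr1.
by rewrite lerBlDr.
Qed.

(** The sum has one term, the left end of the cell that contains r, and that left
    end tends to r from the left. Writing it as a sum over all cells lets it be
    exchanged with a sum over jumps. *)
Lemma cell_sum_ge (s t r e : R) : 0 <= s -> s < r <= t -> 0 < e ->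
  \forall n \near \oo, phi (left_lim x r) - e <=
    \sum_(k < n.+1 | grid s t n.+1 k < r <= grid s t n.+1 k.+1)
      phi (x (grid s t n.+1 k)).
Proof.
move=> s0 /andP[sr rt] e0.
have r0 : 0 < r by exact: le_lt_trans sr.
have ts : 0 < t - s by rewrite subr_gt0 (lt_le_trans sr).
have : phi (x u) @[u --> r^'-] --> phi (left_lim x r).
  by apply: continuous_cvg; [exact: phic|exact: left_lim_cvg].
move=> /cvgrPdist_le/(_ e e0)[/= d d0 dP].
have d0' : 0 < (d : R) := d0.
have dts : 0 < (d : R) / (t - s) by rewrite divr_gt0.
near=> n.
have dn : (t - s) / n.+1%:R < d.
  rewrite mulrC -ltr_pdivlMr//; near: n.
  exact: (near_infty_natSinv_lt (PosNum dts)).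
have [k kn /andP[k1 k2]] : exists2 k, (k < n.+1)%N &
    grid s t n.+1 k < r <= grid s t n.+1 k.+1.
  have ex : exists k, r <= grid s t n.+1 k by exists n.+1; rewrite gridn.
  case: (ex_minnP ex) => -[|k] rk kmin; first by move: rk; rewrite grid0 leNgt sr.
  exists k; first by apply: kmin; rewrite gridn.
  by rewrite rk andbT ltNge; apply/negP => /kmin; rewrite ltnn.
rewrite (bigD1 (Ordinal kn))/= ?k1 ?k2//.
apply: (@le_trans _ _ (phi (x (grid s t n.+1 k)))).
  have gr : grid s t n.+1 k < r by [].
  have := dP (grid s t n.+1 k) _ gr; rewrite ler_distlC => h.
  have /h/andP[] : ball_ [eta Num.Def.normr] r d (grid s t n.+1 k).
    rewrite /ball_/= ger0_norm ?subr_ge0 ?ltW//; apply: le_lt_trans dn.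
    by rewrite -(gridS s t n.+1 k) lerB.
  by [].
by rewrite lerDl; apply: sumr_ge0 => i _; exact: ltW.
Unshelve. all: by end_near. Qed.

(** Group the jumps of A by cells: in each cell they sum to at most the increment
    of z. *)
Lemma cell_sum_le (A : seq R) s t n : 0 <= s -> s <= t -> uniq A ->
  \sum_(r <- A) (\sum_(k < n.+1 | grid s t n.+1 k < r <= grid s t n.+1 k.+1)
      phi (x (grid s t n.+1 k))) * jump z r <= euler_sum phi z x s t n.+1.
Proof.
move=> s0 st uA.
under eq_bigr do rewrite mulr_suml big_mkcond/=.
rewrite exchange_big/=; apply: ler_sum => k _.
rewrite -big_mkcond/= -mulr_sumr ler_wpM2l ?(ltW (phi0 _))//.
rewrite -big_filter; apply: sum_jump_le => //.
- by rewrite (le_trans s0)// grid_ge.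
- exact: le_grid.
- exact: filter_uniq.
- by move=> r; rewrite mem_filter => /andP[].
Qed.

(** Euler sums are at most the increment by the supersolution property; from below,
    finitely many jumps carry the increment of x up to e / 2, and for these
    jumps the left end of the cell replaces the left limit. *)
Lemma jump_solution_euler : euler_path phi z x.
Proof.
split; first exact: jump_solution_super.
move=> s t s0 st; apply/cvgrPdist_le => e e0.
have e2 : 0 < e / 2 by rewrite divr_gt0.
have xst : ((x t - x s)%:E <=
  \esum_(r in `]s, t]) (phi (left_lim x r) * jump z r)%:E)%E.
  by rewrite (jump_solution_incr s0 st).
have [A [uA Ast Ax]] := esum_le_sum e2 xst.
have {}Ast r : r \in A -> s < r <= t by move=> /Ast; rewrite /= in_itv.
have zst : 0 <= z t - z s by rewrite subr_ge0 mz.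
pose c := e / 2 / (z t - z s + 1).
have c0 : 0 < c by rewrite divr_gt0// ltr_wpDl.
have cz2 : c * (z t - z s) <= e / 2.
  by rewrite /c mulrAC ler_pdivrMr ?ltr_wpDl// ler_wpM2l ?(ltW e2)// lerDl.
clearbody c.
have nA : \forall n \near \oo,
    \sum_(r <- A) (phi (left_lim x r) - c) * jump z r <=
    \sum_(r <- A) (\sum_(k < n.+1 | grid s t n.+1 k < r <= grid s t n.+1 k.+1)
      phi (x (grid s t n.+1 k))) * jump z r.
  have h r : r \in A -> \forall n \near \oo, (phi (left_lim x r) - c) * jump z r <=
    (\sum_(k < n.+1 | grid s t n.+1 k < r <= grid s t n.+1 k.+1)
      phi (x (grid s t n.+1 k))) * jump z r.
    move=> /Ast srt; have /andP[sr _] := srt.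
    apply: filterS (cell_sum_ge s0 srt c0) => n.
    by move=> /ler_wpM2r; apply; rewrite jump_ge0// (le_lt_trans s0).
  move: A h {uA Ast Ax} => A; elim: A => [|r A IH] h.
    by apply: nearW => n; rewrite !big_nil.
  apply: filterS2 (h r (mem_head _ _)) (IH _) => [n h1 h2|r' r'A].
    by rewrite !big_cons lerD.
  by apply: h; rewrite inE r'A orbT.
apply: filterS nA => n nA.
have h1 := cell_sum_le n s0 st uA.
have h2 := euler_sum_le n jump_solution_super s0 st.
have h3 := sum_jump_le cz mz s0 st uA Ast.
rewrite ger0_norm ?subr_ge0// lerBlDr -lerBlDl.
apply: le_trans h1; apply: le_trans nA.
have -> : \sum_(r <- A) (phi (left_lim x r) - c) * jump z r =
  \sum_(r <- A) phi (left_lim x r) * jump z r - c * \sum_(r <- A) jump z r.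
  by rewrite mulr_sumr -sumrB; apply: eq_bigr => r _; rewrite mulrBl.
have h4 : c * \sum_(r <- A) jump z r <= c * (z t - z s) by rewrite ler_wpM2l// ltW.
by lra.
Qed.

End jump_solution.

End euler_paths.

(** * Exponential sums along an Euler path, and the continuous part of a monotone path *)

Section exponential_sums.
Variable R : realType.
Implicit Types (phi z x : R -> R).

(** The Euler sum of the image of x under u |-> - e^{- lam u}. Using
    1 - e^{- lam phi dz} rather than lam phi dz keeps it bounded and makes
    conditional means computable from the Laplace transform of z. *)
Definition exp_sum phi z x (lam s t : R) n : R :=
  \sum_(k < n) expR (- lam * x (grid s t n k)) *
    (1 - expR (- (lam * phi (x (grid s t n k))) *
                 (z (grid s t n k.+1) - z (grid s t n k)))).

Section bounds.
Variables (phi z x : R -> R) (lam s t : R) (n : nat).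
Hypothesis phi0 : forall u, 0 < phi u.
Hypothesis mz : monotone_path z.
Hypothesis ex : euler_super phi z x.
Hypotheses (lam0 : 0 < lam) (s0 : 0 <= s) (st : s <= t).
Let g := grid s t n.+1.

Lemma exp_sum_term_le k : (k <= n)%N ->
  expR (- lam * x (g k)) * (1 - expR (- (lam * phi (x (g k))) * (z (g k.+1) - z (g k))))
  <= - expR (- lam * x (g k.+1)) - - expR (- lam * x (g k)).
Proof.
move=> kn.
have g0 : 0 <= g k by rewrite (le_trans s0)// grid_ge.
have gg : g k <= g k.+1 by exact: le_grid.
have := ex g0 gg => h.
rewrite mulrBr mulr1 -expRD opprK addrC lerD2r lerN2 ler_expR.
have : lam * (x (g k) + phi (x (g k)) * (z (g k.+1) - z (g k))) <= lam * x (g k.+1).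
  by rewrite ler_pM2l.
by lra.
Qed.

(** Telescoping: the supersolution inequality on each cell bounds each term by
    the increment of - e^{- lam x}. *)
Lemma exp_sum_le :
  exp_sum phi z x lam s t n.+1 <= expR (- lam * x s) - expR (- lam * x t).
Proof.
rewrite (_ : expR _ - _ = \sum_(k < n.+1)
    (- expR (- lam * x (g k.+1)) - - expR (- lam * x (g k)))); last first.
  by rewrite (telescope_grid (fun u => - expR (- lam * x u))) opprK addrC.
by apply: ler_sum => k _; apply: exp_sum_term_le; rewrite -ltnS.
Qed.

(** The loss in a cell is at most lam e^{- lam x_s} times the gap between the
    increment of x and its Euler approximation, since 1 - e^{- a} <= a. *)
Lemma exp_sum_ge :
  expR (- lam * x s) - expR (- lam * x t)
  - lam * expR (- lam * x s) * (x t - x s - euler_sum phi z x s t n.+1) <=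
  exp_sum phi z x lam s t n.+1.
Proof.
rewrite lerBlDr (_ : expR _ - _ = \sum_(k < n.+1)
    (- expR (- lam * x (g k.+1)) - - expR (- lam * x (g k)))); last first.
  by rewrite (telescope_grid (fun u => - expR (- lam * x u))) opprK addrC.
rewrite -(telescope_grid x s t n) /euler_sum -sumrB mulr_sumr -big_split/=.
apply: ler_sum => k _.
have g0 : 0 <= g k by rewrite (le_trans s0)// grid_ge.
have gg : g k <= g k.+1 by exact: le_grid.
have xs : x s <= x (g k).
  by apply: (euler_super_monotone phi0 mz ex) => //; exact: grid_ge.
rewrite -/(g k) -/(g k.+1).
move: (ex g0 gg) xs; set a := x (g k); set c := x (g k.+1) => aqc xs.
have : 0 <= phi a * (z (g k.+1) - z (g k)).
  by rewrite mulr_ge0 ?(ltW (phi0 _))// subr_ge0 mz.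
set D := z _ - z _.
rewrite (_ : - (lam * phi a) * D = - lam * (phi a * D)); last by ring.
move: aqc; rewrite -/D; set q := phi a * D => aqc q0.
rewrite mulrBr mulr1 -expRD.
rewrite (_ : - lam * a + - lam * q = - lam * (a + q)); last by ring.
have h : expR (- lam * (a + q)) - expR (- lam * c) <=
    lam * expR (- lam * x s) * (c - a - q).
  rewrite (_ : - lam * c = - lam * (a + q) + (- lam * (c - a - q))); last by ring.
  rewrite expRD -{1}[expR (- lam * (a + q))]mulr1 -mulrBr.
  rewrite [lam * _]mulrC -mulrA ler_pM ?expR_ge0//.
  - rewrite subr_ge0 -expR0 ler_expR mulNr oppr_le0 mulr_ge0 ?(ltW lam0)//.
    by lra.
  - by rewrite ler_expR ler_nM2l ?oppr_lt0//; lra.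
  - have h := expR_ge1Dx (- lam * (c - a - q)).
    by lra.
by lra.
Qed.

End bounds.

Lemma exp_sum_cvg phi z x (lam s t : R) : (forall u, 0 < phi u) ->
  monotone_path z -> euler_path phi z x -> 0 < lam -> 0 <= s -> s <= t ->
  exp_sum phi z x lam s t n.+1 @[n --> \oo] -->
  expR (- lam * x s) - expR (- lam * x t).
Proof.
move=> phi0 mz [ex cx] lam0 s0 st.
apply: (@squeeze_cvgr _ _ _ _ (fun n => expR (- lam * x s) - expR (- lam * x t)
  - lam * expR (- lam * x s) * (x t - x s - euler_sum phi z x s t n.+1))
  (cst (expR (- lam * x s) - expR (- lam * x t)))).
- by apply: nearW => n; rewrite exp_sum_le// exp_sum_ge.
- rewrite -[X in _ --> X]subr0; apply: cvgB; first exact: cvg_cst.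
  rewrite -[X in _ --> X](mulr0 (lam * expR (- lam * x s))).
  apply: cvgM; first exact: cvg_cst.
  rewrite -[X in _ --> X](subrr (x t - x s)).
  by apply: cvgB; [exact: cvg_cst|exact: cx].
- exact: cvg_cst.
Qed.

End exponential_sums.

Section drift.
Variable R : realType.
Variable z : R -> R.
Hypothesis cz : cadlag z.
Hypothesis mz : monotone_path z.

Lemma esum_le_bound (D : set R) (f : R -> R) (c : R) :
  (forall A, uniq A -> (forall r, r \in A -> D r) -> \sum_(r <- A) f r <= c) ->
  (\esum_(r in D) (f r)%:E <= c%:E)%E.
Proof.
move=> h; apply: ge_ereal_sup => _ [B [finB BD] <-].
move: finB BD => /finite_fsetP[B' ->] BD.
rewrite fsbig_finite//= set_fsetK sumEFin lee_fin; apply: h => //.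
exact: finmap.fset_uniq.
Qed.

(** With C = z - jump_part z this splits a monotone path into a continuous part and
    a jump part, both monotone. *)
Definition jump_part (t : R) : R := fine (\esum_(r in `]0%R, t]) (jump z r)%:E)%E.

Let jump_part0 : jump_part 0 = 0.
Proof. by rewrite /jump_part set_itvoc0 esum_set0. Qed.

Let esum_jump_ge0 (s t : R) : 0 <= s ->
  (0 <= \esum_(r in `]s, t]) (jump z r)%:E)%E.
Proof.
move=> s0; apply: esum_ge0 => r; rewrite /= in_itv/= => /andP[sr _].
by rewrite lee_fin jump_ge0// (le_lt_trans s0).
Qed.

Let esum_jump_le (s t : R) : 0 <= s -> s <= t ->
  (\esum_(r in `]s, t]) (jump z r)%:E <= (z t - z s)%:E)%E.
Proof.
move=> s0 st; apply: esum_le_bound => A uA Ast; apply: sum_jump_le => //.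
Qed.

Let esum_jump_fin (s t : R) : 0 <= s -> s <= t ->
  (\esum_(r in `]s, t]) (jump z r)%:E)%E \is a fin_num.
Proof.
move=> s0 st; rewrite ge0_fin_numE ?esum_jump_ge0//.
by apply: le_lt_trans (esum_jump_le s0 st) _; rewrite ltry.
Qed.

Lemma esum_jump_incr s t : 0 <= s -> s <= t ->
  (\esum_(r in `]s, t]) (jump z r)%:E = (jump_part t - jump_part s)%:E)%E.
Proof.
move=> s0 st; rewrite /jump_part (@esum_itv_split _ (jump z) _ _ s0 st); last first.
  by move=> r r0; exact: jump_ge0.
by rewrite fineD ?esum_jump_fin// addrAC subrr add0r fineK// esum_jump_fin.
Qed.

Let C t := z t - jump_part t.

Let C_mono (s t : R) : 0 <= s -> s <= t -> C s <= C t.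
Proof.
move=> s0 st; have := esum_jump_le s0 st; rewrite esum_jump_incr// lee_fin /C.
by move=> h; lra.
Qed.

Let C_incr (s t : R) : 0 <= s -> s <= t -> C t - C s <= z t - z s.
Proof.
move=> s0 st; have := @esum_jump_ge0 s t s0; rewrite esum_jump_incr// lee_fin /C.
by move=> h; lra.
Qed.

(** The jump at t is counted by jump_part, so C increases at most like z before
    the jump. *)
Let C_left (s t : R) : 0 <= s -> s < t -> C t - C s <= left_lim z t - z s.
Proof.
move=> s0 st.
have t0 : 0 < t by exact: le_lt_trans st.
have : jump z t <= jump_part t - jump_part s.
  rewrite -lee_fin -(esum_jump_incr s0 (ltW st)).
  have := @sum_le_esum R `]s, t]%classic (jump z) [:: t].
  rewrite big_seq1; apply => //.
    by move=> r; rewrite /= in_itv/= => /andP[sr _]; rewrite jump_ge0// (le_lt_trans s0).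
  by move=> r; rewrite inE => /eqP ->; rewrite /= in_itv/= st lexx.
by rewrite /C /jump => h; lra.
Qed.

(** C is extended by its value at 0 to the negative times, where z is not
    controlled. *)
Let C_cont (t : R) : {for t, continuous (fun u : R => C (Num.max u 0) : R)}.
Proof.
apply/cvgrPdist_lt => e e0.
have right_ : 0 <= t -> exists2 d : R, 0 < d & forall u, t < u -> u < t + d ->
    C u - C t < e.
  move=> t0; have /cvgrPdist_lt/(_ e e0)[/= d d0 dP] := cz.1 t t0.
  exists (d : R) => // u tu ud.
  apply: le_lt_trans (C_incr t0 (ltW tu)) _.
  have := dP u; rewrite /ball_/= distrC ger0_norm; last by rewrite subr_ge0 ltW.
  rewrite distrC ger0_norm; last by rewrite subr_ge0 mz// ltW.
  by apply => //; rewrite ltrBlDl.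
have left_ : 0 < t -> exists2 d : R, 0 < d & forall u, 0 <= u -> u < t -> t - d < u ->
    C t - C u < e.
  move=> t0; have /cvgrPdist_lt/(_ e e0)[/= d d0 dP] := left_lim_cvg cz t0.
  exists (d : R) => // u u0 ut ud.
  apply: le_lt_trans (C_left u0 ut) _.
  have := dP u; rewrite /ball_/= ger0_norm; last by rewrite subr_ge0 ltW.
  rewrite ger0_norm; last by rewrite subr_ge0 le_left_lim.
  by apply => //; rewrite ltrBlDl -ltrBlDr.
have [t0|t0] := ltP t 0.
  near=> u; rewrite (max_idPr _) ?subrr ?normr0 ?ltW//.
  by near: u; exact: lt_nbhsl.
have [d d0 dP] := right_ t0.
have [d' d'0 d'P] : exists2 d' : R, 0 < d' & forall u, u < t -> t - d' < u ->
    C t - C (Num.max u 0) < e.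
  move: t0; rewrite le_eqVlt => /orP[/eqP t0|t0].
    by exists 1 => // u ut _; rewrite -t0 in ut *; rewrite (max_idPr (ltW ut)) subrr.
  have [d' d'0 d'P] := left_ t0.
  exists d' => // u ut ud; apply: d'P.
  - by rewrite le_max lexx orbT.
  - by rewrite gt_max ut.
  - by rewrite lt_max ud.
near=> u.
have ud : u < t + d by near: u; apply: lt_nbhsl; rewrite ltrDl.
have ud' : t - d' < u by near: u; apply: lt_nbhsr; rewrite gtrBl.
have [ut|ut|->] := ltgtP u t.
- rewrite ger0_norm; first exact: d'P.
  by rewrite subr_ge0 C_mono// ?le_max ?lexx ?orbT// ge_max ltW.
- rewrite (max_idPl _) ?(ltW (le_lt_trans t0 ut))// distrC ger0_norm; first exact: dP.
  by rewrite subr_ge0 C_mono// ltW.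
- by rewrite (max_idPl t0) subrr normr0.
Unshelve. all: by end_near. Qed.

(** C is uniformly continuous, hence on a fine grid its increments are at most
    eta; they are also at most those of z. A path with a drift thus has truncated
    increments whose sum does not vanish with eta. *)
Lemma cont_part_le (T eta : R) : 0 <= T -> 0 < eta ->
  \forall n \near \oo, z T - z 0 - jump_part T <=
    \sum_(k < n.+1) Num.min (z (grid 0 T n.+1 k.+1) - z (grid 0 T n.+1 k)) eta.
Proof.
move=> T0 eta0.
have [d d0 dP] := heine_cantor (a := 0) (b := T) (fun x _ => @C_cont x) eta0.
have dts : 0 < d / (T + 1) by rewrite divr_gt0// ltr_wpDl.
near=> n.
have dn : T / n.+1%:R < d.
  apply: (@le_lt_trans _ _ ((T + 1) / n.+1%:R)).
    by rewrite ler_wpM2r ?invr_ge0// lerDl.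
  rewrite mulrC -ltr_pdivlMr ?ltr_wpDl//; near: n.
  exact: (near_infty_natSinv_lt (PosNum dts)).
have -> : z T - z 0 - jump_part T = C T - C 0.
  by rewrite /C jump_part0; ring.
rewrite -(telescope_grid C 0 T n); apply: ler_sum => k _.
have g0 : 0 <= grid 0 T n.+1 k by exact: grid_ge.
have gg : grid 0 T n.+1 k <= grid 0 T n.+1 k.+1 by exact: le_grid.
have gT : grid 0 T n.+1 k.+1 <= T.
  by rewrite -[leRHS](gridn 0 T n); apply: le_grid.
rewrite le_min C_incr//=; apply: ltW.
have := dP (grid 0 T n.+1 k.+1) (grid 0 T n.+1 k).
have g1 := le_trans g0 gg.
rewrite (max_idPl g0) (max_idPl g1) g0 g1 gT (le_trans gg gT) => /(_ isT isT).
rewrite gridS subr0 [X in X < d -> _]ger0_norm; last by rewrite divr_ge0.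
by move=> /(_ dn); apply: le_lt_trans; exact: ler_norm.
Unshelve. all: by end_near. Qed.

Lemma pure_jump : (forall T : nat, z T%:R - z 0 - jump_part T%:R <= 0) ->
  forall s t, 0 <= s -> s <= t ->
    ((z t - z s)%:E <= \esum_(r in `]s, t]) (jump z r)%:E)%E.
Proof.
move=> pj s t s0 st; rewrite esum_jump_incr// lee_fin.
suff : C t <= C s by rewrite /C => h; lra.
have C0 : C 0 = z 0 by rewrite /C jump_part0 subr0.
apply: (@le_trans _ _ (C 0)); last exact: C_mono.
have [n tn] : exists n : nat, t <= n%:R.
  by exists (Num.truncn t).+1; apply: ltW; rewrite truncnS_gt.
apply: (le_trans (C_mono (le_trans s0 st) tn)).
by rewrite C0; have := pj n; rewrite /C => h; lra.
Qed.

End drift.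

(** * Means of bounded variables and independence *)

Section dominated.
Context d (T : measurableType d) (R : realType).
Variables (mu : {measure set T -> \bar R}) (D : set T).

Lemma Rintegral_dominated_cvg (f_ : (T -> R)^nat) (f g : T -> R) : measurable D ->
  (forall n, measurable_fun D (f_ n)) -> measurable_fun D f ->
  {ae mu, forall x, D x -> f_ n x @[n --> \oo] --> f x} ->
  mu.-integrable D (EFin \o g) ->
  (forall n x, D x -> `|f_ n x| <= g x) ->
  \int[mu]_(x in D) f_ n x @[n --> \oo] --> \int[mu]_(x in D) f x.
Proof.
move=> mD mf_ mf ff ig fg.
have [i1 _ i2] : [/\ mu.-integrable D (EFin \o f),
    [sequence \int[mu]_(x in D) (`|(f_ n x)%:E - (f x)%:E|)]_n @ \oo --> 0 &
    [sequence \int[mu]_(x in D) (f_ n x)%:E]_n @ \oo -->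
      \int[mu]_(x in D) (f x)%:E]%E.
  apply: (@dominated_convergence _ _ _ mu D mD
    (fun n x => (f_ n x)%:E) (EFin \o f) (EFin \o g)) => //.
  - by move=> n; apply/measurable_EFinP.
  - exact/measurable_EFinP.
  - by apply: filterS ff => x ffx Dx /=; apply: cvg_EFin; [exact: nearW|exact: ffx].
  - by apply: aeW => x n Dx; rewrite /= lee_fin fg.
apply: fine_cvg => /=.
rewrite fineK; last exact: (integrable_fin_num mD i1).
exact: i2.
Qed.

End dominated.

Section bounded_variables.
Context d (T : measurableType d) (R : realType) (P : probability T R).
Implicit Types f g : T -> R.

(** Boundedness everywhere, and not almost everywhere, makes every mean below a
    plain real integral with no integrability side condition. *)
Definition bounded_rv f :=
  measurable_fun [set: T] f /\ exists K : R, forall w, `|f w| <= K.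

Lemma bounded_rv_integrable f : bounded_rv f -> P.-integrable [set: T] (EFin \o f).
Proof.
move=> [mf [K fK]]; apply: measurable_bounded_integrable => //.
  by apply: (@le_lt_trans _ _ 1%E); [exact: probability_le1|rewrite ltry].
exists K; split; first exact: num_real.
by move=> M KM x _ /=; apply: le_trans (fK x) _; exact: ltW.
Qed.

Lemma bounded_rv_cst (c : R) : bounded_rv (fun=> c).
Proof. by split; [exact: measurable_cst|exists `|c|]. Qed.

Lemma bounded_rvD f g : bounded_rv f -> bounded_rv g ->
  bounded_rv (fun w => f w + g w).
Proof.
move=> [mf [K fK]] [mg [L gL]]; split; first exact: measurable_funD.
by exists (K + L) => w; apply: le_trans (ler_normD _ _) _; rewrite lerD.
Qed.

Lemma bounded_rvM f g : bounded_rv f -> bounded_rv g ->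
  bounded_rv (fun w => f w * g w).
Proof.
move=> [mf [K fK]] [mg [L gL]]; split; first exact: measurable_funM.
by exists (K * L) => w; rewrite normrM ler_pM.
Qed.

Lemma bounded_rvB f g : bounded_rv f -> bounded_rv g ->
  bounded_rv (fun w => f w - g w).
Proof.
move=> [mf [K fK]] [mg [L gL]]; split; first exact: measurable_funB.
by exists (K + L) => w; apply: le_trans (ler_normB _ _) _; rewrite lerD.
Qed.

Lemma bounded_rv_sum n (f_ : nat -> T -> R) : (forall k, bounded_rv (f_ k)) ->
  bounded_rv (fun w => \sum_(k < n) f_ k w).
Proof.
move=> bf; elim: n => [|n IH].
  by under eq_fun do rewrite big_ord0; exact: bounded_rv_cst.
by under eq_fun do rewrite big_ord_recr/=; exact: bounded_rvD.
Qed.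

Lemma meanD f g : bounded_rv f -> bounded_rv g ->
  \int[P]_w (f w + g w) = \int[P]_w f w + \int[P]_w g w.
Proof. by move=> bf bg; rewrite RintegralD//; exact: bounded_rv_integrable. Qed.

Lemma meanB f g : bounded_rv f -> bounded_rv g ->
  \int[P]_w (f w - g w) = \int[P]_w f w - \int[P]_w g w.
Proof. by move=> bf bg; rewrite RintegralB//; exact: bounded_rv_integrable. Qed.

Lemma meanZ (c : R) f : bounded_rv f -> \int[P]_w (c * f w) = c * \int[P]_w f w.
Proof. by move=> bf; rewrite RintegralZl//; exact: bounded_rv_integrable. Qed.

Lemma mean_cst (c : R) : \int[P]_w c = c.
Proof.
rewrite Rintegral_cst//.
by apply: (etrans (congr1 (fun x => c * fine x) (probability_setT P))); rewrite mulr1.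
Qed.

Lemma mean_sum n (f_ : nat -> T -> R) : (forall k, bounded_rv (f_ k)) ->
  \int[P]_w (\sum_(k < n) f_ k w) = \sum_(k < n) \int[P]_w f_ k w.
Proof.
move=> bf; elim: n => [|n IH].
  by under eq_Rintegral do rewrite big_ord0; rewrite big_ord0 mean_cst.
under eq_Rintegral do rewrite big_ord_recr/=.
by rewrite meanD ?big_ord_recr ?IH//; exact: bounded_rv_sum.
Qed.

Lemma mean_eq_ae f g : bounded_rv f -> bounded_rv g ->
  {ae P, forall w, f w = g w} -> \int[P]_w f w = \int[P]_w g w.
Proof.
move=> [mf _] [mg _] fg; congr fine; apply: ae_eq_integral => //.
- exact/measurable_EFinP.
- exact/measurable_EFinP.
- by apply: filterS fg => w fgw _ /=; rewrite fgw.
Qed.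

Lemma mean_le f g : bounded_rv f -> bounded_rv g ->
  {ae P, forall w, f w <= g w} -> \int[P]_w f w <= \int[P]_w g w.
Proof.
move=> bf bg fg; rewrite -subr_ge0 -meanB//.
rewrite (@mean_eq_ae _ (fun w => Num.max (g w - f w) 0)).
- by apply: Rintegral_ge0 => w _; rewrite le_max lexx orbT.
- exact: bounded_rvB.
- have [mh [K hK]] := bounded_rvB bg bf.
  split; first by apply: measurable_maxr.
  exists K => w; have K0 := le_trans (normr_ge0 _) (hK w).
  by have [h|h] := leP (g w - f w) 0; [rewrite normr0|exact: hK].
- by apply: filterS fg => w fgw; rewrite (max_idPl _)// subr_ge0.
Qed.

Lemma mean_ge0_eq0 f : bounded_rv f -> (forall w, 0 <= f w) ->
  \int[P]_w f w <= 0 -> {ae P, forall w, f w = 0}.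
Proof.
move=> bf f0 Ef; have bi := bounded_rv_integrable bf.
have mf : measurable_fun [set: T] (EFin \o f) by apply/measurable_EFinP; case: bf.
have : (\int[P]_w `|(EFin \o f) w|)%E = 0%E.
  under eq_integral => w _ do rewrite /= ger0_norm//.
  rewrite -[LHS]fineK; last exact: (integrable_fin_num measurableT bi).
  by congr EFin; apply/eqP; rewrite eq_le Ef Rintegral_ge0.
move=> /(ae_eq_integral_abs P measurableT mf).
by apply: filterS => w /(_ I) [].
Qed.

Lemma mean_cvg (f_ : nat -> T -> R) f (K : R) :
  (forall n, measurable_fun setT (f_ n)) -> bounded_rv f ->
  (forall n w, `|f_ n w| <= K) ->
  {ae P, forall w, f_ n w @[n --> \oo] --> f w} ->
  \int[P]_w f_ n w @[n --> \oo] --> \int[P]_w f w.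
Proof.
move=> mf_ bf fK ff; apply: (@Rintegral_dominated_cvg _ _ _ P setT f_ f (cst K)) => //.
- by case: bf.
- by apply: filterS ff => w ffw _.
- by apply: bounded_rv_integrable; exact: bounded_rv_cst.
Qed.

End bounded_variables.

Section independence.
Context d (T : measurableType d) (R : realType) (P : probability T R).

(** The joint law is the product law by uniqueness of product measures, and
    Tonelli integrates out Y first. *)
Lemma independent_pair_mean (G : set (set T)) (V Y : T -> R) (f : R * R -> R)
    (K : R) :
  measurable_fun [set: T] V -> measurable_fun [set: T] Y ->
  (forall B, measurable B -> G (V @^-1` B)) -> independent_of P G Y ->
  measurable_fun [set: R * R] f -> (forall u, 0 <= f u <= K) ->
  \int[P]_w f (V w, Y w) = \int[P]_w \int[P]_w' f (V w, Y w').
Proof.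
move=> mV mY GV indep mf fK.
pose V' : {mfun T >-> R} := HB.pack V (isMeasurableFun.Build _ _ _ _ V mV).
pose Y' : {mfun T >-> R} := HB.pack Y (isMeasurableFun.Build _ _ _ _ Y mY).
have mVY : measurable_fun [set: T] (fun w => (V w, Y w)) by exact: measurable_fun_pair.
pose VY : {mfun T >-> (R * R)%type} :=
  HB.pack (fun w => (V w, Y w)) (isMeasurableFun.Build _ _ _ _ (fun w => (V w, Y w)) mVY).
have mfE : measurable_fun [set: R * R] (EFin \o f) by apply/measurable_EFinP.
have f0 u : (0 <= (EFin \o f) u)%E by rewrite lee_fin; have /andP[] := fK u.
have E1 : (\int[P]_w (f (V w, Y w))%:E = \int[P]_w \int[P]_w' (f (V w, Y w'))%:E)%E.
  transitivity (\int[distribution P VY]_u (f u)%:E)%E.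
    by rewrite ge0_integral_distribution.
  transitivity (\int[(distribution P V' \x distribution P Y')%E]_u (f u)%:E)%E.
    apply: eq_measure_integral => A mA _; apply/esym.
    apply: product_measure_unique => // B C mB mC.
    by rewrite /distribution /pushforward/= -indep//; exact: GV.
  rewrite fubini_tonelli1//= /fubini_F.
  rewrite (@ge0_integral_distribution _ _ _ _ _ P V'
      (fun v => \int[distribution P Y']_y (EFin \o f) (v, y))%E)//=.
  - apply: eq_integral => w _.
    rewrite (@ge0_integral_distribution _ _ _ _ _ P Y' (fun y => (EFin \o f) (V w, y)))//=.
    - by apply: (measurableT_comp mfE); exact: measurable_fun_pair.
    - by move=> y; exact: f0.
  - exact: (@measurable_fun_fubini_tonelli_F _ _ _ _ R (distribution P Y') (EFin \o f) mfE f0).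
  - by move=> v; apply: integral_ge0 => y _; exact: f0.
rewrite /Rintegral E1; congr fine; apply: eq_integral => w _.
rewrite fineK// ge0_fin_numE; last by apply: integral_ge0 => y _; exact: f0.
have bf : bounded_rv (fun w' => f (V w, Y w')).
  split; first by apply: measurableT_comp => //; exact: measurable_fun_pair.
  by exists K => w'; have /andP[h1 h2] := fK (V w, Y w'); rewrite ger0_norm.
have := integrable_fin_num measurableT (bounded_rv_integrable P bf).
by rewrite ge0_fin_numE//; apply: integral_ge0 => y _; exact: f0.
Qed.

End independence.

(** * Fubini, dilations and powers for real-valued integrals *)

Section Rfubini.
Context d1 d2 (T1 : measurableType d1) (T2 : measurableType d2) (R : realType).
Variables (m1 : {sigma_finite_measure set T1 -> \bar R}).
Variables (m2 : {sigma_finite_measure set T2 -> \bar R}).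
Variables (f : T1 * T2 -> R) (g : T1 -> R) (k : T2 -> R).
Hypothesis mf : measurable_fun [set: T1 * T2] f.
Hypothesis ig : m1.-integrable [set: T1] (EFin \o g).
Hypothesis ik : m2.-integrable [set: T2] (EFin \o k).
Hypothesis fgk : forall x y, `|f (x, y)| <= g x * k y.

Let mfE : measurable_fun [set: T1 * T2] (EFin \o f).
Proof. exact/measurable_EFinP. Qed.

Lemma product_dominated_integrable1 x :
  m2.-integrable [set: T2] (EFin \o (fun y => f (x, y))).
Proof.
apply: (@le_integrable _ _ _ m2 _ measurableT _ (EFin \o (fun y => g x * k y))).
- by apply: (measurableT_comp mfE); exact: measurable_fun_pair.
- by move=> y _; rewrite /= lee_fin (le_trans (fgk x y))// ler_norm.
- have := integrableZl measurableT (g x) ik.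
  by apply: eq_integrable => // y _; rewrite /= EFinM.
Qed.

Lemma product_dominated_integrable2 y :
  m1.-integrable [set: T1] (EFin \o (fun x => f (x, y))).
Proof.
apply: (@le_integrable _ _ _ m1 _ measurableT _ (EFin \o (fun x => k y * g x))).
- by apply: (measurableT_comp mfE); exact: measurable_fun_pair.
- by move=> x _; rewrite /= lee_fin (le_trans (fgk x y))// mulrC ler_norm.
- have := integrableZl measurableT (k y) ig.
  by apply: eq_integrable => // x _; rewrite /= EFinM.
Qed.

Let if12 : (m1 \x m2)%E.-integrable [set: T1 * T2] (EFin \o f).
Proof.
apply/integrable12ltyP => //.
apply: (@le_lt_trans _ _ (\int[m1]_x `|(g x)%:E| * \int[m2]_y `|(k y)%:E|)%E); last first.
  have /integrableP[_ h1] := ig; have /integrableP[_ h2] := ik.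
  by apply: lte_mul_pinfty => //; [exact: integral_ge0|rewrite ge0_fin_numE//; exact: integral_ge0].
rewrite -ge0_integralZr//; last 2 first.
- by apply: measurableT_comp => //; exact: (measurable_int m1 ig).
- exact: integral_ge0.
apply: ge0_le_integral => //.
- by move=> x _; exact: integral_ge0.
- have mabs : measurable_fun [set: T1 * T2] (fun z => `|(f z)%:E|%E).
    by apply: measurableT_comp.
  exact: (@measurable_fun_fubini_tonelli_F _ _ _ _ R m2 _ mabs (fun z => abse_ge0 _)).
- apply: emeasurable_funM => //.
  by apply: measurableT_comp => //; exact: (measurable_int m1 ig).
move=> x _.
have mk : measurable_fun [set: T2] (fun y => `|(k y)%:E|%E).
  by apply: measurableT_comp => //; exact: (measurable_int m2 ik).
rewrite -ge0_integralZl//.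
apply: ge0_le_integral => //.
- apply: (@measurableT_comp _ _ _ _ _ _ abse) => //.
  by apply: (measurableT_comp mfE); exact: measurable_fun_pair.
- exact: measurable_funeM.
- by move=> y _; rewrite /= -EFinM lee_fin -normrM (le_trans (fgk x y))// ler_norm.
Qed.

(** The domination by a product of two integrable functions gives integrability on
    the product space. *)
Lemma Rintegral_swap :
  \int[m1]_x \int[m2]_y f (x, y) = \int[m2]_y \int[m1]_x f (x, y).
Proof.
rewrite /Rintegral; congr fine.
transitivity (\int[m1]_x \int[m2]_y (EFin \o f) (x, y))%E.
  apply: eq_integral => x _; rewrite fineK//.
  exact: (integrable_fin_num measurableT (product_dominated_integrable1 x)).
rewrite Fubini//; apply: eq_integral => y _; rewrite fineK//.
exact: (integrable_fin_num measurableT (product_dominated_integrable2 y)).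
Qed.

Lemma product_dominated_measurable :
  measurable_fun [set: T1] (fun x => \int[m2]_y f (x, y)).
Proof.
apply/measurable_EFinP.
have -> : EFin \o (fun x => \int[m2]_y f (x, y)) = fubini_F m2 (EFin \o f).
  apply/funext => x /=; rewrite fineK//.
  exact: (integrable_fin_num measurableT (product_dominated_integrable1 x)).
by have := @measurable_fubini_F _ _ _ _ _ m1 m2 _ if12; exact.
Qed.

End Rfubini.

Section dilation.
Variable R : realType.
Notation mu := (@lebesgue_measure R).

(** c mu (A / c) = mu A characterises Lebesgue measure. *)
Lemma ge0_integral_dilation (c : R) (f : R -> \bar R) : 0 < c ->
  measurable_fun [set: R] f -> (forall x, (0 <= f x)%E) ->
  (c%:E * \int[mu]_(x in `]0%R, +oo[) f (c * x)%R = \int[mu]_(x in `]0%R, +oo[) f x)%E.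
Proof.
move=> c0 mf f0.
have mc : measurable_fun [set: R] (fun x : R => c * x).
  by apply: measurable_funM.
pose k := NngNum (ltW c0).
have mE A : measurable A ->
    pushforward (mscale k mu) ( *%R c : _ -> measurableTypeR R) A = mu A.
  move=> mA; apply/esym/lebesgue_measure_unique => //= _ [[a b]] _ <-.
  rewrite /pushforward/= /mscale/=.
  have -> : (fun x => c * x) @^-1` `]a, b]%classic = `]a / c, b / c]%classic.
    apply/seteqP; split => x /=; rewrite !in_itv/= ltr_pdivrMr// ler_pdivlMr//;
      by rewrite mulrC.
  rewrite !lebesgue_measure_itv/= !lte_fin ltr_pM2r ?invr_gt0//.
  case: ifPn => _; last by rewrite mule0.
  rewrite -!EFinB -EFinM; congr EFin.
  by field; rewrite gt_eqF.
have Dc : ( *%R c : _ -> measurableTypeR R) @^-1` `]0, +oo[%classic = `]0, +oo[%classic.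
  by apply/seteqP; split => x /=; rewrite !in_itv/= !andbT pmulr_rgt0.
transitivity (\int[mscale k mu]_(x in `]0%R, +oo[) f (c * x)%R)%E.
  rewrite ge0_integral_mscale//; apply: measurable_funTS.
  exact: measurableT_comp mf mc.
rewrite -{1}Dc -ge0_integral_pushforward//=; last exact: measurable_funTS.
by apply: eq_measure_integral => //= A mA _; exact: mE.
Qed.

Lemma Rintegral_dilation (c : R) (f : R -> R) : 0 < c ->
  measurable_fun [set: R] f ->
  mu.-integrable `]0%R, +oo[ (EFin \o f) ->
  c * \int[mu]_(x in `]0%R, +oo[) f (c * x) = \int[mu]_(x in `]0%R, +oo[) f x.
Proof.
move=> c0 mf intf.
have mfE : measurable_fun [set: R] (EFin \o f) by apply/measurable_EFinP.
rewrite /Rintegral [X in _ = fine X]integralE [X in _ * fine X]integralE.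
have h g : measurable_fun [set: R] g -> (forall x, (0 <= g x)%E) ->
    (\int[mu]_(x in `]0%R, +oo[) g x)%E \is a fin_num ->
    (\int[mu]_(x in `]0%R, +oo[) g (c * x)%R)%E =
    (c^-1 * fine (\int[mu]_(x in `]0%R, +oo[) g x))%:E.
  move=> mg g0 gfin.
  rewrite EFinM fineK// -(@ge0_integral_dilation c g)// muleA -EFinM mulVf ?gt_eqF//.
  by rewrite mul1e.
have ip : (\int[mu]_(x in `]0%R, +oo[) ((EFin \o f)^\+ x))%E \is a fin_num.
  by apply: integrable_pos_fin_num intf.
have im : (\int[mu]_(x in `]0%R, +oo[) ((EFin \o f)^\- x))%E \is a fin_num.
  by apply: integrable_neg_fin_num intf.
have hp := h _ (measurable_funepos mfE) (funepos_ge0 _) ip.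
have hm := h _ (measurable_funeneg mfE) (funeneg_ge0 _) im.
have -> : ((fun x => (f (c * x)%R)%:E)^\+ = (fun x => (EFin \o f)^\+ (c * x)%R))%E.
  by apply/funext => x; rewrite !funeposE.
have -> : ((fun x => (f (c * x)%R)%:E)^\- = (fun x => (EFin \o f)^\- (c * x)%R))%E.
  by apply/funext => x; rewrite !funenegE.
rewrite hp hm; move: ip im {hp hm h}.
case: (\int[mu]_(x in _) (EFin \o f)^\+ x)%E => [p| |] //.
case: (\int[mu]_(x in _) (EFin \o f)^\- x)%E => [m| |] // _ _ /=.
by rewrite -mulrBr mulrA divff ?mul1r ?gt_eqF.
Qed.

Lemma integral_powR (p a b : R) : p != 0 -> 0 < a -> a < b ->
  (\int[mu]_(x in `[a, b]) (x `^ (p - 1))%:E = ((b `^ p - a `^ p) / p)%:E)%E.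
Proof.
move=> p0 a0 ab.
have der (x : R) : 0 < x -> is_derive x 1 (fun h : R => p^-1 * h `^ p) (x `^ (p - 1)).
  move=> x0; have := is_derive1_powR p x0 => dx.
  have := @is_deriveZ _ _ _ (fun h : R => h `^ p) p^-1 x 1 _ dx.
  by rewrite [X in is_derive _ _ _ X](_ : _ = x `^ (p - 1))// /GRing.scale/= mulrA mulVf// mul1r.
have cF (x : R) : 0 < x -> {for x, continuous (fun h : R => p^-1 * h `^ p)}.
  move=> x0; apply: differentiable_continuous; apply/derivable1_diffP.
  by have [] := der _ x0.
have cpow (x q : R) : 0 < x -> {for x, continuous (fun h : R => h `^ q)}.
  move=> x0; apply: differentiable_continuous; apply/derivable1_diffP.
  by have [] := is_derive1_powR q x0.
have b0 := lt_trans a0 ab.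
rewrite (@continuous_FTC2 _ (fun x => x `^ (p - 1)) (fun h => p^-1 * h `^ p))//.
- by rewrite -EFinB; congr EFin; rewrite mulrC [RHS]mulrC; ring.
- apply: continuous_in_subspaceT => x; rewrite inE/= in_itv/= => /andP[ax _].
  by apply: cpow; exact: lt_le_trans ax.
- split.
  + by move=> x; rewrite in_itv/= => /andP[ax _]; have [] := der _ (lt_trans a0 ax).
  + by apply: cvg_at_right_filter; exact: cF.
  + by apply: cvg_at_left_filter; exact: cF.
- move=> x; rewrite in_itv/= => /andP[ax _]; rewrite derive1E.
  by have [_ ->] := der _ (lt_trans a0 ax).
Qed.

End dilation.

(** * The stable jump density *)

Section levy_density.
Variable R : realType.
Notation mu := (@lebesgue_measure R).

Let measurable_powR_cst (q : R) : measurable_fun [set: R] (fun h : R => h `^ q).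
Proof. exact: measurable_powR. Qed.

Lemma integral_powR_near0 (p : R) : 0 < p ->
  (\int[mu]_(h in `]0%R, 1%R]) (h `^ (p - 1))%:E <= (p^-1)%:E)%E.
Proof.
move=> p0; pose A (n : nat) : set R := `[n.+2%:R^-1, 1]%classic.
have n0 (n : nat) : (0 : R) < n.+2%:R by [].
have -> : `]0, 1]%classic = \bigcup_n A n.
  apply/seteqP; split => h /=; rewrite in_itv/=.
    move=> /andP[h0 h1]; exists (Num.truncn (h^-1)) => //.
    rewrite /A /= in_itv/= h1 andbT invf_ple ?posrE//.
    by apply: ltW; apply: lt_trans (truncnS_gt _) _; rewrite ltr_nat.
  move=> [n _]; rewrite /A/= in_itv/= => /andP[h1 ->]; rewrite andbT.
  by apply: lt_le_trans h1; rewrite invr_gt0.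
apply: (@cvge_to_le _ \oo _ _ (fun n => \int[mu]_(h in A n) (h `^ (p - 1))%:E)%E).
  apply: ge0_nondecreasing_set_cvg_integral.
- apply/nondecreasing_seqP => n; rewrite subsetEset => h; rewrite /A/= !in_itv/=.
  move=> /andP[h1 ->]; rewrite andbT; apply: le_trans h1.
  by rewrite lef_pV2 ?posrE// ler_nat.
- by move=> n; exact: measurable_itv.
- by move=> n; apply/measurable_EFinP; exact: measurable_funTS.
- by move=> n h _; rewrite lee_fin powR_ge0.
- apply: nearW => n; rewrite integral_powR ?invr_gt0 ?gt_eqF//; last first.
    by rewrite invf_plt ?posrE// invr1 ltr1n.
  by rewrite lee_fin powR1 -[leRHS]mul1r ler_wpM2r ?invr_ge0 ?(ltW p0)// gerBl powR_ge0.
Qed.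

Lemma integral_powR_near_oo (p : R) : 0 < p ->
  (\int[mu]_(h in `[1%R, +oo[) (h `^ (- p - 1))%:E <= (p^-1)%:E)%E.
Proof.
move=> p0; pose A (n : nat) : set R := `[1, n.+2%:R]%classic.
have -> : `[1, +oo[%classic = \bigcup_n A n.
  apply/seteqP; split => h /=; rewrite in_itv/=.
    rewrite andbT => h1; exists (Num.truncn h) => //.
    rewrite /A /= in_itv/= h1/=.
    by apply: ltW; apply: lt_trans (truncnS_gt _) _; rewrite ltr_nat.
  by move=> [n _]; rewrite /A/= in_itv/= => /andP[->].
apply: (@cvge_to_le _ \oo _ _ (fun n => \int[mu]_(h in A n) (h `^ (- p - 1))%:E)%E).
  apply: ge0_nondecreasing_set_cvg_integral.
- apply/nondecreasing_seqP => n; rewrite subsetEset => h; rewrite /A/= !in_itv/=.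
  by move=> /andP[-> h1]/=; apply: le_trans h1 _; rewrite ler_nat.
- by move=> n; exact: measurable_itv.
- by move=> n; apply/measurable_EFinP; exact: measurable_funTS.
- by move=> n h _; rewrite lee_fin powR_ge0.
- apply: nearW => n; rewrite integral_powR ?oppr_eq0 ?gt_eqF// ?ltr1n//.
  rewrite lee_fin powR1 invrN mulrN -mulNr opprB -[leRHS]mul1r.
  by rewrite ler_wpM2r ?invr_ge0 ?(ltW p0)// lerBlDr lerDl powR_ge0.
Qed.

(** Extended by 0 to the negative half-line, so that jump densities are functions
    on the whole line. *)
Definition stable_density (c alpha h : R) : R :=
  if 0 < h then c / h `^ (1 + alpha) else 0.

Lemma stable_density_ge0 (c alpha h : R) : 0 <= c -> 0 <= stable_density c alpha h.
Proof.
by move=> c0; rewrite /stable_density; case: ifP => // _; rewrite divr_ge0 ?powR_ge0.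
Qed.

Lemma measurable_stable_density (c alpha : R) :
  measurable_fun [set: R] (stable_density c alpha).
Proof.
apply: measurable_fun_ifT => //.
- by apply: measurable_fun_ltr.
- apply: measurable_funM => //.
  rewrite (_ : (fun h => _) = fun h : R => h `^ (- (1 + alpha))); first exact: measurable_powR.
  by apply/funext => h; rewrite powRN.
Qed.

(** h^{- alpha} near 0 uses alpha < 1, and h^{- 1 - alpha} at infinity uses
    0 < alpha. *)
Lemma stable_density_integrable (c alpha : R) : 0 < c -> 0 < alpha -> alpha < 1 ->
  mu.-integrable [set: R]
    (EFin \o (fun h => Num.min 1 `|h| * stable_density c alpha h)).
Proof.
move=> c0 a0 a1.
pose f1 : R -> R := (fun h => h `^ ((1 - alpha) - 1)) \_ `]0%R, 1%R].
pose f2 : R -> R := (fun h => h `^ (- alpha - 1)) \_ `[1%R, +oo[.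
have i1 : mu.-integrable [set: R] (EFin \o f1).
  rewrite /f1 -restrict_EFin; apply: (iffLR (integrable_mkcond _ _)); first exact: measurable_itv.
  apply/integrableP; split.
    by apply/measurable_EFinP; exact: measurable_funTS.
  under eq_integral do rewrite /= ger0_norm ?powR_ge0//.
  apply: le_lt_trans (integral_powR_near0 _) _; rewrite ?ltry//.
  by rewrite subr_gt0.
have i2 : mu.-integrable [set: R] (EFin \o f2).
  rewrite /f2 -restrict_EFin; apply: (iffLR (integrable_mkcond _ _)); first exact: measurable_itv.
  apply/integrableP; split.
    by apply/measurable_EFinP; exact: measurable_funTS.
  under eq_integral do rewrite /= ger0_norm ?powR_ge0//.
  by apply: le_lt_trans (integral_powR_near_oo a0) _; rewrite ltry.
have i12 := integrableZl measurableT c (integrableD measurableT i1 i2).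
apply: le_integrable i12 => //.
  apply/measurable_EFinP; apply: measurable_funM; last exact: measurable_stable_density.
  by apply: measurable_minr => //; exact: measurable_normr.
move=> h _ /=.
have m0 : 0 <= Num.min 1 `|h| by rewrite le_min ler01 normr_ge0.
have f10 : 0 <= f1 h by rewrite /f1 /patch; case: ifP => // _; exact: powR_ge0.
have f20 : 0 <= f2 h by rewrite /f2 /patch; case: ifP => // _; exact: powR_ge0.
rewrite lee_fin ger0_norm; last first.
  by rewrite mulr_ge0// stable_density_ge0// ltW.
apply: le_trans (ler_norm _).
rewrite /stable_density; case: ifPn => h0; last first.
  by rewrite mulr0 mulr_ge0 ?addr_ge0// ltW.
rewrite mulrCA ler_wpM2l ?(ltW c0)// (ger0_norm (ltW h0)).
have [h1|h1] := leP 1 h.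
  apply: ler_wpDl => //; rewrite /f2 patchE mem_set/=; last by rewrite in_itv/= h1.
  by rewrite mul1r -powRN opprD addrC.
apply: ler_wpDr => //; rewrite /f1 patchE mem_set/=; last by rewrite in_itv/= h0 ltW.
rewrite -powRN -{1}(powRr1 (ltW h0)) -powRD; last by rewrite (gt_eqF h0) implybT.
rewrite le_eqVlt; apply/orP; left; apply/eqP; congr (_ `^ _); ring.
Qed.

End levy_density.

(** * Limits of complex powers *)

Section complex_limits.
Variable R : realType.
Implicit Types (z : R[i]).

Lemma mulcE_Re z w : complex.Re (z * w) =
  complex.Re z * complex.Re w - complex.Im z * complex.Im w.
Proof. by case: z => a b; case: w. Qed.

Lemma mulcE_Im z w : complex.Im (z * w) =
  complex.Re z * complex.Im w + complex.Im z * complex.Re w.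
Proof. by case: z => a b; case: w => c e. Qed.

Lemma le_Re_normc z : `|complex.Re z| <= normc z.
Proof.
case: z => a b /=; rewrite -(sqrtr_sqr a) ler_wsqrtr//.
by rewrite lerDl sqr_ge0.
Qed.

Lemma le_Im_normc z : `|complex.Im z| <= normc z.
Proof.
case: z => a b /=; rewrite -(sqrtr_sqr b) ler_wsqrtr//.
by rewrite lerDr sqr_ge0.
Qed.

Lemma normc_le_add z : normc z <= `|complex.Re z| + `|complex.Im z|.
Proof.
case: z => a b /=; set s := `|a| + `|b|.
have s0 : 0 <= s by rewrite addr_ge0.
rewrite -(ger0_norm s0) -sqrtr_sqr ler_wsqrtr// /s sqrrD !real_normK ?num_real//.
have : 0 <= `|a| * `|b| by rewrite mulr_ge0.
rewrite mulr2n; set q := `|a| * `|b| => q0; lra.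
Qed.

(** z^n - w^n telescopes in n terms with a factor z - w, and the other factors lie
    in the unit disc. *)
Lemma normc_expB z w n : normc z <= 1 -> normc w <= 1 ->
  normc (z ^+ n - w ^+ n) <= n%:R * normc (z - w).
Proof.
move=> z1 w1.
have n0 v : 0 <= normc v :> R by case: v => a b; exact: sqrtr_ge0.
have wn k : normc (w ^+ k) <= 1.
  elim: k => [|k IH]; first by rewrite expr0 normc1.
  by rewrite exprS normcM mulr_ile1.
elim: n => [|n IH]; first by rewrite !expr0 subrr normc0 mul0r.
rewrite !exprS (_ : _ - _ = z * (z ^+ n - w ^+ n) + (z - w) * w ^+ n); last by ring.
apply: le_trans (le_normcD _ _) _; rewrite !normcM -natr1 mulrDl mul1r.
apply: lerD; last by rewrite ler_piMr.
by apply: le_trans IH; rewrite ler_piMl.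
Qed.

(** The complex exponential of p + i q. *)
Definition cis (p q : R) : R[i] := Complex (expR p * cos q) (expR p * sin q).

Lemma normc_cis p q : p <= 0 -> normc (cis p q) <= 1.
Proof.
move=> p0; rewrite /cis /= !exprMn -mulrDr cos2Dsin2 mulr1 sqrtr_sqr.
by rewrite ger0_norm ?expR_ge0// -expR0 ler_expR.
Qed.

Lemma cisD p q p' q' : cis (p + p') (q + q') = cis p q * cis p' q'.
Proof.
apply/eqP; rewrite eq_complex mulcE_Re mulcE_Im /= expRD cosD sinD.
by apply/andP; split; apply/eqP; ring.
Qed.

Lemma cisX p q n : cis p q ^+ n = cis (n%:R * p) (n%:R * q).
Proof.
elim: n => [|n IH].
  by rewrite expr0 !mul0r /cis expR0 cos0 sin0 mul1r mul1r.
by rewrite exprS IH -cisD -natr1 !mulrDl !mul1r addrC (addrC q).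
Qed.

Lemma derive0_seq (f : R -> R) (l : R) : is_derive (0 : R) (1 : R) f l ->
  (n.+1%:R * (f n.+1%:R^-1 - f 0)) @[n --> \oo] --> l.
Proof.
move=> [df <-].
have : h^-1 *: (f (h *: (1 : R) + 0) - f 0) @[h --> 0^'] --> 'D_1 f 0 by [].
move=> hf.
have : (n.+1%:R^-1 : R) @[n --> \oo] --> 0^'.
  move=> A [e /= e0 eA]; suff : \forall n \near \oo, A (n.+1%:R^-1) by [].
  near=> n; apply: eA; last by rewrite /= invr_eq0 pnatr_eq0.
  rewrite /ball_/= sub0r normrN ger0_norm ?invr_ge0//.
  near: n; exact: (near_infty_natSinv_lt (PosNum e0)).
move=> /(cvg_comp _ _)/(_ hf); apply: cvg_trans; apply: near_eq_cvg.
by apply: nearW => n /=; rewrite invrK /GRing.scale/= mulr1 addr0.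
Unshelve. all: by end_near. Qed.

(** (1 + zeta / n)^n tends to e^zeta: compare the n-th powers of 1 + zeta / n and
    e^{zeta / n}, both in the unit disc, through their difference, which is
    o(1 / n) by differentiability of the exponential at 0. *)
Lemma cis_limit (p q : R) : p <= 0 ->
  (\forall n \near \oo, normc (Complex (1 + p / n.+1%:R) (q / n.+1%:R)) <= 1) ->
  normc (Complex (1 + p / n.+1%:R) (q / n.+1%:R) ^+ n.+1 - cis p q)
    @[n --> \oo] --> 0.
Proof.
move=> p0 n1.
have dRe : is_derive (0 : R) 1 (fun s : R => expR (p * s) * cos (q * s)) p.
  apply: is_derive_eq.
  by rewrite /GRing.scale/= !mulr0 expR0 cos0 sin0; ring.
have dIm : is_derive (0 : R) 1 (fun s : R => expR (p * s) * sin (q * s)) q.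
  apply: is_derive_eq.
  by rewrite /GRing.scale/= !mulr0 expR0 cos0 sin0; ring.
have hRe := derive0_seq dRe; have hIm := derive0_seq dIm.
have {}hRe : `|n.+1%:R * (1 + p / n.+1%:R - expR (p / n.+1%:R) * cos (q / n.+1%:R))|
    @[n --> \oo] --> 0.
  have : `|p - n.+1%:R * (expR (p * n.+1%:R^-1) * cos (q * n.+1%:R^-1) -
     expR (p * 0) * cos (q * 0))| @[n --> \oo] --> `|p - p|.
    by apply: cvg_norm; apply: cvgB; [exact: cvg_cst|exact: hRe].
  rewrite subrr normr0.
  apply: cvg_trans; apply: near_eq_cvg; apply: nearW => n.
  rewrite !mulr0 expR0 cos0 mul1r; congr (`|_|).
  set E := expR _ * _; have N0 : (n.+1%:R : R) != 0 by rewrite pnatr_eq0.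
  by move: N0; set N : R := n.+1%:R => N0; field.
have {}hIm : `|n.+1%:R * (q / n.+1%:R - expR (p / n.+1%:R) * sin (q / n.+1%:R))|
    @[n --> \oo] --> 0.
  have : `|q - n.+1%:R * (expR (p * n.+1%:R^-1) * sin (q * n.+1%:R^-1) -
     expR (p * 0) * sin (q * 0))| @[n --> \oo] --> `|q - q|.
    by apply: cvg_norm; apply: cvgB; [exact: cvg_cst|exact: hIm].
  rewrite subrr normr0.
  apply: cvg_trans; apply: near_eq_cvg; apply: nearW => n.
  rewrite !mulr0 expR0 sin0 mulr0 subr0; congr (`|_|).
  set E := expR _ * _; have N0 : (n.+1%:R : R) != 0 by rewrite pnatr_eq0.
  by move: N0; set N : R := n.+1%:R => N0; field.
apply: (@squeeze_cvgr _ _ _ _ (cst 0) (fun n =>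
   `|n.+1%:R * (1 + p / n.+1%:R - expR (p / n.+1%:R) * cos (q / n.+1%:R))| +
   `|n.+1%:R * (q / n.+1%:R - expR (p / n.+1%:R) * sin (q / n.+1%:R))|)).
- apply: filterS n1 => n n1; apply/andP; split.
    by case: (_ - _) => a b; exact: sqrtr_ge0.
  have -> : cis p q = cis (p / n.+1%:R) (q / n.+1%:R) ^+ n.+1.
    by rewrite cisX !(mulrC n.+1%:R) -!mulrA mulVf ?pnatr_eq0// !mulr1.
  apply: le_trans (normc_expB _ n1 _) _.
    by apply: normc_cis; rewrite pmulr_lle0.
  apply: le_trans (ler_wpM2l _ (normc_le_add _)) _; first by rewrite ler0n.
  by rewrite !normrM mulrDr !(ger0_norm (ler0n _ _)) lexx.
- exact: cvg_cst.
- by rewrite -[X in _ --> X](addr0 0); exact: cvgD.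
Qed.

End complex_limits.

(** * Fourier transforms carried by the half-line *)

Section one_sided.
Variable R : realType.
Notation mu := (@lebesgue_measure R).
Implicit Types (m chi : R -> R[i]).

Definition measurable_complex chi :=
  measurable_fun [set: R] (fun u => complex.Re (chi u)) /\
  measurable_fun [set: R] (fun u => complex.Im (chi u)).

Definition integrable_complex m :=
  mu.-integrable [set: R] (EFin \o (fun u => complex.Re (m u))) /\
  mu.-integrable [set: R] (EFin \o (fun u => complex.Im (m u))).

Definition pairing m chi : R := \int[mu]_u complex.Re (m u * chi u).

(** The character u |-> e^{i u x}. *)
Definition wave (x u : R) : R[i] := cis 0 (u * x).

(** By duality this says that chi lies in the closed convex hull of the waves with
    x >= 0, i.e. that it is the Fourier transform of a (sub)probability on the
    half-line. In this form the closure properties below need no measure to be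
    constructed. *)
Definition one_sided chi := [/\ measurable_complex chi,
  forall u, normc (chi u) <= 1 &
  forall m B, integrable_complex m ->
    (forall x, 0 <= x -> pairing m (wave x) <= B) -> pairing m chi <= B].

Lemma measurable_complexM chi chi' : measurable_complex chi ->
  measurable_complex chi' -> measurable_complex (fun u => chi u * chi' u).
Proof.
move=> [r1 i1] [r2 i2]; split.
- under eq_fun do rewrite mulcE_Re.
  by apply: measurable_funB; apply: measurable_funM.
- under eq_fun do rewrite mulcE_Im.
  by apply: measurable_funD; apply: measurable_funM.
Qed.

Lemma integrable_complex_measurable m : integrable_complex m -> measurable_complex m.
Proof.
by move=> [/measurable_int/measurable_EFinP r1 /measurable_int/measurable_EFinP i1].
Qed.

Lemma integrable_complex_abs m : integrable_complex m ->
  mu.-integrable [set: R]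
    (EFin \o (fun u => `|complex.Re (m u)| + `|complex.Im (m u)|)).
Proof.
move=> [r1 i1].
have := integrableD measurableT (integrable_abse r1) (integrable_abse i1).
by apply: eq_integrable.
Qed.

Lemma dominated_integrable_complex m chi : integrable_complex m ->
  measurable_complex chi -> (forall u, normc (chi u) <= normc (m u)) ->
  integrable_complex chi.
Proof.
move=> im [mr mi] chim; have ia := integrable_complex_abs im.
split; apply: (le_integrable measurableT _ _ ia).
- exact/measurable_EFinP.
- move=> u _; rewrite /= lee_fin [leRHS]ger0_norm ?addr_ge0//.
  apply: le_trans (le_Re_normc _) _; apply: le_trans (chim u) _.
  exact: normc_le_add.
- exact/measurable_EFinP.
- move=> u _; rewrite /= lee_fin [leRHS]ger0_norm ?addr_ge0//.
  apply: le_trans (le_Im_normc _) _; apply: le_trans (chim u) _.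
  exact: normc_le_add.
Qed.

Lemma normc_ge0 (z : R[i]) : 0 <= normc z.
Proof. by case: z => a b; exact: sqrtr_ge0. Qed.

Lemma integrable_complexM m chi : integrable_complex m -> measurable_complex chi ->
  (forall u, normc (chi u) <= 1) -> integrable_complex (fun u => m u * chi u).
Proof.
move=> im mc c1; apply: (dominated_integrable_complex im).
  by apply: measurable_complexM => //; exact: integrable_complex_measurable.
by move=> u; rewrite normcM ler_piMr ?normc_ge0 ?c1.
Qed.

Lemma waveD x y u : wave (x + y) u = wave x u * wave y u.
Proof. by rewrite /wave -cisD addr0 -mulrDr. Qed.

Lemma normc_wave x u : normc (wave x u) <= 1.
Proof. exact: normc_cis. Qed.

Lemma measurable_wave x : measurable_complex (wave x).
Proof.
split; rewrite /wave /cis /= expR0.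
- under eq_fun do rewrite mul1r.
  apply: continuous_measurable_fun => u; apply: continuous_comp.
    by apply: cvgM; [exact: cvg_id|exact: cvg_cst].
  exact: continuous_cos.
- under eq_fun do rewrite mul1r.
  apply: continuous_measurable_fun => u; apply: continuous_comp.
    by apply: cvgM; [exact: cvg_id|exact: cvg_cst].
  exact: continuous_sin.
Qed.

Lemma one_sided_wave x : 0 <= x -> one_sided (wave x).
Proof.
move=> x0; split; [exact: measurable_wave|exact: normc_wave|].
by move=> m B _ /(_ x x0).
Qed.

(** Convolution of measures on the half-line. Test m against chi chi' by testing
    m chi against chi', which reduces to waves, and then m times a wave
    against chi. *)
Lemma one_sidedM chi chi' : one_sided chi -> one_sided chi' ->
  one_sided (fun u => chi u * chi' u).
Proof.
move=> [mc c1 cP] [mc' c1' cP']; split.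
- exact: measurable_complexM.
- by move=> u; rewrite normcM mulr_ile1 ?normc_ge0.
- move=> m B im mB.
  have -> : pairing m (fun u => chi u * chi' u) = pairing (fun u => m u * chi u) chi'.
    by apply: eq_Rintegral => u _; rewrite mulrA.
  apply: cP'; first exact: integrable_complexM.
  move=> x x0.
  have -> : pairing (fun u => m u * chi u) (wave x) =
      pairing (fun u => m u * wave x u) chi.
    by apply: eq_Rintegral => u _; rewrite mulrAC.
  apply: cP.
    by apply: integrable_complexM => //; [exact: measurable_wave|exact: normc_wave].
  move=> y y0.
  have -> : pairing (fun u => m u * wave x u) (wave y) = pairing m (wave (x + y)).
    by apply: eq_Rintegral => u _; rewrite waveD mulrA.
  by apply: mB; rewrite addr_ge0.
Qed.

Lemma one_sidedX chi n : one_sided chi -> one_sided (fun u => chi u ^+ n).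
Proof.
move=> oc; elim: n => [|n IH].
  have := one_sided_wave (lexx 0); congr one_sided; apply/funext => u.
  by rewrite /wave mulr0 /cis expR0 cos0 sin0 mulr1 mulr0 expr0.
have -> : (fun u => chi u ^+ n.+1) = (fun u => chi u * chi u ^+ n).
  by apply/funext => u; rewrite exprS.
exact: one_sidedM.
Qed.

(** Dominated convergence in the pairing, with dominating function |m|. *)
Lemma one_sided_lim (chi_ : nat -> R -> R[i]) chi :
  (forall n, one_sided (chi_ n)) ->
  (forall u, normc (chi_ n u - chi u) @[n --> \oo] --> 0) -> one_sided chi.
Proof.
move=> oc lim.
have limRe u : complex.Re (chi_ n u) @[n --> \oo] --> complex.Re (chi u).
  apply/cvgrPdist_le => e e0; have /cvgrPdist_le/(_ e e0) := lim u.
  apply: filterS => n; rewrite sub0r normrN => h.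
  rewrite distrC; apply: le_trans h; apply: le_trans (ler_norm _).
  apply: le_trans (le_Re_normc (chi_ n u - chi u)).
  by case: (chi_ n u) (chi u) => a b [].
have limIm u : complex.Im (chi_ n u) @[n --> \oo] --> complex.Im (chi u).
  apply/cvgrPdist_le => e e0; have /cvgrPdist_le/(_ e e0) := lim u.
  apply: filterS => n; rewrite sub0r normrN => h.
  rewrite distrC; apply: le_trans h; apply: le_trans (ler_norm _).
  apply: le_trans (le_Im_normc (chi_ n u - chi u)).
  by case: (chi_ n u) (chi u) => a b [].
have mchi : measurable_complex chi.
  split.
  - apply: (@measurable_fun_cvg _ _ _ setT (fun n u => complex.Re (chi_ n u))) => //.
    + by move=> n; have [[]] := oc n.
  - apply: (@measurable_fun_cvg _ _ _ setT (fun n u => complex.Im (chi_ n u))) => //.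
    + by move=> n; have [[]] := oc n.
split => //.
- move=> u; apply/ler_addgt0Pr => e e0.
  have /cvgrPdist_le/(_ e e0) := lim u.
  move=> /filter_ex[n]; rewrite sub0r normrN ger0_norm ?normc_ge0// => h.
  have -> : chi u = chi_ n u + - (chi_ n u - chi u) by ring.
  apply: le_trans (le_normcD _ _) _; rewrite normcN lerD//.
  by have [] := oc n.
- move=> m B im mB.
  apply: (@cvgr_to_le _ \oo _ _ (fun n => pairing m (chi_ n))); last first.
    by apply: nearW => n; have [_ _] := oc n; apply.
  have mm := integrable_complex_measurable im.
  apply: (@Rintegral_dominated_cvg _ _ _ mu setT (fun n u => complex.Re (m u * chi_ n u))
    _ (fun u => `|complex.Re (m u)| + `|complex.Im (m u)|)) => //.
  + by move=> n; have [mc _ _] := oc n; have [] := measurable_complexM mm mc.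
  + by have [] := measurable_complexM mm mchi.
  + apply: aeW => u _; under eq_fun do rewrite mulcE_Re; rewrite mulcE_Re.
    by apply: cvgB; apply: cvgM => //; exact: cvg_cst.
  + exact: integrable_complex_abs.
  + move=> n u _; apply: le_trans (le_Re_normc _) _; rewrite normcM.
    apply: le_trans (normc_le_add _); rewrite ler_piMr ?normc_ge0//.
    by have [] := oc n.
Qed.

End one_sided.

(** * Exponents of compound Poisson type *)

Section levy_exponent.
Variable R : realType.
Notation mu := (@lebesgue_measure R).
Implicit Types (nu : R -> R).

Lemma sin_cos_lipschitz (x : R) : `|cos x - 1| <= `|x| /\ `|sin x| <= `|x|.
Proof.
have key (f df : R -> R) (a b : R) : (forall x, is_derive x (1 : R) f (df x)) ->
    (forall x, `|df x| <= 1) -> a <= b -> `|f b - f a| <= b - a.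
  move=> dfP df1 ab.
  have cf : {within `[a, b], continuous f}.
    apply: continuous_subspaceT => y; apply: differentiable_continuous.
    by apply/derivable1_diffP; have [] := dfP y.
  have [c _ ->] := MVT_segment ab (fun x _ => dfP x) cf.
  by rewrite normrM (ger0_norm (x := b - a)) ?subr_ge0// ler_piMl// subr_ge0.
have lip (f df : R -> R) (y : R) : (forall x, is_derive x (1 : R) f (df x)) ->
    (forall x, `|df x| <= 1) -> `|f y - f 0| <= `|y|.
  move=> dfP df1; have [y0|y0] := leP 0 y.
    by rewrite [leRHS]ger0_norm// -[leRHS]subr0; exact: key dfP df1 y0.
  rewrite [leRHS]ltr0_norm// distrC -[leRHS]add0r.
  by apply: (key f df y 0 dfP df1); exact: ltW.
split.
- rewrite -cos0; apply: (lip cos (fun x => - sin x)) => y.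
  by rewrite normrN sin_max.
- have := lip sin cos x; rewrite sin0 !subr0; apply => y; exact: cos_max.
Qed.

(** Real part of the Levy exponent of a jump density nu without drift; sin_part is
    the imaginary part. Keeping them apart avoids complex integrals. *)
Definition cos_part nu (u : R) : R := \int[mu]_h ((cos (u * h) - 1) * nu h).
Definition sin_part nu (u : R) : R := \int[mu]_h (sin (u * h) * nu h).

Lemma continuous_prod2 (f : R -> R) : continuous f ->
  measurable_fun [set: R * R] (fun z : R * R => f (z.1 * z.2)).
Proof.
move=> cf; apply: measurableT_comp; first exact: continuous_measurable_fun.
by apply: measurable_funM.
Qed.

Section finite_density.
Variable nu : R -> R.
Hypothesis nu_ge0 : forall h, 0 <= nu h.
Hypothesis nu_neg : forall h, h <= 0 -> nu h = 0.
Hypothesis nu_int : mu.-integrable [set: R] (EFin \o nu).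
Let L : R := \int[mu]_h nu h.
Let a u : R := \int[mu]_h (cos (u * h) * nu h).
Let b u : R := \int[mu]_h (sin (u * h) * nu h).

Let mnu : measurable_fun [set: R] nu.
Proof. by apply/measurable_EFinP; exact: measurable_int nu_int. Qed.

Let int_bounded (f : R -> R) : measurable_fun [set: R] f -> (forall h, `|f h| <= 1) ->
  mu.-integrable [set: R] (EFin \o (fun h => f h * nu h)).
Proof.
move=> mf f1; apply: (le_integrable measurableT _ _ nu_int).
  by apply/measurable_EFinP; exact: measurable_funM.
move=> h _; rewrite /= lee_fin normrM ler_piMl//.
Qed.

Let mcos (u : R) : measurable_fun [set: R] (fun h => cos (u * h)).
Proof.
apply: measurableT_comp; first exact: continuous_measurable_fun (@continuous_cos R).
exact: measurable_funM.
Qed.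

Let msin (u : R) : measurable_fun [set: R] (fun h => sin (u * h)).
Proof.
apply: measurableT_comp; first exact: continuous_measurable_fun (@continuous_sin R).
exact: measurable_funM.
Qed.

Let icos u := int_bounded (mcos u) (fun h => cos_max _).
Let isin u := int_bounded (msin u) (fun h => sin_max _).

Let L0 : 0 <= L.
Proof. by apply: Rintegral_ge0 => h _. Qed.

Lemma cos_partE u : cos_part nu u = a u - L.
Proof.
rewrite -RintegralB//.
by apply: eq_Rintegral => h _; rewrite mulrBl mul1r.
Qed.

(** The Fourier transform of nu is bounded by its mass: integrate
    a cos + b sin <= (a^2 + b^2)^{1/2} against nu. *)
Let ab_le u : a u ^+ 2 + b u ^+ 2 <= L ^+ 2.
Proof.
set A := a u; set B := b u; set r := Num.sqrt (A ^+ 2 + B ^+ 2).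
have r0 : 0 <= r by exact: sqrtr_ge0.
have rE : r ^+ 2 = A ^+ 2 + B ^+ 2 by rewrite sqr_sqrtr// addr_ge0 ?sqr_ge0.
suff rL : r <= L by rewrite -rE lerXn2r.
have : A ^+ 2 + B ^+ 2 <= r * L.
  have -> : A ^+ 2 + B ^+ 2 = \int[mu]_h (A * (cos (u * h) * nu h) + B * (sin (u * h) * nu h)).
    rewrite RintegralD//.
    - by rewrite !RintegralZl.
    - by have := integrableZl measurableT A (icos u); apply: eq_integrable.
    - by have := integrableZl measurableT B (isin u); apply: eq_integrable.
  rewrite -RintegralZl//; apply: le_Rintegral => //.
  - have := integrableD measurableT (integrableZl measurableT A (icos u))
       (integrableZl measurableT B (isin u)).
    by apply: eq_integrable.
  - by have := integrableZl measurableT r nu_int; apply: eq_integrable.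
  move=> h _; rewrite !mulrA -mulrDl ler_wpM2r//.
  apply: le_trans (ler_norm _) _.
  rewrite -sqrtr_sqr ler_wsqrtr//.
  have := cos2Dsin2 (u * h); set x := cos _; set y := sin _ => xy.
  have : 0 <= (A * y - B * x) ^+ 2 by exact: sqr_ge0.
  have -> : A ^+ 2 + B ^+ 2 = (A ^+ 2 + B ^+ 2) * (x ^+ 2 + y ^+ 2) by rewrite xy mulr1.
  by move=> hh; nra.
rewrite -rE expr2; have [r1|r1] := ltP 0 r; first by rewrite ler_pM2l.
by move=> _; apply: le_trans r1 L0.
Qed.

(** 1 + delta psi = (1 - delta L) + delta L E e^{i u J} is the Fourier transform of
    one jump that occurs with probability delta L. Pairing with m is the
    corresponding mixture of pairings with waves, after exchanging the two
    integrals. *)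
Lemma one_sided_compound (delta : R) : 0 <= delta -> delta * L <= 1 ->
  one_sided (fun u => Complex (1 + delta * cos_part nu u) (delta * sin_part nu u)).
Proof.
move=> d0 dL.
have RE u : 1 + delta * cos_part nu u = (1 - delta * L) + delta * a u.
  by rewrite cos_partE; ring.
have i1 : (\d_(0 : R)).-integrable [set: R] (EFin \o (fun=> 1 : R)).
  exact: (@finite_measure_integrable_cst _ _ _ (\d_(0 : R)) setT 1).
have ma : measurable_fun [set: R] a.
  apply: (@product_dominated_measurable _ _ _ _ R (\d_(0 : R)) mu
    (fun z => cos (z.1 * z.2) * nu z.2) (fun=> 1) nu) => //.
  - apply: measurable_funM; first exact: continuous_prod2 (@continuous_cos R).
    exact: measurableT_comp.
  - by move=> x y; rewrite normrM (ger0_norm (nu_ge0 _)) ler_wpM2r ?cos_max ?sin_max.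
have mb : measurable_fun [set: R] b.
  apply: (@product_dominated_measurable _ _ _ _ R (\d_(0 : R)) mu
    (fun z => sin (z.1 * z.2) * nu z.2) (fun=> 1) nu) => //.
  - apply: measurable_funM; first exact: continuous_prod2 (@continuous_sin R).
    exact: measurableT_comp.
  - by move=> x y; rewrite normrM (ger0_norm (nu_ge0 _)) ler_wpM2r ?cos_max ?sin_max.
have mchi : measurable_complex
    (fun u => Complex (1 + delta * cos_part nu u) (delta * sin_part nu u)).
  split => /=.
  - by under eq_fun do rewrite RE; apply: measurable_funD => //; apply: measurable_funM.
  - exact: measurable_funM.
have nchi u : normc (Complex (1 + delta * cos_part nu u) (delta * sin_part nu u)) <= 1.
  rewrite /= RE -[leRHS]sqrtr1 ler_wsqrtr//.
  have h1 := ab_le u; have h2 : a u <= L.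
    have : a u ^+ 2 <= L ^+ 2 by apply: le_trans h1; rewrite lerDl sqr_ge0.
    move=> h3; apply: le_trans (ler_norm _) _.
    by rewrite -(@ler_pXn2r _ 2%N)// ?nnegrE// real_normK ?num_real.
  have h3 : sin_part nu u = b u by [].
  rewrite h3; move: h1 h2; set A := a u; set B := b u => h1 h2.
  have -> : (1 - delta * L + delta * A) ^+ 2 + (delta * B) ^+ 2 =
    1 - 2 * ((1 - delta * L) * (delta * (L - A))) - delta ^+ 2 * (L ^+ 2 - (A ^+ 2 + B ^+ 2)).
    by ring.
  have : 0 <= (1 - delta * L) * (delta * (L - A)) by rewrite !mulr_ge0 ?subr_ge0.
  have : 0 <= delta ^+ 2 * (L ^+ 2 - (A ^+ 2 + B ^+ 2)).
    by rewrite mulr_ge0 ?sqr_ge0 ?subr_ge0.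
  by move=> q0 p0; rewrite -addrA gerDl -opprD oppr_le0 addr_ge0// mulr_ge0.
split => // m B im mB.
have [ir ii] := im; have mm := integrable_complex_measurable im.
have [mr mi] := mm.
pose f (z : R * R) := (complex.Re (m z.1) * cos (z.1 * z.2) -
    complex.Im (m z.1) * sin (z.1 * z.2)) * nu z.2.
pose g u := `|complex.Re (m u)| + `|complex.Im (m u)|.
have mf : measurable_fun [set: R * R] f.
  apply: measurable_funM; last exact: measurableT_comp.
  apply: measurable_funB; apply: measurable_funM.
  - by apply: (measurableT_comp mr).
  - exact: continuous_prod2 (@continuous_cos R).
  - by apply: (measurableT_comp mi).
  - exact: continuous_prod2 (@continuous_sin R).
have fg x y : `|f (x, y)| <= g x * nu y.
  rewrite /f /g/= normrM (ger0_norm (nu_ge0 _)) ler_wpM2r//.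
  apply: le_trans (ler_normB _ _) _; rewrite !normrM.
  by apply: lerD; rewrite ler_piMr ?cos_max ?sin_max.
have ig : mu.-integrable [set: R] (EFin \o g) := integrable_complex_abs im.
have innerh h : \int[mu]_u f (u, h) = nu h * pairing m (wave h).
  rewrite /pairing -RintegralZl//.
    apply: eq_Rintegral => u _.
    by rewrite mulcE_Re /= expR0 !mul1r mulrC.
  exact: (integrable_complexM im (measurable_wave h) (normc_wave h)).1.
have inneru u : \int[mu]_h f (u, h) =
    complex.Re (m u) * a u - complex.Im (m u) * b u.
  rewrite -!RintegralZl//.
  rewrite -RintegralB//.
  - by apply: eq_Rintegral => h _; rewrite /f/=; ring.
  - by have := integrableZl measurableT (complex.Re (m u)) (icos u); apply: eq_integrable.
  - by have := integrableZl measurableT (complex.Im (m u)) (isin u); apply: eq_integrable.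
have swap := @Rintegral_swap _ _ _ _ R mu mu f g nu mf ig nu_int fg.
have pE : pairing m (fun u => Complex (1 + delta * cos_part nu u) (delta * sin_part nu u))
   = (1 - delta * L) * pairing m (wave 0) + delta * \int[mu]_h (nu h * pairing m (wave h)).
  have -> : \int[mu]_h (nu h * pairing m (wave h)) = \int[mu]_h \int[mu]_u f (u, h).
    by apply: eq_Rintegral => h _; rewrite innerh.
  rewrite -swap /pairing.
  have ifu : mu.-integrable [set: R] (EFin \o (fun u => \int[mu]_h f (u, h))).
    apply: (le_integrable measurableT _ _ (integrableZl measurableT L ig)).
      by apply/measurable_EFinP; exact: @product_dominated_measurable _ _ _ _ R mu mu f g nu mf ig nu_int fg.
    move=> u _ /=; rewrite lee_fin.
    have g0 : 0 <= g u by rewrite /g addr_ge0.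
    rewrite (ger0_norm (mulr_ge0 L0 g0)).
    apply: le_trans (le_normr_Rintegral _ _) _ => //.
      exact: @product_dominated_integrable1 _ _ _ _ R mu f g nu mf nu_int fg u.
    rewrite mulrC -RintegralZl//; apply: le_Rintegral => //.
    - exact: (integrable_abse (@product_dominated_integrable1 _ _ _ _ R mu f g nu mf nu_int fg u)).
    - by have := integrableZl measurableT (g u) nu_int; apply: eq_integrable.
  have iw := (integrable_complexM im (measurable_wave 0) (normc_wave 0)).1.
  rewrite -[X in _ = X + _](RintegralZl (1 - delta * L) measurableT iw).
  rewrite -[X in _ = _ + X](RintegralZl delta measurableT ifu) -RintegralD//.
  - apply: eq_Rintegral => u _; rewrite inneru !mulcE_Re /wave /cis /= mulr0 expR0 cos0 sin0 RE.
    by rewrite /sin_part -/(b u); move: (a u) (b u) => A B0; ring.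
  - have := integrableZl measurableT (1 - delta * L) (integrable_complexM im (measurable_wave 0) (normc_wave 0)).1.
    by apply: eq_integrable.
  - by have := integrableZl measurableT delta ifu; apply: eq_integrable.
rewrite pE.
have ipw : mu.-integrable [set: R] (EFin \o (fun h => nu h * pairing m (wave h))).
  pose G := \int[mu]_u g u.
  apply: (le_integrable measurableT _ _ (integrableZl measurableT G nu_int)).
    apply/measurable_EFinP.
    rewrite (_ : (fun h => _) = (fun h => \int[mu]_u f (u, h))); last first.
      by apply/funext => h; rewrite innerh.
    have mf' : measurable_fun [set: R * R] (fun z : R * R => f (z.2, z.1)).
      by apply: (measurableT_comp mf); exact: measurable_fun_pair.
    apply: (@product_dominated_measurable _ _ _ _ R mu mu (fun z => f (z.2, z.1)) nu g) => //.
    by move=> x y; rewrite mulrC; exact: fg.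
  move=> h _ /=; rewrite lee_fin -innerh.
  have G0 : 0 <= G by apply: Rintegral_ge0 => u _; rewrite /g addr_ge0.
  rewrite (ger0_norm (mulr_ge0 G0 (nu_ge0 h))).
  have ifh := @product_dominated_integrable2 _ _ _ _ R mu f g nu mf ig fg h.
  apply: le_trans (le_normr_Rintegral _ _) _ => //.
  rewrite /G mulrC -RintegralZl//; apply: le_Rintegral => //.
  - exact: (integrable_abse ifh).
  - by have := integrableZl measurableT (nu h) ig; apply: eq_integrable.
  - by move=> u _; rewrite mulrC.
have h1 : \int[mu]_h (nu h * pairing m (wave h)) <= L * B.
  rewrite /L mulrC -RintegralZl//; apply: le_Rintegral => //.
    by have := integrableZl measurableT B nu_int; apply: eq_integrable.
  move=> h _; have [h0|h0] := leP 0 h; first by rewrite [leRHS]mulrC ler_wpM2l// mB.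
  by rewrite nu_neg ?(ltW h0)// mul0r mulr0.
have h0 := mB 0 (lexx 0).
apply: (@le_trans _ _ ((1 - delta * L) * B + delta * (L * B))).
  by rewrite lerD ?ler_wpM2l// subr_ge0.
by rewrite le_eqVlt; apply/orP; left; apply/eqP; ring.
Qed.

(** e^{t psi} is the limit of (1 + t psi / n)^n, a power of one-sided functions. *)
Lemma one_sided_exp_finite (t : R) : 0 <= t ->
  one_sided (fun u => cis (t * cos_part nu u) (t * sin_part nu u)).
Proof.
move=> t0; pose N := Num.truncn (t * L).
have NP n : t / (n + N).+1%:R * L <= 1.
  rewrite mulrAC ler_pdivrMr// mul1r; apply: ltW.
  by apply: lt_le_trans (truncnS_gt _) _; rewrite ler_nat ltnS leq_addl.
have d0 n : 0 <= t / (n + N).+1%:R by rewrite divr_ge0.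
apply: (@one_sided_lim _ (fun n u => Complex (1 + t / (n + N).+1%:R * cos_part nu u)
   (t / (n + N).+1%:R * sin_part nu u) ^+ (n + N).+1)).
  by move=> n; apply: one_sidedX; apply: one_sided_compound.
move=> u.
have p0 : t * cos_part nu u <= 0.
  rewrite mulr_ge0_le0// cos_partE subr_le0; apply: le_Rintegral => //.
  by move=> h _; rewrite ler_piMl// cos_le1.
have eqE n : Complex (1 + t * cos_part nu u / n.+1%:R) (t * sin_part nu u / n.+1%:R) =
    Complex (1 + t / n.+1%:R * cos_part nu u) (t / n.+1%:R * sin_part nu u) :> R[i].
  by congr Complex; rewrite mulrAC.
have := @cis_limit R (t * cos_part nu u) (t * sin_part nu u) p0 _.
have nn : \forall n \near \oo, normc (Complex (1 + t * cos_part nu u / n.+1%:R)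
    (t * sin_part nu u / n.+1%:R) : R[i]) <= 1.
  exists N => // n Nn; rewrite eqE -(subnK Nn).
  by have [_ + _] := one_sided_compound (d0 (n - N)%N) (NP (n - N)%N); apply.
move=> /(_ nn); rewrite -(cvg_shiftn N); apply: cvg_trans; apply: near_eq_cvg.
by apply: nearW => n; congr (normc (_ ^+ _ - _)); rewrite -eqE.
Qed.

End finite_density.
End levy_exponent.

(** * Infinite jump measures, and cosine means *)

Section levy_density_exponent.
Variable R : realType.
Notation mu := (@lebesgue_measure R).
Variable nu : R -> R.
Hypothesis nu_ge0 : forall h, 0 <= nu h.
Hypothesis nu_neg : forall h, h <= 0 -> nu h = 0.
Hypothesis mnu : measurable_fun [set: R] nu.
Hypothesis nu_int : mu.-integrable [set: R] (EFin \o (fun h => Num.min 1 `|h| * nu h)).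

Lemma levy_bound (f : R -> R) (u : R) : (forall x, `|f x| <= `|x|) ->
  (forall x, `|f x| <= 2) ->
  forall h, `|f (u * h) * nu h| <= (2 + `|u|) * (Num.min 1 `|h| * nu h).
Proof.
move=> f1 f2 h; rewrite normrM (ger0_norm (nu_ge0 h)) mulrA ler_wpM2r//.
have [h1|h1] := leP 1 `|h|.
  by rewrite mulr1; apply: le_trans (f2 _) _; rewrite lerDl.
apply: le_trans (f1 _) _; rewrite normrM ler_wpM2r//.
by rewrite lerDr.
Qed.

Let cosb : (forall x : R, `|cos x - 1| <= `|x|) /\ (forall x : R, `|cos x - 1| <= 2).
Proof.
split=> x; first by have [] := sin_cos_lipschitz x.
apply: le_trans (ler_normB _ _) _; rewrite normr1 -[2]/(1 + 1) lerD2r.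
exact: cos_max.
Qed.

Let sinb : (forall x : R, `|sin x| <= `|x|) /\ (forall x : R, `|sin x| <= 2).
Proof.
split=> x; first by have [] := sin_cos_lipschitz x.
by apply: le_trans (sin_max _) _; rewrite ler1n.
Qed.

Let mcos (u : R) (k : R -> R) : measurable_fun [set: R] k ->
  measurable_fun [set: R] (fun h => (cos (u * h) - 1) * k h).
Proof.
move=> mk; apply: measurable_funM => //; apply: measurable_funB => //.
apply: measurableT_comp; first exact: continuous_measurable_fun (@continuous_cos R).
exact: measurable_funM.
Qed.

Let msin (u : R) (k : R -> R) : measurable_fun [set: R] k ->
  measurable_fun [set: R] (fun h => sin (u * h) * k h).
Proof.
move=> mk; apply: measurable_funM => //.
apply: measurableT_comp; first exact: continuous_measurable_fun (@continuous_sin R).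
exact: measurable_funM.
Qed.

Let ibound (u : R) : mu.-integrable [set: R]
  (EFin \o (fun h => (2 + `|u|) * (Num.min 1 `|h| * nu h))).
Proof.
by have := integrableZl measurableT (2 + `|u|) nu_int; apply: eq_integrable.
Qed.

Let b0 (u h : R) : 0 <= (2 + `|u|) * (Num.min 1 `|h| * nu h).
Proof. by rewrite !mulr_ge0// ?addr_ge0// le_min ler01 normr_ge0. Qed.

Lemma cos_part_integrable (u : R) :
  mu.-integrable [set: R] (EFin \o (fun h => (cos (u * h) - 1) * nu h)).
Proof.
apply: (le_integrable measurableT _ _ (ibound u)).
  by apply/measurable_EFinP; exact: mcos.
move=> h _; rewrite /= lee_fin [leRHS]ger0_norm//.
exact: (levy_bound u cosb.1 cosb.2).
Qed.

Lemma sin_part_integrable (u : R) :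
  mu.-integrable [set: R] (EFin \o (fun h => sin (u * h) * nu h)).
Proof.
apply: (le_integrable measurableT _ _ (ibound u)).
  by apply/measurable_EFinP; exact: msin.
move=> h _; rewrite /= lee_fin [leRHS]ger0_norm//.
exact: (levy_bound u sinb.1 sinb.2).
Qed.

(** Cut the jumps below 1 / (k + 1), apply the finite case, and let k tend to
    infinity. *)
Lemma one_sided_levy (t : R) : 0 <= t ->
  one_sided (fun u => cis (t * cos_part nu u) (t * sin_part nu u)).
Proof.
move=> t0.
pose nu_ (k : nat) (h : R) : R := if k.+1%:R^-1 < h then nu h else 0.
have nu_le k h : 0 <= nu_ k h <= nu h.
  by rewrite /nu_; case: ifP => _; rewrite ?lexx ?nu_ge0.
have mnu_ k : measurable_fun [set: R] (nu_ k).
  by apply: measurable_fun_ifT => //; exact: measurable_fun_ltr.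
have nu_i k : mu.-integrable [set: R] (EFin \o nu_ k).
  have i1 := integrableZl measurableT k.+1%:R nu_int.
  apply: (le_integrable measurableT _ _ i1); first by apply/measurable_EFinP; exact: mnu_.
  move=> h _ /=; rewrite lee_fin.
  have m0 : 0 <= Num.min 1 `|h| * nu h by rewrite mulr_ge0// le_min ler01 normr_ge0.
  rewrite [leRHS]ger0_norm; last by rewrite mulr_ge0.
  rewrite ger0_norm; last by have /andP[] := nu_le k h.
  rewrite /nu_; case: ifP => hk; last by rewrite mulr_ge0.
  rewrite mulrA ler_peMl// -ler_pdivrMl// mulr1 le_min.
  rewrite invf_le1// ler1n/=; apply: le_trans (ltW hk) _; exact: ler_norm.
have nu_cvg h : nu_ k h @[k --> \oo] --> nu h.
  have [h0|h0] := leP h 0.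
    apply: cvg_near_cst; apply: nearW => k; rewrite /nu_ ifF ?nu_neg//.
    by apply/negbTE; rewrite -leNgt (le_trans h0).
  apply: cvg_near_cst; near=> k; rewrite /nu_ ifT//.
  by near: k; exact: (near_infty_natSinv_lt (PosNum h0)).
have lim (f : R -> R) (u : R) : (forall x, `|f x| <= `|x|) -> (forall x, `|f x| <= 2) ->
    (forall k, measurable_fun [set: R] k -> measurable_fun [set: R] (fun h => f (u * h) * k h)) ->
    \int[mu]_h (f (u * h) * nu_ k h) @[k --> \oo] --> \int[mu]_h (f (u * h) * nu h).
  move=> f1 f2 mf; apply: (@Rintegral_dominated_cvg _ _ _ mu setT
    (fun k h => f (u * h) * nu_ k h) _ (fun h => (2 + `|u|) * (Num.min 1 `|h| * nu h))) => //.
  - by move=> k; exact: mf.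
  - exact: mf.
  - by apply: aeW => h _; apply: cvgM; [exact: cvg_cst|exact: nu_cvg].
  - move=> k h _; apply: le_trans (levy_bound u f1 f2 h); rewrite !normrM ler_wpM2l//.
    by have /andP[k1 k2] := nu_le k h; rewrite !ger0_norm.
apply: (@one_sided_lim _ (fun k u => cis (t * cos_part (nu_ k) u) (t * sin_part (nu_ k) u))).
  move=> k; apply: one_sided_exp_finite => //.
  - by move=> h; have /andP[] := nu_le k h.
  - by move=> h h0; rewrite /nu_ ifF//; apply/negbTE; rewrite -leNgt (le_trans h0).
move=> u.
have lc : t * cos_part (nu_ k) u @[k --> \oo] --> t * cos_part nu u.
  apply: cvgM; first exact: cvg_cst.
  exact: (lim (fun x => cos x - 1) u cosb.1 cosb.2 (mcos u)).
have ls : t * sin_part (nu_ k) u @[k --> \oo] --> t * sin_part nu u.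
  apply: cvgM; first exact: cvg_cst.
  exact: (lim (@sin R) u sinb.1 sinb.2 (msin u)).
set p := t * cos_part nu u; set q := t * sin_part nu u.
pose p_ k := t * cos_part (nu_ k) u; pose q_ k := t * sin_part (nu_ k) u.
have le : expR (p_ k) @[k --> \oo] --> expR p.
  by apply: continuous_cvg => //; exact: continuous_expR.
have lco : cos (q_ k) @[k --> \oo] --> cos q.
  by apply: continuous_cvg => //; exact: continuous_cos.
have lsi : sin (q_ k) @[k --> \oo] --> sin q.
  by apply: continuous_cvg => //; exact: continuous_sin.
have l0 (x_ : nat -> R) (x : R) : x_ k @[k --> \oo] --> x ->
    `|x_ k - x| @[k --> \oo] --> 0.
  move=> xx; have h : `|x_ k - x| @[k --> \oo] --> `|x - x|.
    by apply: cvg_norm; apply: cvgB => //; exact: cvg_cst.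
  by rewrite subrr normr0 in h.
apply: (@squeeze_cvgr _ _ _ _ (cst 0) (fun k =>
  `|expR (p_ k) * cos (q_ k) - expR p * cos q| +
  `|expR (p_ k) * sin (q_ k) - expR p * sin q|)).
- by apply: nearW => k; apply/andP; split; [exact: normc_ge0|exact: normc_le_add].
- exact: cvg_cst.
- by rewrite -[X in _ --> X](addr0 0); apply: cvgD; apply: l0; exact: cvgM.
Unshelve. all: by end_near. Qed.

End levy_density_exponent.

Section laplace_uniqueness.
Variable R : realType.

(** 2 cos(a) cos(b) = cos(a + b) + cos(a - b): means of cos(u Y) cos(e Y)^k are
    combinations of means of cos(v Y). The induction on p needs an extra factor
    cos(u Y) with arbitrary u. *)
Lemma cos_mean_polynomial d d' (T : measurableType d) (T' : measurableType d')
    (P : probability T R) (P' : probability T' R) (Y : T -> R) (Y' : T' -> R)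
    (e : R) (p : {poly R}) :
  measurable_fun [set: T] Y -> measurable_fun [set: T'] Y' ->
  (forall u, \int[P]_w cos (u * Y w) = \int[P']_w cos (u * Y' w)) ->
  \int[P]_w p.[cos (e * Y w)] = \int[P']_w p.[cos (e * Y' w)].
Proof.
move=> mY mY' YY'.
have bc d0 (T0 : measurableType d0) (Y0 : T0 -> R) (u : R) :
    measurable_fun [set: T0] Y0 -> bounded_rv (fun w => cos (u * Y0 w)).
  move=> mY0; split; last by exists 1 => w; exact: cos_max.
  apply: measurableT_comp; first exact: continuous_measurable_fun (@continuous_cos R).
  exact: measurable_funM.
have bp d0 (T0 : measurableType d0) (Y0 : T0 -> R) (q : {poly R}) :
    measurable_fun [set: T0] Y0 -> bounded_rv (fun w => q.[cos (e * Y0 w)]).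
  move=> mY0; elim/poly_ind: q => [|q c IH].
    by under eq_fun do rewrite horner0; exact: bounded_rv_cst.
  under eq_fun do rewrite hornerMXaddC.
  apply: bounded_rvD; last exact: bounded_rv_cst.
  by apply: bounded_rvM => //; exact: bc.
suff key u : \int[P]_w (cos (u * Y w) * p.[cos (e * Y w)]) =
    \int[P']_w (cos (u * Y' w) * p.[cos (e * Y' w)]).
  have := key 0; under eq_Rintegral do rewrite mul0r cos0 mul1r.
  by under [in RHS]eq_Rintegral do rewrite mul0r cos0 mul1r.
elim/poly_ind: p u => [|q c IH] u.
  under eq_Rintegral do rewrite horner0 mulr0.
  by under [in RHS]eq_Rintegral do rewrite horner0 mulr0; rewrite !mean_cst.
have expand d0 (T0 : measurableType d0) (P0 : probability T0 R) (Y0 : T0 -> R) :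
    measurable_fun [set: T0] Y0 ->
    \int[P0]_w (cos (u * Y0 w) * (q * 'X + c%:P).[cos (e * Y0 w)]) =
    2^-1 * \int[P0]_w (cos ((u + e) * Y0 w) * q.[cos (e * Y0 w)]) +
    (2^-1 * \int[P0]_w (cos ((u - e) * Y0 w) * q.[cos (e * Y0 w)]) +
    c * \int[P0]_w cos (u * Y0 w)).
  move=> mY0.
  have b1 v : bounded_rv (fun w => cos (v * Y0 w) * q.[cos (e * Y0 w)]).
    by apply: bounded_rvM; [exact: bc|exact: bp].
  have b2 v k : bounded_rv (fun w => k * (cos (v * Y0 w) * q.[cos (e * Y0 w)])).
    by apply: bounded_rvM; [exact: bounded_rv_cst|exact: b1].
  have b3 : bounded_rv (fun w => c * cos (u * Y0 w)).
    by apply: bounded_rvM; [exact: bounded_rv_cst|exact: bc].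
  rewrite -!meanZ//; try exact: bc.
  rewrite -!meanD//; last exact: bounded_rvD.
  apply: eq_Rintegral => w _.
  by rewrite hornerMXaddC mulrDl mulrBl cosD cosB; field.
by rewrite !expand// !IH YY'.
Qed.

(** |y| is the limit of n |sin (y / n)|, a continuous function of cos (2 y / n).
    So the means of cos(u Y) determine, through Weierstrass, those of
    e^{- lam |Y|}: uniqueness of Laplace transforms from characteristic functions,
    with no inversion formula. *)
Lemma cos_mean_laplace d d' (T : measurableType d) (T' : measurableType d')
    (P : probability T R) (P' : probability T' R) (Y : T -> R) (Y' : T' -> R)
    (lam : R) :
  measurable_fun [set: T] Y -> measurable_fun [set: T'] Y' ->
  (forall u, \int[P]_w cos (u * Y w) = \int[P']_w cos (u * Y' w)) -> 0 <= lam ->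
  \int[P]_w expR (- lam * `|Y w|) = \int[P']_w expR (- lam * `|Y' w|).
Proof.
move=> mY mY' YY' lam0.
pose f (n : nat) (c : R) : R := expR (- lam * (n.+1%:R * Num.sqrt ((1 - c) / 2))).
have cf n : continuous (f n).
  move=> c; apply: continuous_comp; last exact: continuous_expR.
  apply: cvgM; first exact: cvg_cst.
  apply: cvgM; first exact: cvg_cst.
  apply: continuous_cvg; first exact: sqrt_continuous.
  by apply: cvgM; [apply: cvgB; [exact: cvg_cst|exact: cvg_id]|exact: cvg_cst].
have fE n (y : R) : f n (cos (2 / n.+1%:R * y)) =
    expR (- lam * `|n.+1%:R * sin (y / n.+1%:R)|).
  rewrite /f; congr (expR (- lam * _)).
  rewrite normrM (ger0_norm (ler0n _ _)); congr (_ * _).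
  rewrite -sqrtr_sqr; congr Num.sqrt.
  rewrite (_ : 2 / _ * y = (y / n.+1%:R) *+ 2); last by rewrite mulr2n; ring.
  rewrite mulr2n cosD; have := cos2Dsin2 (y / n.+1%:R).
  set C := cos _; set S := sin _ => CS.
  have -> : S ^+ 2 = 1 - C ^+ 2 by rewrite -CS addrC addKr.
  have SS : S * S = 1 - C * C by rewrite -!expr2 -CS addrC addKr.
  by rewrite SS; field.
have f01 n c : 0 <= f n c <= 1.
  by rewrite /f expR_ge0/= -expR0 ler_expR mulNr oppr_le0 mulr_ge0//.
have mf n : measurable_fun [set: R] (f n) by exact: continuous_measurable_fun.
have mc d0 (T0 : measurableType d0) (Y0 : T0 -> R) (u : R) :
    measurable_fun [set: T0] Y0 -> measurable_fun [set: T0] (fun w => cos (u * Y0 w)).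
  move=> mY0.
  apply: measurableT_comp; first exact: continuous_measurable_fun (@continuous_cos R).
  exact: measurable_funM.
have bf d0 (T0 : measurableType d0) (Y0 : T0 -> R) n :
    measurable_fun [set: T0] Y0 -> bounded_rv (fun w => f n (cos (2 / n.+1%:R * Y0 w))).
  move=> mY0; split; first by apply: (measurableT_comp (mf n)); exact: mc.
  by exists 1 => w; have /andP[h1 h2] := f01 n (cos (2 / n.+1%:R * Y0 w)); rewrite ger0_norm.
have lim d0 (T0 : measurableType d0) (P0 : probability T0 R) (Y0 : T0 -> R) :
    measurable_fun [set: T0] Y0 ->
    \int[P0]_w f n (cos (2 / n.+1%:R * Y0 w)) @[n --> \oo] -->
    \int[P0]_w expR (- lam * `|Y0 w|).
  move=> mY0; apply: (@mean_cvg _ _ _ P0 (fun n w => f n (cos (2 / n.+1%:R * Y0 w))) _ 1).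
  - by move=> n; have [] := bf _ _ Y0 n mY0.
  - split.
      apply: measurableT_comp => //; apply: measurable_funM => //.
      exact: measurableT_comp.
    exists 1 => w; rewrite ger0_norm ?expR_ge0// -expR0 ler_expR mulNr oppr_le0.
    by rewrite mulr_ge0.
  - by move=> n w; have /andP[h1 h2] := f01 n (cos (2 / n.+1%:R * Y0 w)); rewrite ger0_norm.
  - apply: aeW => w /=; under eq_fun do rewrite fE.
    apply: continuous_cvg; first exact: continuous_expR.
    apply: cvgM; first exact: cvg_cst.
    apply: cvg_norm.
    have dS : is_derive (0 : R) 1 (fun s : R => sin (Y0 w * s)) (Y0 w).
      by apply: is_derive_eq; rewrite /GRing.scale/= mulr0 cos0; ring.
    have := derive0_seq dS; rewrite mulr0 sin0.
    by under eq_fun do rewrite subr0.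
suff eqn n : \int[P]_w f n (cos (2 / n.+1%:R * Y w)) =
    \int[P']_w f n (cos (2 / n.+1%:R * Y' w)).
  have := lim _ _ P Y mY; under eq_fun do rewrite eqn.
  by move=> h; apply: (cvg_unique _ h (lim _ _ P' Y' mY')).
pose c2 (x : R) := 2 * x - 1.
have cc2 : continuous (f n \o c2).
  move=> x; apply: continuous_comp; last exact: cf.
  by apply: cvgB; [apply: cvgM; [exact: cvg_cst|exact: cvg_id]|exact: cvg_cst].
have close d0 (T0 : measurableType d0) (P0 : probability T0 R) (Y0 : T0 -> R)
    (p : {poly R}) (e : R) : measurable_fun [set: T0] Y0 ->
    (forall x, 0 <= x <= 1 -> `|(f n \o c2) x - p.[x]| <= e) ->
    `|\int[P0]_w f n (cos (2 / n.+1%:R * Y0 w)) -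
      \int[P0]_w (p \Po (2^-1%:P * 'X + 2^-1%:P)).[cos (2 / n.+1%:R * Y0 w)]| <= e.
  move=> mY0 pf.
  set q := p \Po _.
  have bq : bounded_rv (fun w => q.[cos (2 / n.+1%:R * Y0 w)]).
    elim/poly_ind: q => [|q c IH].
      by under eq_fun do rewrite horner0; exact: bounded_rv_cst.
    under eq_fun do rewrite hornerMXaddC.
    apply: bounded_rvD; last exact: bounded_rv_cst.
    apply: bounded_rvM => //; split; first exact: mc.
    by exists 1 => w; exact: cos_max.
  have pw w : `|f n (cos (2 / n.+1%:R * Y0 w)) - q.[cos (2 / n.+1%:R * Y0 w)]| <= e.
    set c := cos _.
    have := pf (2^-1 * c + 2^-1); rewrite /= /c2 /q horner_comp !hornerE.
    rewrite (_ : 2 * (2^-1 * c + 2^-1) - 1 = c); last by field.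
    apply; have := cos_le1 (2 / n.+1%:R * Y0 w); have := cos_geN1 (2 / n.+1%:R * Y0 w).
    by rewrite -/c => *; lra.
  rewrite -meanB//; last exact: bf.
  have bd : bounded_rv (fun w => f n (cos (2 / n.+1%:R * Y0 w)) -
      q.[cos (2 / n.+1%:R * Y0 w)]) by apply: bounded_rvB => //; exact: bf.
  rewrite ler_norml; apply/andP; split.
    rewrite -(mean_cst P0 (- e)); apply: mean_le => //; first exact: bounded_rv_cst.
    by apply: aeW => w; have := pw w; rewrite ler_norml => /andP[].
  rewrite -[leRHS](mean_cst P0 e); apply: mean_le => //; first exact: bounded_rv_cst.
  by apply: aeW => w; have := pw w; rewrite ler_norml => /andP[].
apply/eqP; rewrite -subr_eq0 -normr_le0; apply/ler_addgt0Pr => e e0; rewrite add0r.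
have e2 : 0 < e / 2 by rewrite divr_gt0.
have [p pf] := weierstrass cc2 e2.
have h1 := close _ _ P Y p _ mY pf; have h2 := close _ _ P' Y' p _ mY' pf.
rewrite (cos_mean_polynomial _ _ mY mY' YY') in h1.
move: h1 h2; set I1 := \int[P]_w _; set I2 := \int[P']_w f _ _; set I3 := \int[P']_w _.
move=> h1 h2; have h3 := ler_distD I3 I1 I2.
by apply: le_trans h3 _; rewrite (distrC I3) (splitr e) lerD.
Qed.

End laplace_uniqueness.

(** * Non-negativity from the Poisson kernel *)

Section poisson_kernel.
Variable R : realType.
Notation mu := (@lebesgue_measure R).

Section kernel.
Variable a : R.
Hypothesis a0 : 0 < a.

(** Working with 1 + cos instead of cos makes the integrand non-negative, which
    the improper fundamental theorem of calculus asks for. *)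
Let prim (z u : R) : R := - (a^-1 * expR (- a * u)) +
  (a ^+ 2 + z ^+ 2)^-1 * (expR (- a * u) * (z * sin (z * u) - a * cos (z * u))).

Let dprim (z u : R) : is_derive u (1 : R) (prim z) (expR (- a * u) * (1 + cos (z * u))).
Proof.
have az : a ^+ 2 + z ^+ 2 != 0 by rewrite gt_eqF// ltr_pwDl ?exprn_gt0// sqr_ge0.
apply: is_derive_eq; rewrite /GRing.scale/=.
set E := expR _; set C := cos _; set S := sin _.
by field; rewrite az gt_eqF.
Qed.

Let prim0 (z : R) : prim z 0 = - (a^-1 + a / (a ^+ 2 + z ^+ 2)).
Proof. by rewrite /prim !mulr0 expR0 sin0 cos0; ring. Qed.

Let prim_oo (z : R) : prim z u @[u --> +oo] --> 0.
Proof.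
have e0 : expR (- a * u) @[u --> +oo] --> 0.
  have h : a * u @[u --> +oo] --> +oo by apply: gt0_cvgMry => //; exact: cvg_id.
  have := cvg_comp _ _ h (@cvgr_expR R); apply: cvg_trans; apply: near_eq_cvg.
  by apply: nearW => u /=; rewrite mulNr.
pose K := a^-1 + (a ^+ 2 + z ^+ 2)^-1 * (`|z| + a).
have i0 : 0 <= (a ^+ 2 + z ^+ 2)^-1 by rewrite invr_ge0 addr_ge0 ?sqr_ge0.
have bound u : `|prim z u| <= K * expR (- a * u).
  rewrite /prim /K; apply: le_trans (ler_normD _ _) _; rewrite normrN !normrM mulrDl.
  rewrite (ger0_norm (expR_ge0 _)) (ger0_norm i0) [`|a^-1|]ger0_norm ?invr_ge0 ?(ltW a0)//.
  rewrite lerD2l -mulrA ler_wpM2l// mulrC ler_wpM2r ?expR_ge0//.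
  apply: le_trans (ler_normB _ _) _; rewrite !normrM (ger0_norm (ltW a0)) lerD//.
  - by rewrite ler_piMr// sin_max.
  - by rewrite ler_piMr ?(ltW a0)// cos_max.
apply: (@squeeze_cvgr _ _ _ _ (fun u => - (K * expR (- a * u)))
   (fun u => K * expR (- a * u))).
- by apply: nearW => u; rewrite -ler_norml.
- rewrite -[X in _ --> X]oppr0 -(mulr0 K); apply: cvgN; apply: cvgM => //; exact: cvg_cst.
- by rewrite -(mulr0 K); apply: cvgM => //; exact: cvg_cst.
Qed.

Let cont_cexp (z : R) : continuous (fun u : R => expR (- a * u) * (1 + cos (z * u))).
Proof.
move=> u; apply: cvgM.
  apply: continuous_cvg; first exact: continuous_expR.
  by apply: cvgM; [exact: cvg_cst|exact: cvg_id].
apply: cvgD; first exact: cvg_cst.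
apply: continuous_cvg; first exact: continuous_cos.
by apply: cvgM; [exact: cvg_cst|exact: cvg_id].
Qed.

Let ge0_cexp (z u : R) : 0 <= expR (- a * u) * (1 + cos (z * u)).
Proof. by rewrite mulr_ge0 ?expR_ge0// -lerBlDl sub0r cos_geN1. Qed.

Let int_cexp (z : R) : (\int[mu]_(u in `[0%R, +oo[)
   (expR (- a * u) * (1 + cos (z * u)))%:E = (a^-1 + a / (a ^+ 2 + z ^+ 2))%:E)%E.
Proof.
have cF (u : R) : {for u, continuous (prim z)}.
  apply: differentiable_continuous; apply/derivable1_diffP.
  by have [] := dprim z u.
rewrite (@ge0_continuous_FTC2y _ _ (prim z) 0 0).
- by rewrite prim0 -EFinB; congr EFin; rewrite sub0r opprK.
- by move=> u _; exact: ge0_cexp.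
- by apply: continuous_subspaceT; exact: cont_cexp.
- exact: prim_oo.
- by move=> u _; have [] := dprim z u.
- by apply: cvg_at_right_filter; exact: cF.
- by move=> u _; rewrite derive1E; have [_ ->] := dprim z u.
Qed.

(** The half-line exponential, whose cosine transform is the Poisson kernel. *)
Definition half_exp (u : R) : R := if 0 <= u then expR (- a * u) else 0.

Lemma half_exp_ge0 u : 0 <= half_exp u.
Proof. by rewrite /half_exp; case: ifP => // _; exact: expR_ge0. Qed.

Let half_expE (f : R -> R) : (fun u => half_exp u * f u) =
  (fun u => expR (- a * u) * f u) \_ `[0%R, +oo[.
Proof.
apply/funext => u; rewrite patchE /half_exp; case: ifPn => u0.
  by rewrite mem_set//= in_itv/= u0.
by rewrite memNset ?mul0r//= in_itv/= andbT; exact/negP.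
Qed.

Let int2 (z : R) : mu.-integrable [set: R] (EFin \o (fun u => half_exp u * (1 + cos (z * u)))).
Proof.
rewrite half_expE -restrict_EFin; apply: (iffLR (integrable_mkcond _ _)) => //.
apply/integrableP; split.
  have mc : measurable_fun [set: R] (fun u : R => expR (- a * u) * (1 + cos (z * u))).
    by apply: continuous_measurable_fun; exact: cont_cexp.
  by apply/measurable_EFinP; exact: measurable_funTS.
under eq_integral do rewrite /= ger0_norm ?ge0_cexp//.
by rewrite int_cexp ltry.
Qed.

Let val2 (z : R) : \int[mu]_u (half_exp u * (1 + cos (z * u))) =
  a^-1 + a / (a ^+ 2 + z ^+ 2).
Proof. by rewrite half_expE -Rintegral_mkcond /Rintegral int_cexp. Qed.

Lemma half_exp_integrable : mu.-integrable [set: R] (EFin \o half_exp).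
Proof.
have := integrableZl measurableT 2^-1 (int2 0); apply: eq_integrable => // u _ /=.
by rewrite -EFinM mul0r cos0; congr EFin; field.
Qed.

Let half_exp_mean : \int[mu]_u half_exp u = a^-1.
Proof.
have h := val2 0.
have <- : 2^-1 * \int[mu]_u (half_exp u * (1 + cos (0 * u))) = \int[mu]_u half_exp u.
  rewrite -RintegralZl//.
  by apply: eq_Rintegral => u _; rewrite mul0r cos0; field.
by rewrite h; field; rewrite gt_eqF.
Qed.

Lemma half_exp_cos (z : R) :
  \int[mu]_u (half_exp u * cos (z * u)) = a / (a ^+ 2 + z ^+ 2).
Proof.
rewrite (_ : a / _ = a^-1 + a / (a ^+ 2 + z ^+ 2) - a^-1); last by ring.
rewrite -val2 -half_exp_mean -RintegralB//.
- by apply: eq_Rintegral => u _; ring.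
- exact: half_exp_integrable.
Qed.

End kernel.

Section poisson_mean.
Variables (d : measure_display) (T : measurableType d) (P : probability T R).
Variables (Y : T -> R) (chi : R -> R[i]).
Hypothesis mY : measurable_fun [set: T] Y.
Hypothesis Ycos : forall u, \int[P]_w cos (u * Y w) = complex.Re (chi u).
Hypothesis Ysin : forall u, \int[P]_w sin (u * Y w) = complex.Im (chi u).

(** The integrable test function whose pairing with the wave at x is the Poisson
    kernel a / (a^2 + (x - y)^2). *)
Definition poisson_weight (a y u : R) : R[i] :=
  Complex (half_exp a u * cos (u * y)) (- (half_exp a u * sin (u * y))).

Let brv_cos u : bounded_rv (fun w => cos (u * Y w)).
Proof.
split; last by exists 1 => w; exact: cos_max.
apply: measurableT_comp; first exact: continuous_measurable_fun (@continuous_cos R).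
exact: measurable_funM.
Qed.

Let brv_sin u : bounded_rv (fun w => sin (u * Y w)).
Proof.
split; last by exists 1 => w; exact: sin_max.
apply: measurableT_comp; first exact: continuous_measurable_fun (@continuous_sin R).
exact: measurable_funM.
Qed.

Lemma poisson_weight_integrable (a y : R) : 0 < a ->
  integrable_complex (poisson_weight a y).
Proof.
move=> a0; have ia := half_exp_integrable a0.
have ma : measurable_fun [set: R] (half_exp a).
  by apply/measurable_EFinP; exact: measurable_int ia.
split; apply: (le_integrable measurableT _ _ ia).
- apply/measurable_EFinP; apply: measurable_funM => //.
  apply: measurableT_comp; first exact: continuous_measurable_fun (@continuous_cos R).
  exact: measurable_funM.
- by move=> u _; rewrite /= lee_fin normrM ler_piMr// cos_max.
- apply/measurable_EFinP; apply: measurable_funN; apply: measurable_funM => //.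
  apply: measurableT_comp; first exact: continuous_measurable_fun (@continuous_sin R).
  exact: measurable_funM.
- by move=> u _; rewrite /= lee_fin normrN normrM ler_piMr// sin_max.
Qed.

Lemma poisson_weight_wave (a y x : R) : 0 < a ->
  pairing (poisson_weight a y) (wave x) = a / (a ^+ 2 + (x - y) ^+ 2).
Proof.
move=> a0; rewrite -half_exp_cos//; apply: eq_Rintegral => u _.
rewrite mulcE_Re /= expR0 (_ : (x - y) * u = u * x - u * y); last by ring.
by rewrite cosB; ring.
Qed.

Lemma poisson_mean (a y : R) : 0 < a ->
  \int[P]_w (a / (a ^+ 2 + (Y w - y) ^+ 2)) = pairing (poisson_weight a y) chi.
Proof.
move=> a0; have ia := half_exp_integrable a0.
have ma : measurable_fun [set: R] (half_exp a).
  by apply/measurable_EFinP; exact: measurable_int ia.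
pose f (z : R * T) := half_exp a z.1 * cos ((Y z.2 - y) * z.1).
have mf : measurable_fun [set: R * T] f.
  apply: measurable_funM; first exact: measurableT_comp.
  apply: measurableT_comp; first exact: continuous_measurable_fun (@continuous_cos R).
  apply: measurable_funM => //; apply: measurable_funB => //.
  exact: measurableT_comp.
have i1 : P.-integrable [set: T] (EFin \o (fun=> 1 : R)).
  by apply: bounded_rv_integrable; exact: bounded_rv_cst.
have fg x w : `|f (x, w)| <= half_exp a x * 1.
  rewrite /f/= normrM (ger0_norm (half_exp_ge0 _ _)) ler_wpM2l ?half_exp_ge0//.
  exact: cos_max.
have swap := @Rintegral_swap _ _ _ _ R mu P f (half_exp a) (fun=> 1) mf ia i1 fg.
transitivity (\int[P]_w \int[mu]_u f (u, w)).
  by apply: eq_Rintegral => w _; rewrite -half_exp_cos.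
rewrite -swap; apply: eq_Rintegral => u _.
have bc k : bounded_rv (fun w => k * cos (u * Y w)).
  by apply: bounded_rvM => //; exact: bounded_rv_cst.
have bs k : bounded_rv (fun w => k * sin (u * Y w)).
  by apply: bounded_rvM => //; exact: bounded_rv_cst.
rewrite mulcE_Re /= mulNr opprK -Ycos -Ysin -!meanZ// -meanD//.
apply: eq_Rintegral => w _; rewrite /f /=.
rewrite (_ : (Y w - y) * u = u * Y w - u * y); last by ring.
by rewrite cosB; ring.
Qed.

Hypothesis ochi : one_sided chi.

(** The Poisson kernel centred at y < 0 is at most its value at 0 on the whole
    half-line x >= 0, so the one-sided characteristic function inherits this
    bound. *)
Lemma one_sided_poisson (a y : R) : 0 < a -> y < 0 ->
  \int[P]_w (a / (a ^+ 2 + (Y w - y) ^+ 2)) <= a / (a ^+ 2 + y ^+ 2).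
Proof.
move=> a0 y0; rewrite poisson_mean//; have [_ _ op] := ochi.
apply: op; first exact: poisson_weight_integrable.
move=> x x0; rewrite poisson_weight_wave// ler_wpM2l ?(ltW a0)//.
have p0 v : 0 < a ^+ 2 + v ^+ 2 by rewrite ltr_pwDl ?exprn_gt0// sqr_ge0.
rewrite lef_pV2 ?posrE// lerD2l -sqrrN lerXn2r ?nnegrE ?oppr_ge0 ?(ltW y0)//.
  by rewrite subr_ge0 (le_trans (ltW y0)).
by rewrite -subr_ge0 opprK subrK.
Qed.

(** The Poisson kernel of width a at y < 0 has mean at most a / y^2, but is at least
    1 / (2 a) on the interval of length 2 a around y. A compact set of negative numbers is
    covered by O(1 / a) such intervals, so its probability is O(a). *)
Lemma one_sided_ge0 : {ae P, forall w, 0 <= Y w}.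
Proof.
have key (K : nat) (r : R) : 0 < r -> {ae P, forall w, ~ (- r - K%:R <= Y w <= - r)}.
  move=> r0; pose I w : R := if - r - K%:R <= Y w <= - r then 1 else 0.
  have bI : bounded_rv I.
    split; last by exists 1 => w; rewrite /I; case: ifP; rewrite ?normr1 ?normr0.
    apply: measurable_fun_ifT => //.
    by apply: measurable_and; apply: measurable_fun_ler.
  pose C := 2 * (K.+1)%:R / r ^+ 2.
  have EI n : \int[P]_w I w <= C / n.+1%:R.
    pose a : R := n.+1%:R^-1.
    have a0 : 0 < a by rewrite invr_gt0.
    pose J := (K * n.+1).+1; pose y (j : nat) : R := - r - j%:R * a.
    have y0 j : y j < 0.
      by rewrite /y -opprD oppr_lt0 ltr_pwDl// mulr_ge0// ltW.
    pose p j w := a / (a ^+ 2 + (Y w - y j) ^+ 2).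
    have q0 (v : R) : 0 < a ^+ 2 + v ^+ 2 by rewrite ltr_pwDl ?exprn_gt0// sqr_ge0.
    have p0 j w : 0 <= p j w by rewrite divr_ge0// ltW.
    have bp j : bounded_rv (p j).
      split.
        have ck : continuous (fun x : R => a / (a ^+ 2 + (x - y j) ^+ 2)).
          move=> x; apply: cvgM; first exact: cvg_cst.
          apply: cvgV; first by rewrite gt_eqF.
          apply: cvgD; first exact: cvg_cst.
          apply: (@continuous_cvg _ _ _ _ _ _ (fun v : R => v ^+ 2)).
            exact: exprn_continuous.
          by apply: cvgB; [exact: cvg_id|exact: cvg_cst].
        exact: measurableT_comp (continuous_measurable_fun ck) mY.
      exists (a / a ^+ 2) => w; rewrite ger0_norm ?p0// ler_wpM2l ?(ltW a0)//.
      by rewrite lef_pV2 ?posrE ?exprn_gt0// lerDl sqr_ge0.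
    have bs : bounded_rv (fun w => \sum_(j < J) p j w) by exact: bounded_rv_sum.
    have I_le w : I w <= 2 * a * \sum_(j < J) p j w.
      have s0 : 0 <= 2 * a * \sum_(j < J) p j w.
        by rewrite !mulr_ge0 ?(ltW a0)// sumr_ge0.
      rewrite /I; case: ifPn => // /andP[Y1 Y2].
      pose v := (- r - Y w) / a.
      have v0 : 0 <= v by rewrite divr_ge0 ?(ltW a0)// subr_ge0.
      pose j := Num.truncn v.
      have /andP[jv vj] : j%:R <= v < j.+1%:R by rewrite truncn_itv.
      have jJ : (j < J)%N.
        rewrite ltnS -(ler_nat R); apply: le_trans jv _.
        rewrite /v ler_pdivrMr// natrM -mulrA divff ?pnatr_eq0// mulr1.
        by lra.
      rewrite (bigD1 (Ordinal jJ))//= mulrDr.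
      apply: ler_wpDr; first by rewrite !mulr_ge0 ?(ltW a0)// sumr_ge0.
      rewrite /p mulrA ler_pdivlMr// mul1r.
      have : (Y w - y j) ^+ 2 <= a ^+ 2.
        rewrite -[leLHS]real_normK ?num_real// lerXn2r ?nnegrE ?(ltW a0)//.
        have vE : v * a = - r - Y w by rewrite /v divfK// gt_eqF.
        rewrite distrC ler_norml /y.
        have h1 : j%:R * a <= v * a by rewrite ler_pM2r.
        have h2 : v * a <= j%:R * a + a by rewrite -[X in _ + X]mul1r -mulrDl ler_pM2r// natr1 ltW.
        by rewrite vE in h1 h2; apply/andP; split; lra.
      by rewrite -mulrA -expr2 => h; lra.
    apply: (@le_trans _ _ (2 * a * \sum_(j < J) \int[P]_w p j w)).
      rewrite -mean_sum// -meanZ//; apply: mean_le => //.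
        by apply: bounded_rvM => //; exact: bounded_rv_cst.
      by apply: aeW => w; exact: I_le.
    have Ep j : \int[P]_w p j w <= a / r ^+ 2.
      apply: le_trans (one_sided_poisson a0 (y0 j)) _.
      rewrite ler_wpM2l ?(ltW a0)// lef_pV2 ?posrE ?exprn_gt0//.
      apply: (@le_trans _ _ (y j ^+ 2)); last by rewrite lerDr sqr_ge0.
      rewrite -[leRHS]sqrrN lerXn2r ?nnegrE ?(ltW r0) ?oppr_ge0 ?(ltW (y0 j))//.
      by rewrite /y opprB opprK addrC lerDl mulr_ge0// ltW.
    apply: (@le_trans _ _ (2 * a * \sum_(j < J) (a / r ^+ 2))).
      by rewrite ler_wpM2l ?mulr_ge0 ?(ltW a0)//; apply: ler_sum => j _.
    rewrite sumr_const card_ord -[_ *+ J]mulr_natl.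
    have JK : J%:R <= K.+1%:R * n.+1%:R :> R.
      by rewrite -natrM ler_nat /J mulSn addSn ltnS leq_addl.
    rewrite (_ : 2 * a * (J%:R * (a / r ^+ 2)) = J%:R * (2 * a ^+ 2 / r ^+ 2)); last by ring.
    apply: le_trans (ler_wpM2r _ JK) _.
      by rewrite divr_ge0 ?sqr_ge0// mulr_ge0 ?sqr_ge0.
    rewrite /C /a le_eqVlt; apply/orP; left; apply/eqP.
    have N0 : (n.+1%:R : R) != 0 by rewrite pnatr_eq0.
    by move: N0; move: (n.+1%:R : R) (K.+1%:R : R) => N M N0; field; rewrite N0 (gt_eqF r0).
  have I0 w : 0 <= I w by rewrite /I; case: ifP.
  have EI0 : \int[P]_w I w <= 0.
    have C0 : 0 <= C by rewrite divr_ge0 ?sqr_ge0// mulr_ge0.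
    apply/ler_addgt0Pr => e e0; rewrite add0r.
    apply: le_trans (EI (Num.truncn (C / e))) _.
    by rewrite ler_pdivrMr// mulrC -ler_pdivrMr// ltW// truncnS_gt.
  have := mean_ge0_eq0 bI I0 EI0; apply: filterS => w Iw Yw.
  by move: Iw; rewrite /I Yw => /eqP; rewrite oner_eq0.
have all_ : {ae P, forall w, forall n : nat, ~ (- n.+1%:R^-1 - n%:R <= Y w <= - n.+1%:R^-1)}.
  by apply: ae_foralln => n; apply: key; rewrite invr_gt0.
apply: filterS all_ => w hw; rewrite leNgt; apply/negP => Y0.
have Yp : 0 < - Y w by rewrite oppr_gt0.
pose n := maxn (Num.truncn (- Y w)).+1 (Num.truncn ((- Y w)^-1)).
apply: (hw n); apply/andP; split.
  have h : - Y w <= n%:R.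
    by apply: ltW; apply: lt_le_trans (truncnS_gt _) _; rewrite ler_nat leq_maxl.
  have : 0 <= n.+1%:R^-1 :> R by [].
  by set q := n.+1%:R^-1 => q0; lra.
rewrite lerNr -[leRHS]invrK lef_pV2 ?posrE ?invr_gt0//.
apply: ltW; apply: lt_le_trans (truncnS_gt _) _.
by rewrite ler_nat ltnS leq_maxr.
Qed.

End poisson_mean.

End poisson_kernel.

(** * The stable exponent *)

(** Additive and non-negative functions are monotone; squeeze f (n t) between
    integer multiples of f 1. *)
Lemma additive_nonneg_linear (R : realType) (f : R -> R) :
  (forall s t, 0 <= s -> 0 <= t -> f (s + t) = f s + f t) ->
  (forall t, 0 <= t -> 0 <= f t) -> forall t, 0 <= t -> f t = t * f 1.
Proof.
move=> fD f0 t t0.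
have f00 : f 0 = 0.
  have := fD 0 0 (lexx _) (lexx _); rewrite addr0 => /eqP.
  by rewrite -subr_eq0 opprD addrA subrr sub0r oppr_eq0 => /eqP.
have fn s n : 0 <= s -> f (n%:R * s) = n%:R * f s.
  move=> s0; elim: n => [|n IH]; first by rewrite !mul0r.
  by rewrite -natr1 !mulrDl !mul1r fD ?mulr_ge0// IH.
have fm s u : 0 <= s -> s <= u -> f s <= f u.
  move=> s0 su; rewrite -(subrK s u) addrC fD ?subr_ge0// lerDl f0//.
  by rewrite subr_ge0.
have bound (n : nat) : n.+1%:R * `|f t - t * f 1| <= f 1.
  rewrite -[X in X * _]ger0_norm// -normrM mulrBr -fn//.
  have nt0 : 0 <= n.+1%:R * t by rewrite mulr_ge0.
  set m := Num.truncn (n.+1%:R * t).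
  have /andP[m1 m2] : m%:R <= n.+1%:R * t < m.+1%:R by rewrite truncn_itv.
  have fnat k : f k%:R = k%:R * f 1 by rewrite -[X in f X]mulr1 fn.
  have h1 : m%:R * f 1 <= f (n.+1%:R * t) by rewrite -fnat; apply: fm.
  have h2 : f (n.+1%:R * t) <= m%:R * f 1 + f 1.
    rewrite -[X in _ + X]mul1r -mulrDl natr1 -fnat; apply: fm => //; exact: ltW.
  have h3 : m%:R * f 1 <= n.+1%:R * t * f 1 by rewrite ler_wpM2r ?f0.
  have h4 : n.+1%:R * t * f 1 <= m%:R * f 1 + f 1.
    by rewrite -[X in _ + X]mul1r -mulrDl natr1 ler_wpM2r ?f0// ltW.
  rewrite mulrA; move: h1 h2 h3 h4.
  move: (f (n.+1%:R * t)) (m%:R * f 1) (n.+1%:R * t * f 1) (f 1) => A B C D h1 h2 h3 h4.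
  by rewrite ler_norml; apply/andP; split; lra.
apply/eqP; rewrite -subr_eq0 -normr_le0; apply/ler_addgt0Pr => e e0; rewrite add0r.
have := bound (Num.truncn (f 1 / e)).
rewrite mulrC -ler_pdivlMr// => h; apply: le_trans h _.
by rewrite ler_pdivrMr// mulrC -ler_pdivrMr// ltW// truncnS_gt.
Qed.

Section equal_laws.
Context d (T : measurableType d) (R : realType) (P : probability T R).

Lemma eq_law_mean (Y Y' : T -> R) (f : R -> R) :
  measurable_fun [set: T] Y -> measurable_fun [set: T] Y' -> eq_law P Y Y' ->
  measurable_fun [set: R] f -> (forall x, 0 <= f x) ->
  \int[P]_w f (Y w) = \int[P]_w f (Y' w).
Proof.
move=> mY mY' YY' mf f0.
pose V : {mfun T >-> R} := HB.pack Y (isMeasurableFun.Build _ _ _ _ Y mY).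
pose V' : {mfun T >-> R} := HB.pack Y' (isMeasurableFun.Build _ _ _ _ Y' mY').
have mfE : measurable_fun [set: R] (EFin \o f) by apply/measurable_EFinP.
have fE0 y : (0 <= (EFin \o f) y)%E by rewrite lee_fin.
have h1 := @ge0_integral_distribution _ _ _ _ _ P V _ mfE fE0.
have h2 := @ge0_integral_distribution _ _ _ _ _ P V' _ mfE fE0.
rewrite /Rintegral; congr fine.
transitivity (\int[distribution P V]_y (EFin \o f) y)%E; first by rewrite h1.
transitivity (\int[distribution P V']_y (EFin \o f) y)%E; last by rewrite h2.
by apply: eq_measure_integral => A mA _; exact: YY'.
Qed.

End equal_laws.

Section stable_exponent.
Variables (R : realType) (c alpha : R).
Hypothesis c0 : 0 < c.
Hypothesis alpha0 : 0 < alpha.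
Hypothesis alpha1 : alpha < 1.
Notation mu := (@lebesgue_measure R).
Let nu := stable_density c alpha.

Let nu_ge0 h : 0 <= nu h.
Proof. by apply: stable_density_ge0; exact: ltW. Qed.

Let nu_neg h : h <= 0 -> nu h = 0.
Proof. by move=> h0; rewrite /nu /stable_density ltNge h0. Qed.

Let mnu : measurable_fun [set: R] nu.
Proof. exact: measurable_stable_density. Qed.

Let nu_int : mu.-integrable [set: R] (EFin \o (fun h => Num.min 1 `|h| * nu h)).
Proof. exact: stable_density_integrable. Qed.

Let restrict_nu (f : R -> R) :
  \int[mu]_(h in `]0%R, +oo[) (f h * (c / h `^ (1 + alpha))) = \int[mu]_h (f h * nu h).
Proof.
rewrite Rintegral_mkcond; apply: eq_Rintegral => h _; rewrite patchE /nu /stable_density.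
have [h0|h0] := ltP 0 h; first by rewrite mem_set//= in_itv/= h0.
rewrite memNset ?mulr0//= in_itv/= andbT; apply/negP; rewrite -leNgt//.
Qed.

Lemma stable_exponentE u :
  stable_exponent c alpha u = Complex (cos_part nu u) (sin_part nu u).
Proof.
rewrite /stable_exponent /cintegral; congr Complex.
- rewrite /cos_part -restrict_nu; apply: eq_Rintegral => h _ /=.
  by rewrite expR0 mul1r mulr0 subr0.
- rewrite /sin_part -restrict_nu; apply: eq_Rintegral => h _ /=.
  by rewrite expR0 !mul1r mulr0 add0r subr0.
Qed.

Lemma stable_exponent_cis t u :
  cexp (real_complex R t * stable_exponent c alpha u) = cis (t * cos_part nu u) (t * sin_part nu u).
Proof.
by rewrite stable_exponentE /cexp /cis /= !mul0r subr0 addr0.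
Qed.

Let scaling (f : R -> R) (k u : R) : 0 < k -> measurable_fun [set: R] f ->
  mu.-integrable [set: R] (EFin \o (fun h => f (u * h) * nu h)) ->
  \int[mu]_h (f ((k * u) * h) * nu h) = k `^ alpha * \int[mu]_h (f (u * h) * nu h).
Proof.
move=> k0 mf intf.
have mg : measurable_fun [set: R] (fun h => f (u * h) * nu h).
  by apply/measurable_EFinP; exact: measurable_int intf.
have ig : mu.-integrable `]0%R, +oo[ (EFin \o (fun h => f (u * h) * nu h)).
  by apply: integrableS intf.
have onpos (g : R -> R) :
    \int[mu]_h (g h * nu h) = \int[mu]_(h in `]0%R, +oo[) (g h * nu h).
  rewrite [RHS]Rintegral_mkcond; apply: eq_Rintegral => h _; rewrite patchE.
  have [h0|h0] := ltP 0 h; first by rewrite mem_set//= in_itv/= h0.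
  rewrite memNset; first by rewrite nu_neg// mulr0.
  by rewrite /= in_itv/= andbT; apply/negP; rewrite -leNgt.
rewrite [in RHS]onpos -(Rintegral_dilation k0 mg ig) onpos.
have idil : mu.-integrable `]0%R, +oo[ (EFin \o (fun h => f (u * (k * h)) * nu (k * h))).
  apply/integrableP; split.
    apply/measurable_EFinP; apply: measurable_funTS.
    by apply: (measurableT_comp mg); exact: measurable_funM.
  have /integrableP[_] := ig.
  rewrite -(ge0_integral_dilation k0)//.
    set X := (\int[mu]_(x in _) _)%E => kX; change (X < +oo)%E.
    by move: kX; case: X => [x||]; rewrite ?ltry ?ltNyr// gt0_muley ?lte_fin.
  by apply: measurableT_comp => //; exact/measurable_EFinP.
rewrite mulrA -RintegralZl//; apply: eq_Rintegral => h; rewrite inE/= in_itv/= andbT => h0.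
rewrite mulrCA (mulrA u) (mulrC u k); congr (_ * _).
rewrite /nu /stable_density h0 pmulr_rgt0// h0 powRM ?ltW//.
have -> : k `^ (1 + alpha) = k * k `^ alpha.
  rewrite powRD; last by rewrite (gt_eqF k0) implybT.
  by rewrite powRr1 ?(ltW k0).
have q1 : k `^ alpha != 0 by rewrite gt_eqF ?powR_gt0.
have q2 : h `^ (1 + alpha) != 0 by rewrite gt_eqF ?powR_gt0.
by field; rewrite q1 q2 gt_eqF.
Qed.

(** Substitute h / k for h; the density is homogeneous of degree - 1 - alpha. *)
Lemma cos_part_scaling k u : 0 < k ->
  cos_part nu (k * u) = k `^ alpha * cos_part nu u.
Proof.
move=> k0; apply: (@scaling (fun x => cos x - 1)) => //.
- by apply: measurable_funB => //; exact: continuous_measurable_fun (@continuous_cos R).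
- exact: (cos_part_integrable nu_ge0 mnu nu_int u).
Qed.

Lemma sin_part_scaling k u : 0 < k ->
  sin_part nu (k * u) = k `^ alpha * sin_part nu u.
Proof.
move=> k0; apply: (@scaling (@sin R)) => //.
- exact: continuous_measurable_fun (@continuous_sin R).
- exact: (sin_part_integrable nu_ge0 mnu nu_int u).
Qed.

(** Otherwise (1 - cos h) nu h would vanish almost everywhere, but it is positive
    on ]0, 1]. *)
Lemma cos_part_lt0 : cos_part nu 1 < 0.
Proof.
have i1 := cos_part_integrable nu_ge0 mnu nu_int 1.
rewrite ltNge; apply/negP => A0.
pose g h := (1 - cos h) * nu h.
have g0 h : 0 <= g h by rewrite mulr_ge0// subr_ge0 cos_le1.
have ig : mu.-integrable [set: R] (EFin \o g).
  have := integrableN i1; apply: eq_integrable => // h _ /=.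
  by congr EFin; rewrite /g mul1r -mulNr opprB.
have gint : \int[mu]_h g h <= 0.
  rewrite (_ : \int[mu]_h g h = - cos_part nu 1) ?oppr_le0//.
  rewrite -[RHS]mulN1r -(RintegralZl (-1) measurableT i1); apply: eq_Rintegral => h _.
  by rewrite /g mul1r; ring.
have mg : measurable_fun [set: R] (EFin \o g) by exact: measurable_int ig.
have : (\int[mu]_h `|(EFin \o g) h|)%E = 0%E.
  under eq_integral => h _ do rewrite /= ger0_norm//.
  rewrite -[LHS]fineK; last exact: (integrable_fin_num measurableT ig).
  by congr EFin; apply/eqP; rewrite eq_le gint Rintegral_ge0.
move=> /(ae_eq_integral_abs mu measurableT mg)[N [mN N0 NP]].
have : (mu `]0%R, 1%R] <= mu N)%E.
  apply: le_measure; rewrite ?inE//.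
  move=> h; rewrite /= in_itv/= => /andP[h0 h1]; apply: NP => /= /(_ I)[] /eqP.
  rewrite mulf_eq0 /nu /stable_density h0 => /orP[|]; last first.
    by rewrite mulf_eq0 invr_eq0 gt_eqF//= gt_eqF// powR_gt0.
  rewrite subr_eq0 => /eqP cosh1.
  have sh : 0 < sin h.
    apply: sin_gt0_pi; rewrite h0/=; apply: le_lt_trans h1 _.
    by apply: lt_le_trans (pi_ge2 R); rewrite ltr1n.
  have := cos2Dsin2 h; rewrite -cosh1 expr1n => /(congr1 (fun x => x - 1)).
  by rewrite addrAC subrr add0r => /eqP; rewrite expf_eq0/= gt_eqF.
rewrite N0 lebesgue_measure_itv/= lte_fin ltr01 oppr0 adde0.
by rewrite lee_fin ler10.
Qed.

End stable_exponent.

(** * Laplace transform and monotonicity of the stable process *)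

Section stable_process.
Context d (T : measurableType d) (R : realType) (P : probability T R).
Variables (F : R -> set (set T)) (alpha : R) (Z : R -> T -> R).
Hypothesis hF : usual_conditions P F.
Hypothesis alpha0 : 0 < alpha.
Hypothesis alpha1 : alpha < 1.

Lemma adapted_measurable (X : R -> T -> R) t : adapted F X -> 0 <= t ->
  measurable_fun [set: T] (X t).
Proof.
by move=> aX t0 _ B mB; rewrite setTI; apply: (usual_sub hF t0); exact: aX.
Qed.

Hypothesis hZ : one_sided_stable P F alpha Z.

Let lZ : cadlag_levy P F Z := hZ.1.

Let mZ t : 0 <= t -> measurable_fun [set: T] (Z t).
Proof. exact: adapted_measurable (levy_adapted lZ). Qed.

Let stable_char : exists2 c : R, 0 < c & forall u t, 0 <= t ->
  \int[P]_w cos (u * Z t w) =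
    complex.Re (cis (t * cos_part (stable_density c alpha) u) (t * sin_part (stable_density c alpha) u)) /\
  \int[P]_w sin (u * Z t w) =
    complex.Im (cis (t * cos_part (stable_density c alpha) u) (t * sin_part (stable_density c alpha) u)).
Proof.
have [_ [c c0 cP]] := hZ; exists c => // u t t0.
have := cP u t t0; rewrite stable_exponent_cis /char_fun /cintegral => -[h1 h2].
split.
- rewrite /= -h1; apply: eq_Rintegral => w _ /=.
  by rewrite expR0 mul1r.
- rewrite /= -h2; apply: eq_Rintegral => w _ /=.
  by rewrite expR0 mul1r.
Qed.

(** The characteristic function of Z t is one-sided. *)
Lemma stable_ge0 t : 0 <= t -> {ae P, forall w, 0 <= Z t w}.
Proof.
move=> t0; have [c c0 cP] := stable_char.
apply: (one_sided_ge0 (mZ t0) (fun u => (cP u t t0).1) (fun u => (cP u t t0).2)).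
apply: one_sided_levy => //.
- by move=> h; apply: stable_density_ge0; exact: ltW.
- by move=> h h0; rewrite /stable_density ltNge h0.
- exact: measurable_stable_density.
- exact: stable_density_integrable.
Qed.

Let ell t := \int[P]_w expR (- 1 * `|Z t w|).

Let mexp (lam : R) : measurable_fun [set: R] (fun x : R => expR (- lam * `|x|)).
Proof.
apply: measurableT_comp => //; apply: measurable_funM => //.
Qed.

Let brv_exp (Y : T -> R) (lam : R) : 0 <= lam -> measurable_fun [set: T] Y ->
  bounded_rv (fun w => expR (- lam * `|Y w|)).
Proof.
move=> l0 mY; split; first exact: measurableT_comp (mexp lam) mY.
exists 1 => w; rewrite ger0_norm ?expR_ge0// -expR0 ler_expR mulNr oppr_le0.
by rewrite mulr_ge0.
Qed.

(** lam Z_t and Z_(t lam^alpha) have the same characteristic function. *)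
Let laplace_scaling t lam : 0 <= t -> 0 < lam ->
  \int[P]_w expR (- lam * `|Z t w|) = ell (t * lam `^ alpha).
Proof.
move=> t0 l0; have [c c0 cP] := stable_char.
have tl0 : 0 <= t * lam `^ alpha by rewrite mulr_ge0 ?powR_ge0.
transitivity (\int[P]_w expR (- 1 * `|lam * Z t w|)).
  by apply: eq_Rintegral => w _; rewrite normrM (ger0_norm (ltW l0)) !mulNr mul1r.
apply: cos_mean_laplace => //.
- by apply: measurable_funM => //; exact: mZ.
- exact: mZ.
move=> u; rewrite (cP u _ tl0).1.
under eq_Rintegral do rewrite mulrA (mulrC u).
rewrite (cP _ _ t0).1 cos_part_scaling// sin_part_scaling//.
by rewrite !mulrA.
Qed.

Let ell0 : ell 0 = 1.
Proof.
rewrite -[RHS](mean_cst P 1); apply: mean_eq_ae.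
- exact: brv_exp (mZ _).
- exact: bounded_rv_cst.
- by apply: filterS (levy_start lZ) => w ->; rewrite normr0 mulr0 expR0.
Qed.

Let ellD s t : 0 <= s -> 0 <= t -> ell (s + t) = ell s * ell t.
Proof.
rewrite le_eqVlt => /predU1P[<-|s0]; first by rewrite add0r ell0 mul1r.
rewrite le_eqVlt => /predU1P[<-|t0]; first by rewrite addr0 ell0 mulr1.
have st0 : 0 <= s + t by rewrite addr_ge0 ?ltW.
have sst : s < s + t by rewrite ltrDl.
pose Y w := Z (s + t) w - Z s w.
have mY : measurable_fun [set: T] Y by apply: measurable_funB; apply: mZ => //; exact: ltW.
have laws : eq_law P Y (Z t).
  by have := levy_stationary lZ (ltW s0) sst; rewrite addrAC subrr add0r.
have Y0 : {ae P, forall w, 0 <= Y w}.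
  have [N [mN N0 NP]] := stable_ge0 (ltW t0).
  have mB : measurable (`]-oo, 0[%classic : set R) by exact: measurable_itv.
  have := laws _ mB; set A := (Z t @^-1` _) => PA.
  exists (Y @^-1` `]-oo, 0[%classic); split.
  - by rewrite -[X in measurable X]setTI; exact: mY.
  - rewrite PA; apply/eqP; rewrite eq_le measure_ge0 andbT -N0; apply: le_measure; rewrite ?inE//.
      by rewrite /A -[X in measurable X]setTI; exact: (mZ (ltW t0)).
    move=> w; rewrite /A/= in_itv/= => Zw; apply: NP => /=.
    by apply/negP; rewrite -ltNge.
  - by move=> w /= Yw; rewrite in_itv/=; rewrite ltNge; apply/negP.
pose f (z : R * R) := expR (- 1 * `|z.1|) * expR (- 1 * `|z.2|).
have f01 z : 0 <= f z <= 1.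
  rewrite /f -expRD expR_ge0/= -[leRHS]expR0 ler_expR !mulN1r -opprD oppr_le0.
  by rewrite addr_ge0.
have mf : measurable_fun [set: R * R] f.
  by apply: measurable_funM; apply: (measurableT_comp (mexp 1)).
have ind := independent_pair_mean (mZ (ltW s0)) mY
  (levy_adapted lZ (ltW s0)) (levy_indep lZ (ltW s0) sst) mf f01.
transitivity (\int[P]_w f (Z s w, Y w)).
  apply: mean_eq_ae.
  - exact: brv_exp (mZ _).
  - apply: bounded_rvM; apply: brv_exp => //; exact: mZ (ltW _).
  - apply: filterS2 (stable_ge0 (ltW s0)) Y0 => w Zs Yw; rewrite /f/=.
    rewrite !ger0_norm//; first by rewrite -expRD -mulrDr /Y [X in _ = expR (_ * X)]addrC subrK.
    by rewrite -(subrK (Z s w) (Z (s + t) w)) addr_ge0.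
have bs : bounded_rv (fun w => expR (- 1 * `|Z s w|)) by exact: brv_exp (mZ (ltW s0)).
have bY : bounded_rv (fun w => expR (- 1 * `|Y w|)) by exact: brv_exp mY.
rewrite ind /f /=; under eq_Rintegral => w _ do rewrite meanZ//.
rewrite (@eq_law_mean _ _ _ P Y (Z t) (fun x => expR (- 1 * `|x|)))//.
- by under eq_Rintegral do rewrite mulrC; rewrite meanZ// mulrC.
- exact: mZ (ltW t0).
Qed.

Let ell_gt0 t : 0 <= t -> 0 < ell t.
Proof.
move=> t0; rewrite lt0r; apply/andP; split; last first.
  by apply: Rintegral_ge0 => w _; exact: expR_ge0.
apply/eqP => e0.
have h : {ae P, forall w, expR (- 1 * `|Z t w|) = 0}.
  apply: mean_ge0_eq0; first exact: brv_exp (mZ t0).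
    by move=> w; exact: expR_ge0.
  by rewrite -/(ell t) e0.
have : {ae P, forall w : T, False}.
  by apply: filterS h => w /eqP; rewrite gt_eqF// expR_gt0.
move=> [N [mN N0 NP]].
have NT : N = setT by apply/seteqP; split => // w _; apply: NP.
by have := probability_setT P; rewrite -NT N0 => /eqP; rewrite eqe eq_sym oner_eq0.
Qed.

(** By laplace_scaling the transform at (t, lam) is ell (t lam^alpha), and ell is
    multiplicative by independence of increments, so ell t = e^{- kappa t}. If
    kappa were 0, Z 1 would vanish almost surely, against cos_part_lt0. The
    absolute value makes the variable bounded on the whole space. *)
Lemma stable_laplace : exists2 kappa : R, 0 < kappa &
  forall t lam, 0 <= t -> 0 < lam ->
    \int[P]_w expR (- lam * `|Z t w|) = expR (- (t * (kappa * lam `^ alpha))).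
Proof.
have ell_le1 t : 0 <= t -> ell t <= 1.
  move=> t0; rewrite -[leRHS](mean_cst P 1); apply: mean_le.
  - exact: brv_exp (mZ t0).
  - exact: bounded_rv_cst.
  - by apply: aeW => w; rewrite -[leRHS]expR0 ler_expR mulN1r oppr_le0.
pose eta t := - ln (ell t).
have etaD s t : 0 <= s -> 0 <= t -> eta (s + t) = eta s + eta t.
  move=> s0 t0; rewrite /eta ellD// lnM ?posrE ?ell_gt0//; ring.
have eta0 t : 0 <= t -> 0 <= eta t.
  by move=> t0; rewrite /eta oppr_ge0 ln_le0// ell_le1.
have etaE := additive_nonneg_linear etaD eta0.
have ellE t : 0 <= t -> ell t = expR (- (t * eta 1)).
  by move=> t0; rewrite -etaE// /eta opprK lnK// posrE ell_gt0.
exists (eta 1); last first.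
  move=> t lam t0 l0; rewrite laplace_scaling// ellE ?mulr_ge0 ?powR_ge0//.
  by congr (expR (- _)); ring.
rewrite lt0r eta0// andbT; apply/eqP => eta1.
have ell1 : ell 1 = 1 by rewrite ellE// eta1 mulr0 oppr0 expR0.
have Z10 : {ae P, forall w, 1 - expR (- 1 * `|Z 1 w|) = 0}.
  have bZ : bounded_rv (fun w => expR (- 1 * `|Z 1 w|)) by exact: brv_exp (mZ _).
  have b1 : bounded_rv (fun _ : T => 1 : R) by exact: bounded_rv_cst.
  apply: mean_ge0_eq0; first exact: bounded_rvB.
    by move=> w; rewrite subr_ge0 -[leRHS]expR0 ler_expR mulN1r oppr_le0.
  by rewrite meanB// mean_cst -/(ell 1) ell1 subrr.
have [c c0 cP] := stable_char.
have := (cP 1 1 ler01).1; rewrite !mul1r /=.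
have -> : \int[P]_w cos (1 * Z 1 w) = 1.
  rewrite -[RHS](mean_cst P 1); apply: mean_eq_ae.
  - split; last by exists 1 => w; exact: cos_max.
    apply: measurableT_comp; first exact: continuous_measurable_fun (@continuous_cos R).
    by apply: measurable_funM => //; exact: mZ.
  - exact: bounded_rv_cst.
  - apply: filterS Z10 => w /eqP; rewrite subr_eq0 -[X in X == _]expR0 eq_sym => /eqP/expR_inj/eqP.
    by rewrite mulN1r oppr_eq0 normr_eq0 => /eqP ->; rewrite mulr0 cos0.
apply/eqP; rewrite eq_sym lt_eqF//.
have A0 := cos_part_lt0 c0 alpha0 alpha1.
set A := cos_part _ _ in A0 *; set B := sin_part _ _.
apply: (@le_lt_trans _ _ (expR A)).
  by rewrite -[leRHS]mulr1 ler_wpM2l ?expR_ge0// cos_le1.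
by rewrite -[ltRHS]expR0 ltr_expR.
Qed.

Lemma stable_increment_ge0 s t : 0 <= s -> s <= t -> {ae P, forall w, Z s w <= Z t w}.
Proof.
move=> s0; rewrite le_eqVlt => /predU1P[<-|st]; first by apply: aeW.
have t0 : 0 <= t by rewrite (le_trans s0)// ltW.
have ts0 : 0 <= t - s by rewrite subr_ge0 ltW.
have [N [mN N0 NP]] := stable_ge0 ts0.
have mB : measurable (`]-oo, 0[%classic : set R) by exact: measurable_itv.
have := levy_stationary lZ s0 st mB => PA.
have mY : measurable_fun [set: T] (fun w => Z t w - Z s w).
  by apply: measurable_funB; exact: mZ.
exists ((fun w => Z t w - Z s w) @^-1` `]-oo, 0[%classic); split.
- by rewrite -[X in measurable X]setTI; exact: mY.
- rewrite PA; apply/eqP; rewrite eq_le measure_ge0 andbT -N0; apply: le_measure; rewrite ?inE//.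
    by rewrite -[X in measurable X]setTI; exact: (mZ ts0).
  move=> w; rewrite /= in_itv/= => Zw; apply: NP => /=.
  by apply/negP; rewrite -ltNge.
- by move=> w /= Yw; rewrite in_itv/= subr_lt0 ltNge; apply/negP.
Qed.

Let right_grid (n : nat) (s : R) : R := (Num.truncn (s * n.+1%:R)).+1%:R / n.+1%:R.

Let right_grid_cvg (z : R -> R) s : cadlag z -> 0 <= s ->
  z (right_grid n s) @[n --> \oo] --> z s.
Proof.
move=> [cz _] s0 A /(cz s s0)[e /= e0 eA].
suff : \forall n \near \oo, A (z (right_grid n s)) by [].
near=> n.
have n0 : (0 : R) < n.+1%:R by [].
have /andP[h1 h2] : (Num.truncn (s * n.+1%:R))%:R <= s * n.+1%:R <
    (Num.truncn (s * n.+1%:R)).+1%:R by rewrite truncn_itv// mulr_ge0.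
have g1 : s < right_grid n s by rewrite /right_grid ltr_pdivlMr.
apply: eA => //; rewrite /ball_/= distrC ger0_norm ?subr_ge0 ?ltW//.
apply: (@le_lt_trans _ _ (n.+1%:R^-1)); last first.
  by near: n; exact: (near_infty_natSinv_lt (PosNum e0)).
rewrite lerBlDr /right_grid -natr1 mulrDl mul1r addrC lerD2l.
by rewrite ler_pdivrMr.
Unshelve. all: by end_near. Qed.

(** Almost surely monotone on the countable set of rationals, hence everywhere by
    right continuity. *)
Lemma stable_monotone : {ae P, forall w, monotone_path (Z ^~ w)}.
Proof.
have h : {ae P, forall w, forall n i j : nat, (i <= j)%N ->
    Z (i%:R / n.+1%:R) w <= Z (j%:R / n.+1%:R) w}.
  apply: ae_foralln => n; apply: ae_foralln => i; apply: ae_foralln => j.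
  have [ij|ij] := leqP i j; last by apply: aeW.
  have : {ae P, forall w, Z (i%:R / n.+1%:R) w <= Z (j%:R / n.+1%:R) w}.
    apply: stable_increment_ge0; first by rewrite divr_ge0.
    by rewrite ler_wpM2r ?invr_ge0// ler_nat.
  by apply: filterS => w hw _.
apply: filterS h => w hw s t s0 st.
have cz := levy_cadlag lZ w.
have t0 := le_trans s0 st.
apply: ler_cvg_to (right_grid_cvg cz s0) (right_grid_cvg cz t0) _.
apply: nearW => n; apply: hw; rewrite ltnS; apply: le_truncn.
by rewrite ler_wpM2r.
Qed.

End stable_process.

(** * The stable process is a pure jump process *)

Section exponential_inequalities.
Variable R : realType.
Implicit Types x : R.

Lemma onem_expRN_ge x : 0 <= x -> x / (1 + x) <= 1 - expR (- x).
Proof.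
move=> x0; have x1 : 0 < 1 + x by rewrite ltr_wpDr.
rewrite lerBrDr -lerBrDl (_ : 1 - x / (1 + x) = (1 + x)^-1); last first.
  by field; rewrite gt_eqF.
by rewrite expRN lef_pV2 ?posrE ?expR_gt0// expR_ge1Dx.
Qed.

Lemma onem_expRN_le x : 1 - expR (- x) <= x.
Proof. by rewrite lerBlDr -lerBlDl; have := expR_ge1Dx (- x). Qed.

Lemma onem_expRN_ge0 x : 0 <= x -> 0 <= 1 - expR (- x).
Proof. by move=> x0; rewrite subr_ge0 -[leRHS]expR0 ler_expR oppr_le0. Qed.

(** Bounds means of truncated variables by Laplace transforms. *)
Lemma min1_le_onem_expRN x : 0 <= x -> Num.min x 1 <= 2 * (1 - expR (- x)).
Proof.
move=> x0; have x1 : 0 < 1 + x by rewrite ltr_wpDr.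
apply: (@le_trans _ _ (2 * (x / (1 + x)))); last by rewrite ler_wpM2l// onem_expRN_ge.
rewrite mulrA ler_pdivlMr//.
by have [h|h] := leP x 1; nra.
Qed.

End exponential_inequalities.

Section fatou.
Context d (T : measurableType d) (R : realType) (P : probability T R).

(** Fatou: the lower limit in n of S m n has mean at most c / (m + 1), so the
    infimum over m of these lower limits is 0 almost surely, and it bounds C from
    above. *)
Lemma small_mean_near_le0 (S : nat -> nat -> T -> R) (c : R) :
  (forall m n, bounded_rv (S m n)) -> (forall m n w, 0 <= S m n w) ->
  (forall m n, \int[P]_w S m n w <= c * m.+1%:R^-1) ->
  {ae P, forall w (C : R), (forall m, \forall n \near \oo, C <= S m n w) -> C <= 0}.
Proof.
move=> bS S0 ES.
pose s m n w := (S m n w)%:E.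
have s0 m n w : (0 <= s m n w)%E by rewrite lee_fin.
have ms m n : measurable_fun [set: T] (s m n).
  by apply/measurable_EFinP; case: (bS m n).
have Es m n : (\int[P]_w s m n w <= (c * m.+1%:R^-1)%:E)%E.
  rewrite -[leLHS]fineK; last exact: integrable_fin_num (bounded_rv_integrable P (bS m n)).
  by rewrite lee_fin; exact: ES.
pose W m w := limn_einf (fun n => s m n w).
have mW m : measurable_fun [set: T] (W m).
  rewrite /W /limn_einf; apply: measurableT_comp => //.
  by apply: measurable_fun_limn_esup => n; apply: measurableT_comp.
have einfs_le (u : (\bar R)^nat) n : (einfs u n <= u n)%E.
  by apply: ereal_inf_lbound; exists n => /=.
have W0 m w : (0 <= W m w)%E.
  rewrite /W limn_einf_lim; apply: lime_ge; first exact: is_cvg_einfs.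
  by apply: nearW => n; apply: le_ereal_inf_tmp => _ [k _ <-].
have EW m : (\int[P]_w W m w <= (c * m.+1%:R^-1)%:E)%E.
  apply: le_trans (fatou P measurableT (ms m) (fun n w _ => s0 m n w)) _.
  rewrite limn_einf_lim; apply: lime_le; first exact: is_cvg_einfs.
  by apply: nearW => n; apply: le_trans (einfs_le _ _) (Es m n).
pose G w := einfs (W ^~ w) 0%N.
have mG : measurable_fun [set: T] G by apply: measurable_fun_einfs.
have G0 w : (0 <= G w)%E by apply: le_ereal_inf_tmp => _ [k _ <-].
have GW m w : (G w <= W m w)%E by apply: ereal_inf_lbound; exists m => /=.
have EG : (\int[P]_w `|G w| = 0)%E.
  under eq_integral do rewrite gee0_abs//.
  apply/eqP; rewrite eq_le integral_ge0 ?andbT//.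
  have h m : (\int[P]_w G w <= (c * m.+1%:R^-1)%:E)%E.
    by apply: le_trans (EW m); apply: ge0_le_integral.
  have cv : (c * m.+1%:R^-1)%:E @[m --> \oo] --> (0%:E : \bar R).
    apply: cvg_EFin; first exact: nearW.
    rewrite -[X in _ --> X](mulr0 c); apply: cvgM; first exact: cvg_cst.
    exact: cvg_harmonic.
  rewrite -[leRHS](cvg_lim _ cv)//; apply: lime_ge; first by apply/cvg_ex; exists 0%:E.
  exact: nearW.
move: EG => /(ae_eq_integral_abs P measurableT mG); apply: filterS => w /(_ I) Gw C hC.
rewrite -lee_fin; have -> : (0%:E = G w)%E by rewrite Gw. 
apply: le_ereal_inf_tmp => _ [m _ <-].
rewrite /W limn_einf_lim; apply: lime_ge; first exact: is_cvg_einfs.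
have [N _ hN] := hC m.
exists N => // n /= Nn; apply: le_ereal_inf_tmp => _ [k /= nk <-].
by rewrite lee_fin; apply: hN => /=; exact: leq_trans nk.
Qed.

End fatou.

Section stable_pure_jump.
Context d (T : measurableType d) (R : realType) (P : probability T R).
Variables (F : R -> set (set T)) (alpha : R) (Z : R -> T -> R).
Hypothesis hF : usual_conditions P F.
Hypothesis alpha0 : 0 < alpha.
Hypothesis alpha1 : alpha < 1.
Hypothesis hZ : one_sided_stable P F alpha Z.

Let lZ : cadlag_levy P F Z := hZ.1.

Let mZ t : 0 <= t -> measurable_fun [set: T] (Z t).
Proof. by apply: (adapted_measurable hF); exact: levy_adapted lZ. Qed.

Let brv_min (Y : T -> R) (eta : R) : 0 < eta -> measurable_fun [set: T] Y ->
  bounded_rv (fun w => Num.min `|Y w| eta).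
Proof.
move=> e0 mY; split.
  by apply: measurable_minr => //; exact: measurableT_comp.
exists eta => w; rewrite ger0_norm ?ge_min ?lexx ?orbT//.
by rewrite le_min normr_ge0 ltW.
Qed.

Let small_sum (t eta : R) n w :=
  \sum_(k < n.+1) Num.min `|Z (grid 0 t n.+1 k.+1) w - Z (grid 0 t n.+1 k) w| eta.

(** Each of the n + 1 increments has the law of Z at time t / (n + 1), and
    min (x, eta) <= 2 eta (1 - e^{- x / eta}) has mean of order eta^{1 - alpha} / n. *)
Let small_sum_mean (kappa t eta : R) n : 0 < kappa -> 0 < t -> 0 < eta ->
  (forall s lam, 0 <= s -> 0 < lam ->
    \int[P]_w expR (- lam * `|Z s w|) = expR (- (s * (kappa * lam `^ alpha)))) ->
  \int[P]_w small_sum t eta n w <= 2 * t * kappa * (eta * eta^-1 `^ alpha).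
Proof.
move=> k0 t0 e0 lap.
have g0 k : 0 <= grid 0 t n.+1 k by apply: grid_ge; exact: ltW.
have mD k : measurable_fun [set: T] (fun w => Z (grid 0 t n.+1 k.+1) w - Z (grid 0 t n.+1 k) w).
  by apply: measurable_funB; exact: mZ.
pose del := t / n.+1%:R.
have del0 : 0 < del by rewrite divr_gt0.
have term k : \int[P]_w Num.min `|Z (grid 0 t n.+1 k.+1) w - Z (grid 0 t n.+1 k) w| eta <=
    2 * eta * (del * (kappa * eta^-1 `^ alpha)).
  have gk : grid 0 t n.+1 k < grid 0 t n.+1 k.+1.
    by rewrite -subr_gt0 gridS subr0.
  have laws := levy_stationary lZ (g0 k) gk.
  rewrite gridS subr0 -/del in laws.
  rewrite (@eq_law_mean _ _ _ P _ (Z del) (fun x => Num.min `|x| eta) (mD k) (mZ (ltW del0)) laws); last 2 first.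
  - by apply: measurable_minr => //; exact: measurable_normr.
  - by move=> x; rewrite le_min normr_ge0 ltW.
  have be : bounded_rv (fun w => expR (- eta^-1 * `|Z del w|)).
    split.
      apply: measurableT_comp => //; apply: measurable_funM => //.
      by apply: measurableT_comp => //; exact: mZ (ltW del0).
    exists 1 => w; rewrite ger0_norm ?expR_ge0// -[leRHS]expR0 ler_expR mulNr oppr_le0.
    by rewrite mulr_ge0 ?invr_ge0 ?(ltW e0).
  have b1 : bounded_rv (fun w => 1 - expR (- eta^-1 * `|Z del w|)).
    by apply: bounded_rvB => //; exact: bounded_rv_cst.
  apply: (@le_trans _ _ (\int[P]_w (2 * eta * (1 - expR (- eta^-1 * `|Z del w|))))).
    apply: mean_le.
    - exact: brv_min (mZ (ltW del0)).
    - by apply: bounded_rvM => //; exact: bounded_rv_cst.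
    - apply: aeW => w.
      have x0 : 0 <= eta^-1 * `|Z del w| by rewrite mulr_ge0 ?invr_ge0 ?(ltW e0).
      have := min1_le_onem_expRN x0; rewrite mulNr -(ler_pM2l e0) => h.
      rewrite [leRHS](_ : _ = eta * (2 * (1 - expR (- (eta^-1 * `|Z del w|))))); last by ring.
      apply: le_trans h; rewrite minr_pMr ?(ltW e0)// mulr1 mulrA divff ?gt_eqF// mul1r.
      exact: lexx.
  rewrite meanZ// meanB//; last exact: bounded_rv_cst.
  rewrite mean_cst lap ?invr_gt0 ?(ltW del0)//.
  rewrite ler_wpM2l ?mulr_ge0 ?(ltW e0)//.
  exact: onem_expRN_le.
rewrite /small_sum (@mean_sum _ _ _ P n.+1 (fun k w => Num.min
  `|Z (grid 0 t n.+1 k.+1) w - Z (grid 0 t n.+1 k) w| eta)); last first.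
  by move=> k; exact: brv_min (mD k).
apply: (@le_trans _ _ (\sum_(k < n.+1) 2 * eta * (del * (kappa * eta^-1 `^ alpha)))).
  by apply: ler_sum => k _; exact: term.
rewrite sumr_const card_ord -[_ *+ n.+1]mulr_natl /del.
have N0 : (n.+1%:R : R) != 0 by rewrite pnatr_eq0.
move: N0 (eta^-1 `^ alpha); move: (n.+1%:R : R) => N N0 y.
rewrite le_eqVlt; apply/orP; left; apply/eqP.
by field.
Qed.

(** A continuous part of Z would be bounded by sums of increments truncated at
    eta, whose means tend to 0 with eta as alpha < 1. *)
Lemma stable_pure_jump : {ae P, forall w, forall s t, 0 <= s -> s <= t ->
  ((Z t w - Z s w)%:E <= \esum_(r in `]s, t]) (jump (Z ^~ w) r)%:E)%E}.
Proof.
have [kappa k0 lap] := stable_laplace hF alpha0 alpha1 hZ.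
have key (N : nat) : {ae P, forall w, monotone_path (Z ^~ w) ->
    Z N%:R w - Z 0 w - jump_part (Z ^~ w) N%:R <= 0}.
  have [->|N0] := posnP N.
    apply: aeW => w _; rewrite subrr sub0r oppr_le0.
    by rewrite /jump_part set_itvoc0 esum_set0.
  have t0 : 0 < N%:R :> R by rewrite ltr0n.
  have a10 : 0 < 1 - alpha by rewrite subr_gt0.
  pose eta (m : nat) : R := m.+1%:R^-1 `^ (1 - alpha)^-1.
  have eta0 m : 0 < eta m by rewrite powR_gt0 ?invr_gt0.
  have etaE m : eta m * (eta m)^-1 `^ alpha = m.+1%:R^-1.
    rewrite -powR_inv1 ?(ltW (eta0 m))// -powRrM mulN1r.
    rewrite -{1}(powRr1 (ltW (eta0 m))) -powRD; last by rewrite (gt_eqF (eta0 m)) implybT.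
    by rewrite /eta -powRrM mulVf ?gt_eqF// powRr1// invr_ge0.
  have bS m n : bounded_rv (small_sum N%:R (eta m) n).
    apply: (@bounded_rv_sum _ _ _ n.+1 (fun k w => Num.min
      `|Z (grid 0 N%:R n.+1 k.+1) w - Z (grid 0 N%:R n.+1 k) w| (eta m))) => k.
    by apply: brv_min => //; apply: measurable_funB; apply: mZ; exact: grid_ge (ltW t0).
  have S0 m n w : 0 <= small_sum N%:R (eta m) n w.
    by apply: sumr_ge0 => k _; rewrite le_min normr_ge0 ltW.
  have ES m n : \int[P]_w small_sum N%:R (eta m) n w <= 2 * N%:R * kappa * m.+1%:R^-1.
    by rewrite -etaE; apply: small_sum_mean.
  apply: filterS (small_mean_near_le0 bS S0 ES) => w hw mono; apply: hw => m.
  apply: filterS (cont_part_le (levy_cadlag lZ w) mono (ltW t0) (eta0 m)) => n.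
  move=> /le_trans; apply; apply: ler_sum => k _.
  rewrite ger0_norm// subr_ge0 mono//; first exact: grid_ge (ltW t0).
  by apply: le_grid => //; exact: ltW.
have {}key : {ae P, forall w, forall N : nat, monotone_path (Z ^~ w) ->
    Z N%:R w - Z 0 w - jump_part (Z ^~ w) N%:R <= 0} by exact: ae_foralln.
apply: filterS2 key (stable_monotone hF alpha0 alpha1 hZ) => w hw mono.
by apply: pure_jump => //; [exact: levy_cadlag lZ w|move=> N; exact: hw].
Qed.


End stable_pure_jump.

(** * Exponential cells *)

Section exponential_cells.
Variable R : realType.

Lemma onem_expRN_natM (j : nat) (a : R) : 0 <= a ->
  1 - expR (- (j%:R * a)) <= j%:R * (1 - expR (- a)).
Proof.
move=> a0; elim: j => [|j IH]; first by rewrite !mul0r oppr0 expR0 subrr.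
rewrite -natr1 !mulrDl !mul1r opprD expRD.
have e1 : 0 <= 1 - expR (- (j%:R * a)) by rewrite onem_expRN_ge0// mulr_ge0.
have e2 := onem_expRN_ge0 a0.
have := mulr_ge0 e1 e2; lra.
Qed.

Lemma onem_expRN_ge_quad (x : R) : 0 <= x -> x - x ^+ 2 <= 1 - expR (- x).
Proof.
move=> x0; apply: le_trans (onem_expRN_ge x0).
have x1 : 0 < 1 + x by rewrite ltr_wpDr.
by rewrite ler_pdivlMr//; have := exprn_ge0 3 x0; rewrite !exprS expr0; lra.
Qed.

(** Both terms lie between 0 and the right-hand side. *)
Lemma onem_expRN_scaling (j : nat) (L a : R) : 1 <= L -> L <= j%:R -> 0 <= a ->
  `|L * (1 - expR (- a)) - (1 - expR (- (L * a)))| <= j%:R * (1 - expR (- a)).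
Proof.
move=> L1 Lj a0; have L0 : 0 <= L by lra.
have h := onem_expRN_ge0 a0.
have h2 : 0 <= 1 - expR (- (L * a)) by rewrite onem_expRN_ge0// mulr_ge0.
have h3 : 1 - expR (- (L * a)) <= j%:R * (1 - expR (- a)).
  apply: le_trans (onem_expRN_natM j a0).
  by rewrite lerD2l lerN2 ler_expR lerN2 ler_wpM2r.
have h4 : L * (1 - expR (- a)) <= j%:R * (1 - expR (- a)) by rewrite ler_wpM2r.
have h5 : 0 <= L * (1 - expR (- a)) by rewrite mulr_ge0.
by rewrite ler_norml; apply/andP; split; lra.
Qed.

(** Both terms are L a up to L^2 a^2. *)
Lemma onem_expRN_scaling_small (L a : R) : 1 <= L -> 0 <= a -> a <= 1 ->
  `|L * (1 - expR (- a)) - (1 - expR (- (L * a)))| <= 2 * L ^+ 2 * a * (1 - expR (- a)).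
Proof.
move=> L1 a0 a1; have L0 : 0 <= L by lra.
have La0 : 0 <= L * a by rewrite mulr_ge0.
have h1 := onem_expRN_le a; have h2 := onem_expRN_ge_quad a0.
have h3 := onem_expRN_le (L * a); have h4 := onem_expRN_ge_quad La0.
have h5 : a <= 2 * (1 - expR (- a)).
  by have := min1_le_onem_expRN a0; rewrite (min_idPl a1).
apply: (@le_trans _ _ (L ^+ 2 * a ^+ 2)); last first.
  rewrite [leRHS](_ : _ = L ^+ 2 * a * (2 * (1 - expR (- a)))); last by ring.
  by rewrite expr2 (expr2 a) [leLHS]mulrA ler_wpM2l// !mulr_ge0.
have h6 := ler_wpM2l L0 h1; have h7 := ler_wpM2l L0 h2.
have h8 : L * a ^+ 2 <= L ^+ 2 * a ^+ 2.
  by rewrite ler_wpM2r ?sqr_ge0// expr2 ler_peMr.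
rewrite exprMn in h4.
rewrite mulrBr in h7.
by rewrite ler_norml; apply/andP; split; lra.
Qed.

Variables (b : R -> R) (x0 : R).
Hypothesis b0 : forall v, 0 < b v.
Hypothesis mb : forall u v, u <= v -> b u <= b v.
Hypothesis cb : continuous b.

(** With b the jump intensity, delta the mesh and L = lam^alpha, the conditional mean of a
    term of exp_sum given the value v at the left end of the grid cell. *)
Definition cell (lam L delta v : R) :=
  expR (- lam * v) * (1 - expR (- (delta * (L * b v)))).

Lemma cell_ge0 lam L delta v : 0 <= L -> 0 <= delta -> 0 <= cell lam L delta v.
Proof.
move=> L0 d0; rewrite mulr_ge0 ?expR_ge0// onem_expRN_ge0//.
by rewrite !mulr_ge0// ltW.
Qed.

Lemma cell_le lam L delta v : cell lam L delta v <= expR (- lam * v).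
Proof. by rewrite ler_piMr ?expR_ge0// gerBl expR_ge0. Qed.

(** At small intensity the two scaled cells are delta L b e^{- j v} up to a factor 1 + O(delta).
    b may be unbounded, so large v are treated apart: there the factor
    e^{- (j - 1) v}, j >= 2, is small. *)
Lemma cell_scaling (j : nat) (L eps : R) : (2 <= j)%N -> 1 <= L -> L <= j%:R -> 0 < eps ->
  \forall n \near \oo, forall v, x0 <= v ->
    `|L * cell j%:R 1 n.+1%:R^-1 v - cell j%:R L n.+1%:R^-1 v| <=
    eps * cell 1 1 n.+1%:R^-1 v.
Proof.
move=> j2 L1 Lj e0.
have j0 : (0 : R) < j%:R by rewrite ltr0n (leq_trans _ j2).
have j1 : (1 : R) <= j%:R - 1.
  have h : (2 : R) <= j%:R by rewrite ler_nat.
  by lra.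
pose C := expR (- (j%:R - 1) * x0).
pose V := Num.max 0 (- ln (eps / j%:R)).
have VP v : V <= v -> expR (- (j%:R - 1) * v) * j%:R <= eps.
  rewrite ge_max => /andP[v0 Vv]; rewrite -ler_pdivlMr//.
  rewrite -[leRHS]lnK ?posrE ?divr_gt0// ler_expR mulNr lerNl.
  by apply: le_trans Vv _; rewrite ler_peMl.
pose K := b V + 2 * L ^+ 2 * b V * C / eps + 1.
have K0 : 0 < K.
  rewrite ltr_wpDl// addr_ge0 ?(ltW (b0 _))// divr_ge0 ?(ltW e0)// mulr_ge0 ?expR_ge0//.
  by rewrite mulr_ge0 ?(ltW (b0 _))// mulr_ge0 ?sqr_ge0.
near=> n => v xv.
have nK : K * n.+1%:R^-1 <= 1.
  rewrite -ler_pdivlMl// mulr1; apply: ltW; near: n.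
  have Ki : 0 < K^-1 by rewrite invr_gt0.
  exact: (near_infty_natSinv_lt (PosNum Ki)).
have : 0 < (n.+1%:R^-1 : R) by rewrite invr_gt0.
move: nK; move: (n.+1%:R^-1 : R) => del nK del0.
have a0 : 0 <= del * b v by rewrite mulr_ge0 ?ltW.
have e10 := onem_expRN_ge0 a0.
rewrite /cell !mul1r (_ : del * (L * b v) = L * (del * b v)); last by ring.
rewrite mulrCA -mulrBr normrM (ger0_norm (expR_ge0 _)).
rewrite (_ : - j%:R * v = - (j%:R - 1) * v + - 1 * v); last by ring.
rewrite expRD -mulrA mulrCA [leRHS]mulrCA ler_wpM2l ?expR_ge0//.
have [vV|/ltW Vv] := leP v V; last first.
  apply: (@le_trans _ _ (expR (- (j%:R - 1) * v) * j%:R * (1 - expR (- (del * b v))))).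
    rewrite -mulrA ler_wpM2l ?expR_ge0//.
    exact: onem_expRN_scaling.
  by rewrite ler_wpM2r// VP.
have bV := mb vV.
have aV : del * b v <= del * b V by rewrite ler_wpM2l// ltW.
have C0 : 0 < C by exact: expR_gt0.
have Q0 : 0 <= 2 * L ^+ 2 * b V * C / eps.
  by rewrite divr_ge0 ?(ltW e0)// mulr_ge0 ?(ltW C0)// mulr_ge0 ?(ltW (b0 _))// mulr_ge0 ?sqr_ge0.
have a1 : del * b v <= 1.
  apply: le_trans aV _; apply: le_trans nK; rewrite mulrC ler_wpM2r ?(ltW del0)//.
  by rewrite /K -addrA lerDl; lra.
apply: (@le_trans _ _ (C * (2 * L ^+ 2 * (del * b v) * (1 - expR (- (del * b v)))))).
  apply: ler_pM; rewrite ?expR_ge0 ?normr_ge0//.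
    by rewrite ler_expR ler_wnM2l// oppr_le0; lra.
  exact: onem_expRN_scaling_small.
rewrite mulrA ler_wpM2r//.
apply: (@le_trans _ _ (C * (2 * L ^+ 2 * (del * b V)))).
  have L20 : 0 <= 2 * L ^+ 2 by rewrite mulr_ge0 ?sqr_ge0.
  by apply: (ler_wpM2l (ltW C0)); exact: (ler_wpM2l L20 aV).
have -> : C * (2 * L ^+ 2 * (del * b V)) = eps * (2 * L ^+ 2 * b V * C / eps * del).
  by field; rewrite gt_eqF.
rewrite -[leRHS]mulr1 (ler_wpM2l (ltW e0))//.
apply: le_trans nK; rewrite ler_wpM2r ?(ltW del0)// /K.
by have := b0 V; lra.
Unshelve. all: by end_near. Qed.

(** The discrete version of delta e^{- 2 v}. As b may be unbounded, 1 - e^{- delta b} is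
    not uniformly close to delta b; keeping it here makes rates exact multiples
    of cells. *)
Definition rate (delta v : R) := expR (- 2 * v) * (1 - expR (- (delta * b v))) / b v.

(** b |-> (1 - e^{- delta b}) / b is non-increasing and at least delta / (1 + b). *)
Lemma rate_gap (delta x m : R) : 0 <= delta -> delta <= 1 -> x <= m ->
  delta * (expR (- 2 * x) - expR (- 2 * m)) / (1 + b x) <= rate delta x - rate delta m.
Proof.
move=> d0 d1 xm.
have bx := b0 x; have bm := b0 m; have bxm := mb xm.
pose r v := (1 - expR (- (delta * b v))) / b v.
have rE v : rate delta v = expR (- 2 * v) * r v by rewrite /rate /r mulrA.
have r1 : delta / (1 + b x) <= r x.
  rewrite /r ler_pdivlMr//.
  have db : 0 <= delta * b x by rewrite mulr_ge0// ltW.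
  apply: le_trans (onem_expRN_ge db); rewrite mulrAC.
  rewrite ler_wpM2l// lef_pV2 ?posrE ?lerD2l ?ltr_wpDr ?(ltW bx)//.
  by rewrite ler_piMl// ltW.
have r2 : r m <= r x.
  rewrite /r ler_pdivrMr// mulrAC ler_pdivlMr//.
  pose u := delta * b x.
  have u0 : 0 <= u by rewrite mulr_ge0// ltW.
  have -> : delta * b m = u + delta * (b m - b x) by rewrite /u; ring.
  rewrite -/u opprD expRD.
  have w0 : 0 <= delta * (b m - b x) by rewrite mulr_ge0// subr_ge0.
  have h1 := onem_expRN_le (delta * (b m - b x)).
  have h2 := onem_expRN_le u.
  have eu := expR_gt0 (- u).
  (* equivalent to 1 + u <= e^u *)
  have h3 : u * expR (- u) <= 1 - expR (- u).
    have h := expR_ge1Dx u.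
    have hh : expR (- u) * expR u = 1 by rewrite -expRD addNr expR0.
    by have := ler_wpM2l (ltW eu) h; rewrite hh; lra.
  have h4 := ler_wpM2l (ltW eu) h1.
  have h5 : 1 - expR (- u) * expR (- (delta * (b m - b x))) <=
     1 - expR (- u) + expR (- u) * (delta * (b m - b x)) by lra.
  apply: le_trans (ler_wpM2r (ltW bx) h5) _.
  have h6 : 0 <= (b m - b x) * (1 - expR (- u) - u * expR (- u)).
    by rewrite mulr_ge0 ?subr_ge0.
  have -> : (1 - expR (- u) + expR (- u) * (delta * (b m - b x))) * b x =
     (1 - expR (- u)) * b x + (b m - b x) * (u * expR (- u)) by rewrite /u; ring.
  by move: h6; lra.
rewrite !rE.
have e1 := expR_ge0 (- 2 * m).
have e2 : 0 <= expR (- 2 * x) - expR (- 2 * m).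
  by rewrite subr_ge0 ler_expR ler_wnM2l.
have := ler_wpM2l e1 r2; have := ler_wpM2l e2 r1.
rewrite mulrA (mulrC _ delta); lra.
Qed.

(** The function that turns cells into rates, in the variable u = e^{x0 - v}; it
    tends to 0 as v tends to infinity, so it extends continuously to [0, 1]. *)
Let H (u : R) : R := expR (- x0) * Num.max u 0 / b (Num.max (x0 - ln u) x0).

Let H_cont : continuous H.
Proof.
move=> u; have [u0|u0|u0] := ltgtP u 0.
- have : cst 0 t @[t --> u] --> H u.
    rewrite /H (max_idPr (ltW u0)) mulr0 mul0r; exact: cvg_cst.
  apply: cvg_trans; apply: near_eq_cvg; near=> t.
  have t0 : t < 0 by near: t; exact: lt_nbhsl.
  by rewrite /H /= (max_idPr (ltW t0)) mulr0 mul0r.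
- apply: cvgM; last first.
    apply: cvgV; first by rewrite gt_eqF.
    apply: continuous_cvg; first exact: cb.
    apply: (@continuous_max _ _ (fun t => x0 - ln t) (cst x0)); last exact: cvg_cst.
    by apply: cvgB; [exact: cvg_cst|exact: continuous_ln].
  apply: cvgM; first exact: cvg_cst.
  by apply: (@continuous_max _ _ id (cst 0)); [exact: cvg_id|exact: cvg_cst].
- rewrite u0 /continuous_at.
  have -> : H 0 = 0 by rewrite /H maxxx mulr0 mul0r.
  apply: (@squeeze_cvgr _ _ _ _ (cst 0) (fun t => expR (- x0) * `|t| / b x0)).
  + near=> t; have m0 : 0 <= expR (- x0) * Num.max t 0.
      by rewrite mulr_ge0 ?expR_ge0// le_max lexx orbT.
    rewrite /H /= divr_ge0 ?(ltW (b0 _))//=; apply: ler_pM => //.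
    + by rewrite invr_ge0 ltW.
    + by rewrite ler_wpM2l ?expR_ge0// ge_max normr_ge0 ler_norm.
    + by rewrite lef_pV2 ?posrE//; apply: mb; rewrite le_max lexx orbT.
  + exact: cvg_cst.
  + rewrite -[X in _ --> X](mul0r (b x0)^-1) -[X in X / _](mulr0 (expR (- x0))).
    apply: cvgM; last exact: cvg_cst.
    apply: cvgM; first exact: cvg_cst.
    by rewrite -[X in _ --> X](normr0 R); exact: norm_continuous.
Unshelve. all: by end_near. Qed.

(** A polynomial in e^{- v} times the cell at lam = 1 is a combination of cells at
    integers lam. *)
Lemma rate_approx (eps : R) : 0 < eps -> exists p : {poly R},
  forall v delta, x0 <= v -> 0 <= delta ->
    `|rate delta v - p.[expR (- v)] * cell 1 1 delta v| <= eps * cell 1 1 delta v.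
Proof.
move=> e0; have [p hp] := weierstrass H_cont e0.
exists (p \Po (expR x0 *: 'X)) => v delta xv d0.
have -> : (p \Po (expR x0 *: 'X)).[expR (- v)] = p.[expR (x0 - v)].
  by rewrite horner_comp hornerZ hornerX -expRD.
have u0 : 0 < expR (x0 - v) by exact: expR_gt0.
have u1 : expR (x0 - v) <= 1 by rewrite -[leRHS]expR0 ler_expR subr_le0.
have := hp (expR (x0 - v)); rewrite (ltW u0) u1 => /(_ isT).
rewrite /H (max_idPl (ltW u0)) expRK subKr (max_idPl xv) -expRD addKr => h.
have -> : rate delta v = expR (- v) / b v * cell 1 1 delta v.
  by rewrite /rate /cell !mul1r (_ : - 2 * v = - v + - 1 * v) ?expRD; ring.
rewrite -mulrBl normrM (ger0_norm (cell_ge0 _ _ ler01 d0)) ler_wpM2r//.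
exact: cell_ge0.
Qed.

End exponential_cells.

Section adapted_max.
Context d (T : measurableType d) (R : realType) (P : probability T R).
Variable F : R -> set (set T).
Hypothesis hF : usual_conditions P F.

(** F t is a sigma-algebra, hence the measurability of a maximum of measurable
    functions applies on the space (T, F t). *)
Lemma adapted_max (X Y : R -> T -> R) : adapted F X -> adapted F Y ->
  adapted F (fun t w => Num.max (X t w) (Y t w)).
Proof.
move=> aX aY t t0 B mB.
pose T' := g_sigma_algebraType (F t).
have mX : measurable_fun [set: T'] (X t : T' -> R).
  by move=> _ C mC; rewrite setTI; apply: sub_gen_smallest; exact: aX.
have mY : measurable_fun [set: T'] (Y t : T' -> R).
  by move=> _ C mC; rewrite setTI; apply: sub_gen_smallest; exact: aY.
have := measurable_maxr mX mY measurableT mB.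
rewrite setTI /measurable/=.
rewrite (sigma_algebra_id (usual_sigma_algebra hF t0)).
exact.
Qed.

End adapted_max.

(** * Euler processes and their exponential moments *)

Section euler_process.
Context d (T : measurableType d) (R : realType) (P : probability T R).
Variables (F : R -> set (set T)) (alpha : R) (Z : R -> T -> R) (phi : R -> R).
Hypothesis hF : usual_conditions P F.
Hypothesis alpha0 : 0 < alpha.
Hypothesis alpha1 : alpha < 1.
Hypothesis hZ : one_sided_stable P F alpha Z.
Hypothesis phic : continuous phi.
Hypothesis mphi : forall x y : R, x <= y -> phi x <= phi y.
Hypothesis phi0 : forall x : R, 0 < phi x.
Variables (kappa x0 : R).
Hypothesis kappa0 : 0 < kappa.
Hypothesis lap : forall t lam, 0 <= t -> 0 < lam ->
  \int[P]_w expR (- lam * `|Z t w|) = expR (- (t * (kappa * lam `^ alpha))).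

Let lZ : cadlag_levy P F Z := hZ.1.

Let mZ t : 0 <= t -> measurable_fun [set: T] (Z t).
Proof. by apply: (adapted_measurable hF); exact: levy_adapted lZ. Qed.

(** Given the value v at time t, 1 - e^{- lam phi(v) dZ} has mean
    1 - e^{- delta lam^alpha intensity(v)} over a time step delta. *)
Definition intensity v := kappa * phi v `^ alpha.
Let b := intensity.

Let b0 v : 0 < b v.
Proof. by rewrite mulr_gt0// powR_gt0. Qed.

Let mb u v : u <= v -> b u <= b v.
Proof.
move=> uv; rewrite (ler_pM2l kappa0) ge0_ler_powR ?(ltW alpha0)//.
- by rewrite nnegrE ltW.
- by rewrite nnegrE ltW.
- exact: mphi.
Qed.

Let cb : continuous b.
Proof.
have -> : b = fun v => kappa * expR (alpha * ln (phi v)).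
  by apply/funext => v; rewrite /b /intensity /powR gt_eqF.
move=> v; apply: cvgM; first exact: cvg_cst.
apply: continuous_cvg; first exact: continuous_expR.
apply: cvgM; first exact: cvg_cst.
by apply: continuous_cvg; [exact: continuous_ln|exact: phic].
Qed.

Definition euler_process (Y : R -> T -> R) := adapted F Y /\
  {ae P, forall w, Y 0 w = x0 /\ euler_path phi (Z ^~ w) (Y ^~ w)}.

Definition time n k : R := k%:R / n.+1%:R.

Let time_ge0 n k : 0 <= time n k.
Proof. by rewrite divr_ge0. Qed.

Let timeS n k : time n k.+1 - time n k = n.+1%:R^-1.
Proof. by rewrite /time -natr1 mulrDl mul1r addrAC subrr add0r. Qed.

Let le_time n i j : (i <= j)%N -> time n i <= time n j.
Proof. by move=> ij; rewrite ler_wpM2r ?invr_ge0// ler_nat. Qed.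

Let timeM m n : time n (m * n.+1) = m%:R.
Proof. by rewrite /time natrM mulfK// pnatr_eq0. Qed.

Let grid_time n N k : grid 0 (time n N.+1) N.+1 k = time n k.
Proof.
rewrite /grid /time; have h : (N.+1%:R : R) != 0 by rewrite pnatr_eq0.
have h' : (n.+1%:R : R) != 0 by rewrite pnatr_eq0.
by move: h h'; move: (N.+1%:R : R) (n.+1%:R : R) => u v *; field; apply/andP.
Qed.

(** For an Euler process this is Y almost surely, but bounded from below everywhere, so that
    e^{- lam clip Y} is bounded. *)
Definition clip (Y : R -> T -> R) t w := Num.max (Y t w) x0.

Let clip_ge (Y : R -> T -> R) t w : x0 <= clip Y t w.
Proof. by rewrite le_max lexx orbT. Qed.

Let measurable_clip Y t : euler_process Y -> 0 <= t -> measurable_fun [set: T] (clip Y t).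
Proof.
move=> [aY _] t0; apply: measurable_maxr; last exact: measurable_cst.
exact: (adapted_measurable hF aY t0).
Qed.

Let good_path Y : euler_process Y -> {ae P, forall w, [/\ Z 0 w = 0,
  monotone_path (Z ^~ w), euler_path phi (Z ^~ w) (Y ^~ w) &
  forall t, 0 <= t -> clip Y t w = Y t w] }.
Proof.
move=> [_ eY]; move: (levy_start lZ) (stable_monotone hF alpha0 alpha1 hZ) eY.
apply: filterS3 => w z0 mz [y0 ey]; split => // t t0.
apply/max_idPl; rewrite -y0.
exact: (euler_super_monotone phi0 mz ey.1).
Qed.

Definition step (lam : R) (u : R * R) := expR (- lam * Num.max u.1 x0) *
  (1 - expR (- (lam * phi (Num.max u.1 x0)) * `|u.2|)).

Let measurable_phi : measurable_fun [set: R] phi.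
Proof. exact: continuous_measurable_fun phic. Qed.

Let measurable_step lam : measurable_fun [set: R * R] (step lam).
Proof.
have m1 : measurable_fun [set: R * R] (fun u => Num.max u.1 x0).
  by apply: measurable_maxr; [exact: measurable_fst|exact: measurable_cst].
apply: measurable_funM.
  by apply: measurableT_comp => //; apply: measurable_funM.
apply: measurable_funB => //; apply: measurableT_comp => //.
apply: measurable_funM.
  apply: measurableT_comp => //; apply: measurable_funM => //.
  exact: measurableT_comp.
by apply: measurableT_comp => //; exact: measurable_snd.
Qed.

Let step_bounds lam u : 0 < lam -> 0 <= step lam u <= expR (- lam * x0).
Proof.
move=> l0; have h : 0 <= (lam * phi (Num.max u.1 x0)) * `|u.2|.
  by rewrite !mulr_ge0 ?(ltW l0) ?(ltW (phi0 _)).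
apply/andP; split.
  by rewrite mulr_ge0 ?expR_ge0// mulNr onem_expRN_ge0.
apply: (@le_trans _ _ (expR (- lam * Num.max u.1 x0))).
  by rewrite ler_piMr ?expR_ge0// gerBl expR_ge0.
by rewrite ler_expR ler_wnM2l ?oppr_le0 ?(ltW l0)// le_max lexx orbT.
Qed.

Definition Zincr n k w := Z (time n k.+1) w - Z (time n k) w.

Let mZincr n k : measurable_fun [set: T] (Zincr n k).
Proof. by apply: measurable_funB; exact: mZ. Qed.

Let bounded_step Y lam n k : euler_process Y -> 0 < lam ->
  bounded_rv (fun w => step lam (Y (time n k) w, Zincr n k w)).
Proof.
move=> eY l0; split.
  apply: (measurableT_comp (measurable_step lam)); apply: measurable_fun_pair => //.
  exact: (adapted_measurable hF eY.1).
exists (expR (- lam * x0)) => w.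
by have /andP[h1 h2] := step_bounds (Y (time n k) w, Zincr n k w) l0; rewrite ger0_norm.
Qed.

(** The increment of Z is independent of the past and has the law of Z at the mesh
    size; its Laplace transform is known. *)
Lemma step_mean Y lam n k : euler_process Y -> 0 < lam ->
  \int[P]_w step lam (Y (time n k) w, Zincr n k w) =
  \int[P]_w cell b lam (lam `^ alpha) n.+1%:R^-1 (clip Y (time n k) w).
Proof.
move=> eY l0.
have tt : time n k < time n k.+1 by rewrite -subr_gt0 timeS.
have del0 : 0 <= (n.+1%:R^-1 : R) by rewrite invr_ge0.
rewrite (independent_pair_mean (adapted_measurable hF eY.1 (time_ge0 n k)) (mZincr n k)
  (eY.1 _ (time_ge0 n k)) (levy_indep lZ (time_ge0 n k) tt) (measurable_step lam)
  (fun u => step_bounds u l0)).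
apply: eq_Rintegral => w _; rewrite /step /=; set v := Num.max _ _.
have q0 : 0 < lam * phi v by rewrite mulr_gt0.
have law := levy_stationary lZ (time_ge0 n k) tt; rewrite timeS in law.
have bexp : bounded_rv (fun w' => expR (- (lam * phi v) * `|Zincr n k w'|)).
  split; first by do 2 apply: measurableT_comp => //; exact: measurableT_comp.
  exists 1 => w'; rewrite ger0_norm ?expR_ge0// -[leRHS]expR0 ler_expR mulNr oppr_le0.
  by rewrite mulr_ge0// ltW.
rewrite meanZ; last by apply: bounded_rvB => //; exact: bounded_rv_cst.
rewrite meanB//; last exact: bounded_rv_cst.
rewrite mean_cst (@eq_law_mean _ _ _ P _ (Z n.+1%:R^-1)
  (fun x => expR (- (lam * phi v) * `|x|)) (mZincr n k) (mZ del0) law).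
- rewrite lap// /cell /b /intensity /clip -/v powRM ?(ltW l0) ?(ltW (phi0 _))//.
  by congr (_ * (1 - expR (- (_ * _)))); ring.
- by apply: measurableT_comp => //; apply: measurable_funM.
- by move=> x; exact: expR_ge0.
Qed.

Let step_sumE Y lam n N : euler_process Y -> {ae P, forall w,
  \sum_(k < N.+1) step lam (Y (time n k) w, Zincr n k w) =
  exp_sum phi (Z ^~ w) (Y ^~ w) lam 0 (time n N.+1) N.+1}.
Proof.
move=> eY; apply: filterS (good_path eY) => w [z0 mz ey cY].
apply: eq_bigr => k _; rewrite !grid_time /step /=.
rewrite -/(clip Y (time n k) w) cY// ger0_norm// subr_ge0 mz//.
exact: le_time.
Qed.

Let step_sum_mean_le Y lam n N : euler_process Y -> 0 < lam ->
  \int[P]_w \sum_(k < N.+1) step lam (Y (time n k) w, Zincr n k w) <= expR (- lam * x0).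
Proof.
move=> eY l0; rewrite -[leRHS](mean_cst P); apply: mean_le.
- exact: (@bounded_rv_sum _ _ _ N.+1 (fun k w => step lam (Y (time n k) w, Zincr n k w))
    (fun k => bounded_step n k eY l0)).
- exact: bounded_rv_cst.
apply: filterS3 (step_sumE lam n N eY) (good_path eY) eY.2 => w -> [z0 mz ey cY] [y0 _].
apply: le_trans (exp_sum_le N ey.1 l0 (lexx 0) (time_ge0 n N.+1)) _.
by rewrite y0 gerBl expR_ge0.
Qed.

Let bounded_exp_clip Y lam t : euler_process Y -> 0 < lam -> 0 <= t ->
  bounded_rv (fun w => expR (- lam * clip Y t w)).
Proof.
move=> eY l0 t0; split.
  by apply: measurableT_comp => //; apply: measurable_funM => //; exact: measurable_clip.
exists (expR (- lam * x0)) => w; rewrite ger0_norm ?expR_ge0// ler_expR.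
by rewrite ler_wnM2l ?oppr_le0 ?(ltW l0).
Qed.

(** Pathwise convergence of exp_sum on [0, m + 1]; the minimum with e^{- lam x0}
    only changes the sum on a null set and gives a uniform bound. *)
Let step_sum_mean_cvg Y lam m : euler_process Y -> 0 < lam ->
  \int[P]_w \sum_(k < m.+1 * n.+1) step lam (Y (time n k) w, Zincr n k w) @[n --> \oo] -->
  expR (- lam * x0) - \int[P]_w expR (- lam * clip Y m.+1%:R w).
Proof.
move=> eY l0; have m0 : (0 : R) <= m.+1%:R by [].
pose N n := (m.+1 * n.+1).-1.
have NE n : (N n).+1 = (m.+1 * n.+1)%N by rewrite prednK.
have Noo : N n @[n --> \oo] --> \oo.
  apply/cvgnyPge => k; near=> n; rewrite /N -ltnS prednK//.
  apply: (@leq_trans n.+1); last by rewrite leq_pmull.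
  by rewrite ltnS; near: n; exact: nbhs_infty_ge.
pose f n w := \sum_(k < m.+1 * n.+1) step lam (Y (time n k) w, Zincr n k w).
have bf n : bounded_rv (f n).
  exact: (@bounded_rv_sum _ _ _ (m.+1 * n.+1) (fun k w => step lam (Y (time n k) w, Zincr n k w))
    (fun k => bounded_step n k eY l0)).
have f0 n w : 0 <= f n w.
  by apply: sumr_ge0 => k _; have /andP[] := step_bounds (Y (time n k) w, Zincr n k w) l0.
have fE : {ae P, forall w, forall n, f n w =
    exp_sum phi (Z ^~ w) (Y ^~ w) lam 0 m.+1%:R (N n).+1}.
  apply: ae_foralln => n; apply: filterS (step_sumE lam n (N n) eY) => w.
  by rewrite NE timeM.
pose g n w := Num.min (f n w) (expR (- lam * x0)).
have bg n : bounded_rv (g n).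
  split; first by apply: measurable_minr => //; case: (bf n).
  exists (expR (- lam * x0)) => w; rewrite ger0_norm ?ge_min ?lexx ?orbT//.
  by rewrite le_min f0 expR_ge0.
have gf : {ae P, forall w n, g n w = f n w}.
  apply: filterS3 fE (good_path eY) eY.2 => w hf [z0 mz ey cY] [y0 _] n.
  apply/min_idPl; rewrite hf.
  apply: le_trans (exp_sum_le (N n) ey.1 l0 (lexx 0) m0) _.
  by rewrite y0 gerBl expR_ge0.
have -> : (fun n => \int[P]_w f n w) = fun n => \int[P]_w g n w.
  apply/funext => n; apply: mean_eq_ae => //.
  by apply: filterS gf => w ->.
have bl : bounded_rv (fun w => expR (- lam * x0) - expR (- lam * clip Y m.+1%:R w)).
  by apply: bounded_rvB; [exact: bounded_rv_cst|exact: bounded_exp_clip].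
rewrite -{1}[expR (- lam * x0)](mean_cst P) -meanB; last 2 first.
- exact: bounded_rv_cst.
- exact: bounded_exp_clip.
apply: (@mean_cvg _ _ _ _ g _ (expR (- lam * x0))) => //.
- by move=> n; case: (bg n).
- move=> n w; rewrite ger0_norm ?ge_min ?lexx ?orbT//.
  by rewrite le_min f0 expR_ge0.
apply: filterS3 gf fE (filterI (good_path eY) eY.2) => w hg hf [[z0 mz ey cY] [y0 _]].
under eq_fun do rewrite hg hf.
rewrite cY// -y0.
exact: (cvg_comp _ _ Noo (exp_sum_cvg phi0 mz ey l0 (lexx 0) m0)).
Unshelve. all: by end_near. Qed.

(** Y_m >= x0 + phi(x0) Z_m. *)
Let exp_clip_mean_le Y lam m : euler_process Y -> 0 < lam ->
  \int[P]_w expR (- lam * clip Y m%:R w) <=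
  expR (- lam * x0) * expR (- (kappa * (lam * phi x0) `^ alpha)) ^+ m.
Proof.
move=> eY l0; have m0 : (0 : R) <= m%:R by [].
have q0 : 0 < lam * phi x0 by rewrite mulr_gt0.
have bexp : bounded_rv (fun w => expR (- (lam * phi x0) * `|Z m%:R w|)).
  split; first by do 2 apply: measurableT_comp => //; apply: measurableT_comp => //; exact: mZ.
  exists 1 => w; rewrite ger0_norm ?expR_ge0// -[leRHS]expR0 ler_expR mulNr oppr_le0.
  by rewrite mulr_ge0// ltW.
rewrite -expRM_natl mulrN -(lap m0 q0) -meanZ//; apply: mean_le.
- exact: bounded_exp_clip.
- by apply: bounded_rvM => //; exact: bounded_rv_cst.
apply: filterS2 (good_path eY) eY.2 => w [z0 mz ey cY] [y0 _].
rewrite cY// -expRD ler_expR.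
have := ey.1 0 m%:R (lexx 0) m0; rewrite y0 z0 subr0.
have := mz 0 m%:R (lexx 0) m0; rewrite z0 => h; rewrite (ger0_norm h) => h2.
rewrite (_ : _ + _ = - lam * (x0 + phi x0 * Z m%:R w)); last by ring.
by rewrite ler_wnM2l ?oppr_le0 ?(ltW l0).
Qed.

(** As n grows the mesh 1 / (n + 1) shrinks and the horizon n + 1 grows at the same
    time. *)
Definition total Y n (g : R -> R) :=
  \sum_(k < n.+1 * n.+1) \int[P]_w g (clip Y (time n k) w).

(** Bounded on [x0, +oo[ only, where clipped processes live: e^{- v} is unbounded
    on the whole line. *)
Definition tame (g : R -> R) := measurable_fun [set: R] g /\
  exists K, forall v, x0 <= v -> `|g v| <= K.

Let tame_rv Y t g : euler_process Y -> 0 <= t -> tame g ->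
  bounded_rv (fun w => g (clip Y t w)).
Proof.
move=> eY t0 [mg [K gK]]; split.
  by apply: measurableT_comp => //; exact: measurable_clip.
by exists K => w; exact: gK.
Qed.

Let tameB f g : tame f -> tame g -> tame (fun v => f v - g v).
Proof.
move=> [mf [K fK]] [mg [L gL]]; split; first exact: measurable_funB.
by exists (K + L) => v xv; apply: le_trans (ler_normB _ _) _; rewrite lerD ?fK ?gL.
Qed.

Let tameZ c g : tame g -> tame (fun v => c * g v).
Proof.
move=> [mg [L gL]]; split; first exact: measurable_funM.
by exists (`|c| * L) => v xv; rewrite normrM ler_wpM2l// gL.
Qed.

Let tame_sum N (f : nat -> R -> R) : (forall i, tame (f i)) ->
  tame (fun v => \sum_(i < N) f i v).
Proof.
move=> tf; elim: N => [|N [IH [K IHK]]].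
  under eq_fun do rewrite big_ord0; split; first exact: measurable_cst.
  by exists 0 => v _; rewrite normr0.
have [mf [L fL]] := tf N.
under eq_fun do rewrite big_ord_recr/=; split; first exact: measurable_funD.
by exists (K + L) => v xv; apply: le_trans (ler_normD _ _) _; rewrite lerD ?IHK ?fL.
Qed.

Let tame_cell lam L n : 0 <= lam -> 0 <= L -> tame (cell b lam L n.+1%:R^-1).
Proof.
move=> l0 L0; have mb' : measurable_fun [set: R] b by exact: continuous_measurable_fun cb.
split.
  apply: measurable_funM.
    by apply: measurableT_comp => //; exact: measurable_funM.
  apply: measurable_funB => //; apply: measurableT_comp => //.
  apply: measurableT_comp => //; apply: measurable_funM => //.
  exact: measurable_funM.
exists (expR (- lam * x0)) => v xv.
rewrite ger0_norm; last by apply: cell_ge0 => //; rewrite invr_ge0.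
apply: le_trans (cell_le _ _ _ _ _) _ => //.
by rewrite ler_expR ler_wnM2l ?oppr_le0.
Qed.

Let tame_rate n : tame (rate b n.+1%:R^-1).
Proof.
have mb' : measurable_fun [set: R] b by exact: continuous_measurable_fun cb.
split.
  have -> : rate b n.+1%:R^-1 = fun v => cell b 2 1 n.+1%:R^-1 v * (b v) `^ (-1).
    by apply/funext => v; rewrite /rate /cell mul1r powR_inv1// ltW.
  apply: measurable_funM; first by case: (@tame_cell 2 1 n _ _).
  exact: measurableT_comp (measurable_powR (-1)) mb'.
exists (expR (- 2 * x0) / b x0) => v xv.
have c0 : 0 <= cell b 2 1 n.+1%:R^-1 v by apply: cell_ge0 => //; rewrite invr_ge0.
have -> : rate b n.+1%:R^-1 v = cell b 2 1 n.+1%:R^-1 v / b v by rewrite /rate /cell mul1r.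
rewrite ger0_norm ?divr_ge0 ?(ltW (b0 _))//; apply: ler_pM => //.
- by rewrite invr_ge0 ltW.
- apply: (@le_trans _ _ (expR (- 2 * v))); first exact: cell_le.
  by rewrite ler_expR ler_wnM2l.
- by rewrite lef_pV2 ?posrE// mb.
Qed.

Let totalB Y n f g : euler_process Y -> tame f -> tame g ->
  total Y n (fun v => f v - g v) = total Y n f - total Y n g.
Proof.
move=> eY tf tg; rewrite -sumrB; apply: eq_bigr => k _.
by rewrite -meanB//; exact: tame_rv.
Qed.

Let totalZ Y n c g : euler_process Y -> tame g ->
  total Y n (fun v => c * g v) = c * total Y n g.
Proof.
move=> eY tg; rewrite mulr_sumr; apply: eq_bigr => k _.
by rewrite meanZ//; exact: tame_rv.
Qed.

Let total_sum Y n N (f : nat -> R -> R) : euler_process Y -> (forall i, tame (f i)) ->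
  total Y n (fun v => \sum_(i < N) f i v) = \sum_(i < N) total Y n (f i).
Proof.
move=> eY tf; rewrite /total exchange_big/=; apply: eq_bigr => k _.
by rewrite (@mean_sum _ _ _ P N (fun i w => f i (clip Y (time n k) w)))// => i; exact: tame_rv.
Qed.

Let total_norm_le Y n f g : euler_process Y -> tame f -> tame g ->
  (forall v, x0 <= v -> `|f v| <= g v) -> `|total Y n f| <= total Y n g.
Proof.
move=> eY tf tg fg; apply: le_trans (ler_norm_sum _ _ _) _.
apply: ler_sum => k _.
have bf := tame_rv eY (time_ge0 n k) tf; have bg := tame_rv eY (time_ge0 n k) tg.
rewrite ler_norml; apply/andP; split.
  rewrite lerNl -mulN1r -meanZ//; apply: mean_le => //.
    by apply: bounded_rvM => //; exact: bounded_rv_cst.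
  apply: aeW => w; rewrite mulN1r.
  by have := fg _ (clip_ge Y (time n k) w); rewrite ler_norml => /andP[h _]; rewrite lerNl.
apply: mean_le => //; apply: aeW => w.
exact: le_trans (ler_norm _) (fg _ (clip_ge Y (time n k) w)).
Qed.

Let total_stepE Y n lam : euler_process Y -> 0 < lam ->
  total Y n (cell b lam (lam `^ alpha) n.+1%:R^-1) =
  \int[P]_w \sum_(k < n.+1 * n.+1) step lam (Y (time n k) w, Zincr n k w).
Proof.
move=> eY l0.
rewrite (@mean_sum _ _ _ P _ (fun k w => step lam (Y (time n k) w, Zincr n k w))); last first.
  by move=> k; exact: bounded_step.
by apply: eq_bigr => k _; rewrite step_mean.
Qed.

Let total_le Y n lam : euler_process Y -> 0 < lam ->
  total Y n (cell b lam (lam `^ alpha) n.+1%:R^-1) <= expR (- lam * x0).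
Proof.
move=> eY l0; rewrite total_stepE//.
by rewrite -(@prednK (n.+1 * n.+1))//; exact: step_sum_mean_le.
Qed.

(** Summing step_mean, the exponential sum over all times has mean
    e^{- lam x0} - E e^{- lam Y_oo}, and Y tends to infinity. *)
Lemma total_cvg Y lam : euler_process Y -> 0 < lam ->
  total Y n (cell b lam (lam `^ alpha) n.+1%:R^-1) @[n --> \oo] --> expR (- lam * x0).
Proof.
move=> eY l0; apply/cvgrPdist_le => e e0.
pose q := expR (- (kappa * (lam * phi x0) `^ alpha)).
have q1 : `|q| < 1.
  rewrite ger0_norm ?expR_ge0// -[ltRHS]expR0 ltr_expR oppr_lt0.
  by rewrite mulr_gt0// powR_gt0// mulr_gt0.
have e2 : 0 < e / 2 by rewrite divr_gt0.
have [m hm] : exists m, expR (- lam * x0) * q ^+ m.+1 <= e / 2.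
  have : expR (- lam * x0) * q ^+ m @[m --> \oo] --> 0.
    rewrite -[X in _ --> X](mulr0 (expR (- lam * x0))).
    by apply: cvgM; [exact: cvg_cst|exact: cvg_expr].
  move=> /cvgrPdist_le/(_ _ e2)[m _ hm]; exists m.
  have := hm m.+1 (leqnSn m); rewrite sub0r normrN; apply: le_trans; exact: ler_norm.
have := @step_sum_mean_cvg _ _ m eY l0 => /cvgrPdist_le/(_ _ e2).
have := @exp_clip_mean_le _ _ m.+1 eY l0; rewrite -/q => hm2.
apply: filterS2 (nbhs_infty_ge m) => n mn hn.
have hle := total_le n eY l0.
rewrite ger0_norm ?subr_ge0//.
have : \int[P]_w \sum_(k < m.+1 * n.+1) step lam (Y (time n k) w, Zincr n k w) <=
    total Y n (cell b lam (lam `^ alpha) n.+1%:R^-1).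
  rewrite total_stepE//; apply: mean_le.
  - exact: (@bounded_rv_sum _ _ _ (m.+1 * n.+1) (fun k w => step lam (Y (time n k) w, Zincr n k w))
      (fun k => bounded_step n k eY l0)).
  - exact: (@bounded_rv_sum _ _ _ (n.+1 * n.+1) (fun k w => step lam (Y (time n k) w, Zincr n k w))
      (fun k => bounded_step n k eY l0)).
  apply: aeW => w.
  pose F' k := step lam (Y (time n k) w, Zincr n k w).
  rewrite -(big_mkord xpredT F') -(big_mkord xpredT F').
  rewrite [leRHS](@big_cat_nat _ _ _ (m.+1 * n.+1))//=; last by rewrite leq_mul2r orbC ltnS mn.
  rewrite lerDl; apply: sumr_ge0 => k _.
  by have /andP[] := step_bounds (Y (time n k) w, Zincr n k w) l0.
move: hn => /ler_normlP[_]; lra.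
Qed.

(** In the limit, j^alpha times the j-th moment of the occupation measure weighted
    by b is e^{- j x0}, a value that does not depend on Y. For j = 1 the scaling
    is trivial; for j >= 2 it costs eps times the total for j = 1, which is
    bounded. *)
Lemma total_cell_cvg Y j : (0 < j)%N -> euler_process Y ->
  total Y n (cell b j%:R 1 n.+1%:R^-1) @[n --> \oo] --> expR (- j%:R * x0) / j%:R `^ alpha.
Proof.
move=> j0 eY; have jR : (0 : R) < j%:R by rewrite ltr0n.
have := total_cvg eY jR; set L := j%:R `^ alpha.
have [j1|j2] := leqP j 1.
  have -> : L = 1 by rewrite /L (_ : j = 1%N) ?powR1//; apply/eqP; rewrite eqn_leq j1 j0.
  by rewrite divr1.
have j1 : (1 : R) <= j%:R by rewrite ler1n.
have L1 : 1 <= L by rewrite -[leLHS](powRr0 j%:R) ler_powR// ltW.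
have Lj : L <= j%:R by rewrite -[leRHS](powRr1 (ltW jR)) ler_powR// ltW.
have L0 : 0 < L by lra.
move=> cL.
have tc n : tame (cell b j%:R 1 n.+1%:R^-1) by apply: tame_cell.
have tL n : tame (cell b j%:R L n.+1%:R^-1) by apply: tame_cell => //; exact: ltW.
have cD : L * total Y n (cell b j%:R 1 n.+1%:R^-1) - total Y n (cell b j%:R L n.+1%:R^-1)
    @[n --> \oo] --> 0.
  apply/cvgrPdist_le => e e0.
  have ee : 0 < e / expR (- 1 * x0) by rewrite divr_gt0 ?expR_gt0.
  apply: filterS (cell_scaling x0 b0 mb j2 L1 Lj ee) => n hn.
  rewrite sub0r normrN -totalZ// -totalB//; last exact: tameZ.
  have t1 : tame (fun v => e / expR (- 1 * x0) * cell b 1 1 n.+1%:R^-1 v).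
    by apply: tameZ; exact: tame_cell.
  apply: (le_trans (total_norm_le n eY (tameB (tameZ L (tc n)) (tL n)) t1 hn)).
  rewrite totalZ//; last exact: tame_cell.
  have := total_le n eY ltr01; rewrite powR1.
  move=> h; apply: le_trans (ler_wpM2l (ltW ee) h) _.
  by rewrite divfK// gt_eqF// expR_gt0.
rewrite mulrC.
have -> : (fun n => total Y n (cell b j%:R 1 n.+1%:R^-1)) =
    fun n => L^-1 * ((L * total Y n (cell b j%:R 1 n.+1%:R^-1) -
       total Y n (cell b j%:R L n.+1%:R^-1)) + total Y n (cell b j%:R L n.+1%:R^-1)).
  by apply/funext => n; rewrite subrK mulKf// gt_eqF.
apply: cvgM; first exact: cvg_cst.
by rewrite -[X in _ --> X]add0r; exact: cvgD.
Qed.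

(** Polynomials in e^{- v} have the same limits along X and Y, and rates are
    uniformly close to polynomials times cells of bounded total. *)
Lemma total_rate_cvg X Y : euler_process X -> euler_process Y ->
  total X n (rate b n.+1%:R^-1) - total Y n (rate b n.+1%:R^-1) @[n --> \oo] --> 0.
Proof.
move=> eX eY; apply/cvgrPdist_le => e e0.
pose E := expR (- 1 * x0); have E0 : 0 < E by exact: expR_gt0.
have e3 : 0 < e / 3 by rewrite divr_gt0.
have ee : 0 < e / 3 / E by rewrite divr_gt0.
have [p hp] := rate_approx x0 b0 mb cb ee.
pose g n v := p.[expR (- v)] * cell b 1 1 n.+1%:R^-1 v.
have gE n v : g n v = \sum_(i < size p) p`_i * cell b i.+1%:R 1 n.+1%:R^-1 v.
  rewrite /g horner_coef mulr_suml; apply: eq_bigr => i _.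
  rewrite -mulrA; congr (_ * _); rewrite /cell [LHS]mulrA -expRM_natl -expRD.
  by congr (expR _ * _); rewrite -natr1; ring.
have gE' n : g n = fun v => \sum_(i < size p) p`_i * cell b i.+1%:R 1 n.+1%:R^-1 v.
  by apply/funext => v; exact: gE.
have tp n i : tame (fun v => p`_i * cell b i.+1%:R 1 n.+1%:R^-1 v).
  by apply: tameZ; exact: tame_cell.
have tg n : tame (g n).
  by rewrite gE'; exact: tame_sum (tp n).
have tgE Y' n : euler_process Y' -> total Y' n (g n) =
    \sum_(i < size p) p`_i * total Y' n (cell b i.+1%:R 1 n.+1%:R^-1).
  move=> eY'; rewrite gE'.
  rewrite (@total_sum _ _ _ (fun i v => p`_i * cell b i.+1%:R 1 n.+1%:R^-1 v))//.
  by apply: eq_bigr => i _; rewrite totalZ//; exact: tame_cell.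
have cg Y' : euler_process Y' -> total Y' n (g n) @[n --> \oo] -->
    \sum_(i < size p) p`_i * (expR (- i.+1%:R * x0) / i.+1%:R `^ alpha).
  move=> eY'; under eq_fun do rewrite tgE//.
  apply: cvg_big => [|i _]; first exact: add_continuous.
  apply: cvgM; first exact: cvg_cst.
  exact: total_cell_cvg.
have tr := tame_rate.
have key Y' n : euler_process Y' ->
    `|total Y' n (rate b n.+1%:R^-1) - total Y' n (g n)| <= e / 3.
  move=> eY'; rewrite -totalB//.
  have t1 : tame (fun v => e / 3 / E * cell b 1 1 n.+1%:R^-1 v).
    by apply: tameZ; exact: tame_cell.
  have d0 : 0 <= (n.+1%:R^-1 : R) by rewrite invr_ge0.
  apply: (le_trans (total_norm_le n eY' (tameB (tr n) (tg n)) t1 (fun v xv => hp v _ xv d0))).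
  rewrite totalZ//; last exact: tame_cell.
  have := total_le n eY' ltr01; rewrite powR1 -/E.
  move=> h; apply: le_trans (ler_wpM2l (ltW ee) h) _.
  by rewrite divfK// gt_eqF.
have : total X n (g n) - total Y n (g n) @[n --> \oo] --> 0.
  by rewrite -[X in _ --> X](subrr (\sum_(i < size p) p`_i * (expR (- i.+1%:R * x0) / i.+1%:R `^ alpha))); apply: cvgB; exact: cg.
move=> /cvgrPdist_le/(_ _ e3); apply: filterS => n hn.
have := key X n eX; have := key Y n eY; move: hn.
move: (total X n (g n)) (total Y n (g n)) => u v.
move: (total X n (rate b n.+1%:R^-1)) (total Y n (rate b n.+1%:R^-1)) => u' v'.
rewrite !ler_norml => /andP[h1 h2] /andP[h3 h4] /andP[h5 h6].
by apply/andP; split; lra.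
Qed.

(** In the difference of totals of rates every term is non-negative as X <= Y. The
    n + 1 grid points of [q, q + 1] together contribute at least the mean of
    G q, which is positive where X < Y at time q because Y - X is monotone. The
    difference tends to 0, hence X = Y at integer times, and at all times by
    monotonicity of Y - X again. *)
Lemma euler_process_eq X Y : euler_process X -> euler_process Y ->
  (forall t w, X t w <= Y t w) ->
  {ae P, forall w t, 0 <= t -> X t w = Y t w}.
Proof.
move=> eX eY XY.
have cXY t w : clip X t w <= clip Y t w by rewrite ge_max !le_max XY lexx orbT.
pose G q w := expR (- 2 * clip X q.+1%:R w) *
  (1 - expR (- (2 * (clip Y q%:R w - clip X q%:R w)))) / (1 + b (clip X q.+1%:R w)).
have mb' : measurable_fun [set: R] b by exact: continuous_measurable_fun cb.
have G0 q w : 0 <= G q w.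
  rewrite /G divr_ge0 ?addr_ge0 ?ler01 ?(ltW (b0 _))// mulr_ge0 ?expR_ge0//.
  by rewrite onem_expRN_ge0// mulr_ge0// subr_ge0.
have bG q : bounded_rv (G q).
  have mX q' : measurable_fun [set: T] (clip X (q'%:R : R)) by apply: measurable_clip.
  have mY q' : measurable_fun [set: T] (clip Y (q'%:R : R)) by apply: measurable_clip.
  have mi : measurable_fun [set: R] (fun v => (1 + b v) `^ (-1)).
    by apply: (measurableT_comp (measurable_powR (-1))); exact: measurable_funD.
  have GE : G q = fun w => expR (- 2 * clip X q.+1%:R w) *
    (1 - expR (- (2 * (clip Y q%:R w - clip X q%:R w)))) * (1 + b (clip X q.+1%:R w)) `^ (-1).
    by apply/funext => w; rewrite powR_inv1// addr_ge0// ltW.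
  split.
    rewrite GE; apply: measurable_funM; last exact: measurableT_comp mi (mX _).
    apply: measurable_funM.
      by apply: measurableT_comp => //; exact: measurable_funM.
    apply: measurable_funB => //; apply: measurableT_comp => //.
    apply: measurableT_comp => //; apply: measurable_funM => //.
    exact: measurable_funB.
  exists (expR (- 2 * x0)) => w; rewrite ger0_norm//.
  rewrite /G ler_pdivrMr ?addr_gt0//.
  apply: (@le_trans _ _ (expR (- 2 * clip X q.+1%:R w))).
    by rewrite ler_piMr ?expR_ge0// gerBl expR_ge0.
  apply: (@le_trans _ _ (expR (- 2 * x0))); first by rewrite ler_expR ler_wnM2l.
  by rewrite ler_peMr ?expR_ge0// lerDl ltW.
have br Y' n k : euler_process Y' ->
    bounded_rv (fun w => rate b n.+1%:R^-1 (clip Y' (time n k) w)).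
  by move=> eY'; exact: tame_rv.
have i01 n : 0 <= (n.+1%:R^-1 : R) <= 1 by rewrite invr_ge0 ler0n/= invf_le1// ler1n.
pose D n k := \int[P]_w rate b n.+1%:R^-1 (clip X (time n k) w) -
  \int[P]_w rate b n.+1%:R^-1 (clip Y (time n k) w).
have DE n k : D n k = \int[P]_w (rate b n.+1%:R^-1 (clip X (time n k) w) -
    rate b n.+1%:R^-1 (clip Y (time n k) w)) by rewrite meanB//; exact: br.
have gap n k w := rate_gap b0 mb (andP (i01 n)).1 (andP (i01 n)).2 (cXY (time n k) w).
have D0 n k : 0 <= D n k.
  rewrite DE; apply: Rintegral_ge0 => w _; apply: le_trans (gap n k w).
  have /andP[d0 _] := i01 n.
  rewrite divr_ge0 ?addr_ge0 ?(ltW (b0 _))// mulr_ge0// subr_ge0 ler_expR ler_wnM2l//.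
have DG n k q : (q * n.+1 <= k)%N -> (k < q.+1 * n.+1)%N ->
    n.+1%:R^-1 * \int[P]_w G q w <= D n k.
  move=> qk kq; rewrite DE -meanZ//; apply: mean_le.
  - by apply: bounded_rvM => //; exact: bounded_rv_cst.
  - by apply: bounded_rvB; exact: br.
  apply: filterS2 (good_path eX) (good_path eY) => w [z0 mz exX cX] [_ _ exY cY].
  apply: le_trans (gap n k w).
  have mX := euler_super_monotone phi0 mz exX.1.
  have mD := euler_path_sub_monotone mphi mz exX exY (fun t _ => XY t w).
  have q0 : (0 : R) <= q%:R by [].
  have t1 : q%:R <= time n k by rewrite -(timeM q n); exact: le_time.
  have t2 : time n k <= q.+1%:R by rewrite -(timeM q.+1 n); apply: le_time; exact: ltnW.
  have h1 := mX _ _ (time_ge0 n k) t2; have h2 := mD _ _ q0 t1.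
  rewrite /G !cX ?cY//.
  move: (i01 n) h1 h2; move: (n.+1%:R^-1 : R) => del /andP[d0 _].
  move: (X (time n k) w) (Y (time n k) w) (X q.+1%:R w) => x y x' h1 h2.
  rewrite -[leRHS]mulrA ler_wpM2l//.
  have -> : expR (- 2 * x) - expR (- 2 * y) = expR (- 2 * x) * (1 - expR (- (2 * (y - x)))).
    by rewrite mulrBr mulr1 -expRD; congr (_ - expR _); ring.
  apply: ler_pM.
  - rewrite mulr_ge0 ?expR_ge0// onem_expRN_ge0// mulr_ge0// subr_ge0; exact: XY.
  - by rewrite invr_ge0 addr_ge0// ltW.
  - apply: ler_pM; rewrite ?expR_ge0//.
    + by rewrite onem_expRN_ge0// mulr_ge0// subr_ge0; exact: XY.
    + by rewrite ler_expR ler_wnM2l.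
    + by rewrite lerD2l lerN2 ler_expR lerN2 ler_wpM2l.
  - by rewrite lef_pV2 ?posrE ?addr_gt0// lerD2l mb.
have EG q : \int[P]_w G q w <= 0.
  apply: (ler_cvg_to (cvg_cst _) (total_rate_cvg eX eY)).
  near=> n.
  have qn : (q.+1 <= n.+1)%N by near: n; exact: nbhs_infty_ge.
  rewrite /total -sumrB -/(D n _) -(big_mkord xpredT (D n)).
  have h1 : (q * n.+1 <= q.+1 * n.+1)%N by rewrite leq_mul2r leqnSn orbT.
  have h2 : (q.+1 * n.+1 <= n.+1 * n.+1)%N by rewrite leq_mul2r qn orbT.
  rewrite (@big_cat_nat _ _ _ (q * n.+1))//=; last exact: leq_trans h2.
  rewrite (@big_cat_nat _ _ _ (q.+1 * n.+1) (q * n.+1))//=.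
  apply: (@le_trans _ _ (\sum_(q * n.+1 <= k < q.+1 * n.+1) D n k)).
    apply: (@le_trans _ _ (\sum_(q * n.+1 <= k < q.+1 * n.+1) n.+1%:R^-1 * \int[P]_w G q w)).
      rewrite sumr_const_nat -mulnBl subSnn mul1n -mulrnAl -[_ *+ _]mulr_natl.
      by rewrite divff ?pnatr_eq0// mul1r.
    by rewrite big_nat_cond [leRHS]big_nat_cond; apply: ler_sum => k; rewrite andbT => /andP[]; exact: DG.
  have s1 : 0 <= \sum_(0 <= k < q * n.+1) D n k by apply: sumr_ge0.
  have s2 : 0 <= \sum_(q.+1 * n.+1 <= k < n.+1 * n.+1) D n k by apply: sumr_ge0.
  by rewrite -[leLHS]add0r lerD// lerDl.
have Gae : {ae P, forall w, forall q, G q w = 0}.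
  by apply: ae_foralln => q; exact: mean_ge0_eq0 (bG q) (G0 q) (EG q).
apply: filterS3 Gae (good_path eX) (good_path eY) => w Gw [z0 mz exX cX] [_ _ exY cY] t t0.
have mD := euler_path_sub_monotone mphi mz exX exY (fun t _ => XY t w).
have [q tq] : exists q : nat, t <= q%:R.
  by exists (Num.truncn t).+1; apply: ltW; rewrite truncnS_gt.
have q0 : (0 : R) <= q%:R by [].
apply/eqP; rewrite eq_le XY/= -subr_le0; apply: (le_trans (mD _ _ t0 tq)).
have := Gw q; rewrite /G => /eqP; rewrite mulf_eq0 invr_eq0 [X in _ || X]gt_eqF ?addr_gt0//.
rewrite orbF mulf_eq0 gt_eqF ?expR_gt0//= subr_eq0 -[X in X == _]expR0 => /eqP/expR_inj/eqP.
by rewrite eq_sym oppr_eq0 mulf_eq0 pnatr_eq0/= cX// cY// => /eqP ->.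
Unshelve. all: by end_near. Qed.

End euler_process.

(** * Pathwise uniqueness *)

Section pathwise_uniqueness.
Context d (T : measurableType d) (R : realType) (P : probability T R).
Variables (F : R -> set (set T)) (alpha : R) (Z : R -> T -> R) (phi : R -> R).
Hypothesis hF : usual_conditions P F.
Hypothesis alpha0 : 0 < alpha.
Hypothesis alpha1 : alpha < 1.
Hypothesis hZ : one_sided_stable P F alpha Z.
Hypothesis phic : continuous phi.
Hypothesis mphi : forall x y : R, x <= y -> phi x <= phi y.
Hypothesis phi0 : forall x : R, 0 < phi x.

Lemma sde_solution_euler x0 X : sde_solution P F phi Z x0 X ->
  euler_process P F Z phi x0 X.
Proof.
move=> [cX aX]; move: (stable_monotone hF alpha0 alpha1 hZ) (stable_pure_jump hF alpha0 alpha1 hZ).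
move=> h1 h2 h3; split => //.
apply: filterS3 h1 h2 h3 => w mz pz xE.
have cz := levy_cadlag hZ.1 w.
split; first exact: (jump_solution0 phi0 mz cz xE).
exact: (jump_solution_euler phic mphi phi0 mz cz pz (cX w) xE).
Qed.

Lemma euler_process_max x0 X Y : euler_process P F Z phi x0 X ->
  euler_process P F Z phi x0 Y ->
  euler_process P F Z phi x0 (fun t w => Num.max (X t w) (Y t w)).
Proof.
move=> [aX hX] [aY hY]; split; first exact: (adapted_max hF).
apply: filterS3 (stable_monotone hF alpha0 alpha1 hZ) hX hY => w mz [x0E eX] [y0E eY].
by split; [rewrite x0E y0E maxxx|exact: euler_path_max].
Qed.

(** Both solutions coincide with their maximum. The set of good outcomes is
    measurable because the usual conditions put null sets in F 0. *)
Lemma stable_pathwise_unique : pathwise_unique P F phi Z.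
Proof.
move=> x0 X X' sX sX'.
have eX := sde_solution_euler sX; have eX' := sde_solution_euler sX'.
have [kappa kappa0 lap] := stable_laplace hF alpha0 alpha1 hZ.
have eM := euler_process_max eX eX'.
have h1 : {ae P, forall w t, 0 <= t -> X t w = Num.max (X t w) (X' t w)}.
  apply: (euler_process_eq hF alpha0 alpha1 hZ phic mphi phi0 kappa0 lap eX eM).
  by move=> t w; rewrite le_max lexx.
have h2 : {ae P, forall w t, 0 <= t -> X' t w = Num.max (X t w) (X' t w)}.
  apply: (euler_process_eq hF alpha0 alpha1 hZ phic mphi phi0 kappa0 lap eX' eM).
  by move=> t w; rewrite le_max lexx orbT.
set A := [set w | _].
have nA : P.-negligible (~` A).
  have : {ae P, forall w t, 0 <= t -> X t w = X' t w}.
    by apply: filterS2 h1 h2 => w e1 e2 t t0; rewrite e1// -e2.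
  by [].
have mA : measurable (~` A).
  exact: (usual_sub hF (lexx 0)) (usual_null hF nA).
have P0 : P (~` A) = 0%E by apply/(negligibleP P mA).
rewrite -[A]setCK probability_setC// P0 sube0 //.
Qed.

End pathwise_uniqueness.

Unset Implicit Arguments.

Theorem theorem1p2 (d : measure_display) (T : measurableType d) (R : realType)
    (P : probability T R) (F : R -> set (set T)) (alpha : R)
    (Z : R -> T -> R) (phi : R -> R)
    (hF : usual_conditions P F)
    (halpha0 : 0 < alpha) (halpha1 : alpha < 1)
    (hZ : one_sided_stable P F alpha Z)
    (phi_continuous : continuous phi)
    (phi_nondecreasing : forall x y : R, x <= y -> phi x <= phi y)
    (phi_positive : forall x : R, 0 < phi x) :
  pathwise_unique P F phi Z.
Proof.
exact: (stable_pathwise_unique hF halpha0 halpha1 hZ phi_continuous phi_nondecreasing phi_positive).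
Qed.
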